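(* Let $M=\Lambda^2_-(T^*\mathcal{S}^4)$ with the Bryant--Salamon $\mathrm{G}_2$-structure $\varphi_c$ ($c>0$) and $M_0=M\setminus\mathcal{S}^4$ with $\varphi_0$, with their coassociative fibrations $\pi_c$ and $\pi_0$ over $\mathbb{R}^3$. There is a natural $\mathrm{SU}(2)$-structure on each smooth coassociative $T^*\mathcal{S}^2$ fibre in $M$ or $M_0$ such that the zero section $\mathcal{S}^2$ is special Lagrangian. Hence, there are special Lagrangian representatives for the ''vanishing cycles'' of the coassociative fibration.
   Context: Ambient structure. On the round $\mathcal{S}^4$ of curvature $1$, with local oriented orthonormal coframe $b_0,\dots,b_3$, put $\Omega_1=b_0\wedge b_1-b_2\wedge b_3$, $\Omega_2=b_0\wedge b_2-b_3\wedge b_1$, $\Omega_3=b_0\wedge b_3-b_1\wedge b_2$, let $\rho_i$ be the 1-forms of the induced connection, $d\Omega_1=2\rho_3\wedge\Omega_2-2\rho_2\wedge\Omega_3$, $d\Omega_2=2\rho_1\wedge\Omega_3-2\rho_3\wedge\Omega_1$, $d\Omega_3=2\rho_2\wedge\Omega_1-2\rho_1\wedge\Omega_2$, let $(a_1,a_2,a_3)$ be fibre coordinates with respect to $\Omega_i$, $r^2=\sum a_i^2$, and $\zeta_1=da_1-2a_2\rho_3+2a_3\rho_2$, $\zeta_2=da_2-2a_3\rho_1+2a_1\rho_3$, $\zeta_3=da_3-2a_1\rho_2+2a_2\rho_1$. Then $\varphi_c=(c+r^2)^{-3/4}\zeta_1\wedge\zeta_2\wedge\zeta_3+2(c+r^2)^{1/4}\sum_i\zeta_i\wedge\Omega_i$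 and its metric is $g_c=(c+r^2)^{-1/2}(\zeta_1^2+\zeta_2^2+\zeta_3^2)+2(c+r^2)^{1/2}(b_0^2+b_1^2+b_2^2+b_3^2)$. Coordinates. With $\mathbb{R}^5=\mathbb{R}^3\oplus\mathbb{R}^2$, write points of $\mathcal{S}^4$ as $(\cos\alpha\cos\theta,\cos\alpha\sin\theta\cos\phi,\cos\alpha\sin\theta\sin\phi,\sin\alpha\cos\beta,\sin\alpha\sin\beta)$, with coframe $b_0=d\alpha$, $b_1=\sin\alpha\,d\beta$, $b_2=\cos\alpha\,d\theta$, $b_3=\cos\alpha\sin\theta\,d\phi$, and $a_1=t$, $a_2=s\cos\gamma$, $a_3=s\sin\gamma$, $s\ge0$; put $\rho=s\cos\alpha$ and $\sigma_1=d\gamma+\cos\theta\,d\phi$, $\sigma_2=\cos\gamma\,d\theta+\sin\gamma\sin\theta\,d\phi$, $\sigma_3=\sin\gamma\,d\theta-\cos\gamma\sin\theta\,d\phi$. Fibration. $\pi_c=(t\cos\alpha,\,2(c+s^2+t^2)^{1/4}\sin\alpha\cos\beta,\,2(c+s^2+t^2)^{1/4}\sin\alpha\sin\beta)=(u,v\cos\beta,v\sin\beta)$, $c\ge0$. Its fibres are coassociative; the smooth ones, i.e. those not over the circle $u=0,v=2c^{1/4}$ (if $c>0$) or the origin (if $c=0$), are diffeomorphic to $T^*\mathcal{S}^2$, with zero section (the ''bolt'') the locus $\rho=0$. Along a path in the base from a smooth fibre to a singular fibre these 2-spheres collapse to a point; they are the vanishing cycles. $\mathrm{SU}(2)$-structure.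 On a smooth fibre $N$, an $\mathrm{SU}(2)$-structure here means an almost Hermitian structure $(g,J,\omega)$ with $g(\cdot,\cdot)=\omega(\cdot,J\cdot)$ together with a complex 2-form $\Omega=\mathrm{Re}\,\Omega+i\,\mathrm{Im}\,\Omega$ of type $(2,0)$ with respect to $J$; neither closedness of $\Omega$ nor a normalization of its pointwise length away from the zero section is required. ''Natural'' means that it is built from the geometry induced on $N$ by $\varphi_c$: $g=g_c|_N$ is the induced metric and $\omega=\sqrt2\,(d\rho\wedge\sigma_3+\rho\,\sigma_1\wedge\sigma_2)$, which (where $v\ne0$) is the multiple $\frac{\sqrt2}{v}\omega_3$ of the induced 2-form $\omega_3=(n_3\lrcorner\varphi_c)|_N$, $n_3$ being the normal vector field with $du(n_3)=dv(n_3)=0$, $d\beta(n_3)=1$. An oriented surface $\Sigma\subset N$ is special Lagrangian if $\omega|_\Sigma=0$ and $\Sigma$ is calibrated by $\mathrm{Re}\,\Omega$, i.e. $\mathrm{Re}\,\Omega|_\Sigma=\mathrm{vol}_\Sigma$ (and $\mathrm{Im}\,\Omega|_\Sigma=0$). *)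

(* Defs.v *)
From HB Require Import structures.
From mathcomp Require Import all_boot all_order all_algebra.
From mathcomp Require Import all_classical all_reals all_analysis.

Set Implicit Arguments.
Unset Strict Implicit.
Unset Printing Implicit Defensive.

Import Order.TTheory GRing.Theory Num.Theory.
Import numFieldNormedType.Exports.

Local Open Scope classical_set_scope.
Local Open Scope ring_scope.

(* The bundle Lambda^2_-(T^*S^4) is realised as a submanifold of the vector
   space E = R^5 x M_5(R): the point (x, A) consists of x in the unit sphere
   S^4 and of the 2-form (X, Y) |-> X A Y^T, where A is antisymmetric,
   A x = 0, and the form is anti-self-dual on T_x S^4.  Indices run from 0,
   so that the splitting R^5 = R^3 + R^2 is {0,1,2} + {3,4}. *)

Section SmoothMaps.
Context {R : realType}.

Fixpoint Ck {V W : normedModType R} (k : nat) (U : set V) (f : V -> W) : Prop :=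
  match k with
  | 0 => forall x, U x -> {for x, continuous f}
  | k'.+1 => (forall x, U x -> differentiable f x) /\
             forall v, Ck k' U (fun x => 'D_v f x)
  end.

Definition smooth_on {V W : normedModType R} (U : set V) (f : V -> W) : Prop :=
  forall k, Ck k U f.

Definition dot {n : nat} (x y : 'rV[R]_n) : R := (x *m y^T) 0 0.

Definition S2 : set 'rV[R]_3 := [set y | dot y y = 1].

Definition row3 (x y z : 'rV[R]_3) : 'M[R]_3 := \matrix_(i < 3) nth 0 [:: x; y; z] i.

Definition row5 (x y z u v : 'rV[R]_5) : 'M[R]_5 :=
  \matrix_(i < 5) nth 0 [:: x; y; z; u; v] i.

Definition vec5 (x0 x1 x2 x3 x4 : R) : 'rV[R]_5 :=
  \row_(j < 5) nth 0 [:: x0; x1; x2; x3; x4] j.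

End SmoothMaps.

(* Tensor fields along a subset N of a normed space with a field T of tangent
   spaces: a field is a function of the point p and of vectors, and only its
   values for p in N and vectors in T p matter.  A field is smooth when it is
   locally the restriction of a smooth field on an open set of the ambient
   space. *)
Section TensorFields.
Context {R : realType} {V : normedModType R}.
Variables (N : set V) (T : V -> set V).

Definition bilin (b : V -> V -> R) : Prop :=
  (forall a X Y Z, b (a *: X + Y) Z = a * b X Z + b Y Z) /\
  (forall a X Y Z, b Z (a *: X + Y) = a * b Z X + b Z Y).

Definition smooth_bilin (b : V -> V -> V -> R) : Prop :=
  forall p, N p -> exists (U : set V) (B : V -> V -> V -> R),
    [/\ open U, U p,
        forall q, bilin (B q),
        forall X Y, smooth_on U (fun q => B q X Y : R^o) &
        forall q X Y, U q -> N q -> T q X -> T q Y -> b q X Y = B q X Y].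

Definition smooth_endo (J : V -> V -> V) : Prop :=
  (forall p X, N p -> T p X -> T p (J p X)) /\
  forall p, N p -> exists (U : set V) (K : V -> V -> V),
    [/\ open U, U p,
        forall q a X Y, K q (a *: X + Y) = a *: K q X + K q Y,
        forall X, smooth_on U (fun q => K q X) &
        forall q X, U q -> N q -> T q X -> J q X = K q X].

Definition form2 (b : V -> V -> V -> R) : Prop :=
  smooth_bilin b /\ forall p X, N p -> T p X -> b p X X = 0.

Definition metric (g : V -> V -> V -> R) : Prop :=
  [/\ smooth_bilin g,
      forall p X Y, N p -> T p X -> T p Y -> g p X Y = g p Y X &
      forall p X, N p -> T p X -> X != 0 -> 0 < g p X X].

End TensorFields.

(* The complex 2-form is Omega = ReO + i ImO. *)
Record su2data {R : realType} (V : normedModType R) := SU2Data {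
  metr : V -> V -> V -> R;
  cplx : V -> V -> V;
  omeg : V -> V -> V -> R;
  ReO : V -> V -> V -> R;
  ImO : V -> V -> V -> R }.

Section SU2Structures.
Context {R : realType} {V : normedModType R}.

Definition almost_hermitian (N : set V) (T : V -> set V)
    (g : V -> V -> V -> R) (J : V -> V -> V) (w : V -> V -> V -> R) : Prop :=
  [/\ metric N T g, smooth_endo N T J, form2 N T w,
      forall p X, N p -> T p X -> J p (J p X) = - X &
      forall p X Y, N p -> T p X -> T p Y ->
        g p (J p X) (J p Y) = g p X Y /\ g p X Y = w p X (J p Y)].

(* Type (2,0) is Omega(JX, Y) = i Omega(X, Y).  Omega is required to be nowhere
   zero: only then do (g, J, omega, Omega) reduce the structure group to SU(2),
   up to a positive rescaling of Omega. *)
Definition su2_structure (N : set V) (T : V -> set V) (S : su2data V) : Prop :=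
  [/\ almost_hermitian N T (metr S) (cplx S) (omeg S),
      form2 N T (ReO S), form2 N T (ImO S),
      forall p X Y, N p -> T p X -> T p Y ->
        ReO S p (cplx S p X) Y = - ImO S p X Y /\
        ImO S p (cplx S p X) Y = ReO S p X Y &
      forall p, N p -> exists X Y,
        [/\ T p X, T p Y & ReO S p X Y != 0 \/ ImO S p X Y != 0]].

(* iota is an embedding of the 2-sphere with image Sigma (injective immersions
   of S^2 are embeddings by compactness; a smooth map on S^2 always extends to
   R^3). *)
Definition embedded_sphere (iota : 'rV[R]_3 -> V) (Sigma : set V) : Prop :=
  [/\ smooth_on setT iota,
      {in S2 &, injective iota},
      forall y X, S2 y -> dot y X = 0 -> 'd iota y X = 0 -> X = 0 &
      iota @` S2 = Sigma].

(* The surface iota(S^2), oriented by the outward normal of S^2 in R^3.  (The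
   opposite orientation is obtained with y |-> iota (- y).) *)
Definition special_lagrangian (S : su2data V) (iota : 'rV[R]_3 -> V) : Prop :=
  forall y X Y, S2 y -> dot y X = 0 -> dot y Y = 0 ->
    let p := iota y in let X' := 'd iota y X in let Y' := 'd iota y Y in
    [/\ omeg S p X' Y' = 0,
        ImO S p X' Y' = 0 &
        0 < \det (row3 y X Y) ->
        ReO S p X' Y' =
          Num.sqrt (metr S p X' X' * metr S p Y' Y' - metr S p X' Y' ^+ 2)].

End SU2Structures.

Section BryantSalamon.
Context {R : realType}.

Local Notation E := ('rV[R]_5 * 'M[R]_5)%type.

Definition ev (A : 'M[R]_5) (X Y : 'rV[R]_5) : R := (X *m A *m Y^T) 0 0.

(* The Hodge star of T_x S^4, oriented by det(x, e_0, .., e_3) > 0, extended to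
   R^5 so that x lies in the kernel of the resulting form. *)
Definition star (x : 'rV[R]_5) (A : 'M[R]_5) : 'M[R]_5 :=
  \matrix_(i < 5, j < 5) (2^-1 * \sum_(k < 5) \sum_(l < 5) A k l *
    \det (row5 x (delta_mx 0 i) (delta_mx 0 j) (delta_mx 0 k) (delta_mx 0 l))).

(* A = - star x A already forces A^T = - A and A x = 0. *)
Definition constraint (p : E) : R^o * 'M[R]_5 := (dot p.1 p.1 - 1, p.2 + star p.1 p.2).

(* r^2 = a_1^2 + a_2^2 + a_3^2: each Omega_i has matrix norm squared 4. *)
Definition rsq (A : 'M[R]_5) : R := 4^-1 * \sum_(i < 5) \sum_(j < 5) A i j ^+ 2.

(* M if c > 0, and M_0 = M \ S^4 if c = 0. *)
Definition total (c : R) : set E := [set p | constraint p = 0 /\ 0 < c + rsq p.2].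

(* Tangent spaces of level sets are kernels of differentials. *)
Definition tanM (p : E) : set E := [set w | 'd constraint p w = 0].

(* Oriented orthonormal frames e_0, .., e_3 (rows of e) of T_x S^4. *)
Definition oframe (x : 'rV[R]_5) (e : 'M[R]_(4, 5)) : Prop :=
  let Q : 'M[R]_5 := col_mx x e in Q *m Q^T = 1%:M /\ \det Q = 1.

Definition wedge (X Y : 'rV[R]_5) : 'M[R]_5 := X^T *m Y - Y^T *m X.

Definition Om (e : 'M[R]_(4, 5)) (i : 'I_3) : 'M[R]_5 :=
  nth 0 [:: wedge (row 0 e) (row 1 e) - wedge (row 2 e) (row 3 e);
            wedge (row 0 e) (row 2 e) - wedge (row 3 e) (row 1 e);
            wedge (row 0 e) (row 3 e) - wedge (row 1 e) (row 2 e)] i.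

(* The coframe forms b_0, .., b_3, pulled back to M. *)
Definition bform (e : 'M[R]_(4, 5)) (k : 'I_4) (w : E) : R := dot (row k e) w.1.

(* zeta_i = da_i + (connection terms) is the Omega_i-component of the covariant
   derivative of the tautological section.  The Levi-Civita connection of S^4
   is the tangential part of the derivative in R^5, and the Omega_i-component
   of an anti-self-dual form is its value on (e_0, e_i). *)
Definition zeta (e : 'M[R]_(4, 5)) (i : 'I_3) (w : E) : R :=
  ev w.2 (row 0 e) (row (lift 0 i) e).

Definition gBS (c : R) (e : 'M[R]_(4, 5)) (p w1 w2 : E) : R :=
  (c + rsq p.2) `^ (- 2^-1) * (\sum_(i < 3) zeta e i w1 * zeta e i w2) +
  2 * (c + rsq p.2) `^ (2^-1) * (\sum_(k < 4) bform e k w1 * bform e k w2).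

Definition phiBS (c : R) (e : 'M[R]_(4, 5)) (p w1 w2 w3 : E) : R :=
  (c + rsq p.2) `^ (- (3 / 4)) *
    \det (\matrix_(i < 3, j < 3) zeta e i (nth 0 [:: w1; w2; w3] j)) +
  2 * (c + rsq p.2) `^ (4^-1) * (\sum_(i < 3)
    (zeta e i w1 * ev (Om e i) w2.1 w3.1 + zeta e i w2 * ev (Om e i) w3.1 w1.1 +
     zeta e i w3 * ev (Om e i) w1.1 w2.1)).

(* In the coordinates below, A 3 4 = t cos(alpha): on the two coordinate
   vectors of R^2 the forms b_2, b_3 vanish and b_0 /\ b_1 is cos(alpha). *)
Definition fibration (c : R) (p : E) : R^o * R^o * R^o :=
  (p.2 3 4, 2 * (c + rsq p.2) `^ (4^-1) * p.1 0 3,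
            2 * (c + rsq p.2) `^ (4^-1) * p.1 0 4).

Definition base (u v beta : R) : R^o * R^o * R^o := (u, v * cos beta, v * sin beta).

Definition singular (c : R) (P : R^o * R^o * R^o) : Prop :=
  exists beta, P = base 0 (2 * c `^ (4^-1)) beta.

Definition fibre (c : R) (P : R^o * R^o * R^o) : set E :=
  [set p | total c p /\ fibration c p = P].

Definition tanN (c : R) (p : E) : set E :=
  [set w | tanM p w /\ 'd (fibration c) p w = 0].

(* Coordinates (alpha, beta, theta, phi, t, s, gamma).  The coordinate
   functions are linear on R^7, so on tangent vectors of R^7 they also give
   the differentials d alpha, .., d gamma. *)
Definition alpha_ (xi : 'rV[R]_7) : R := xi 0 0.
Definition beta_ (xi : 'rV[R]_7) : R := xi 0 1.
Definition theta_ (xi : 'rV[R]_7) : R := xi 0 2.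
Definition phi_ (xi : 'rV[R]_7) : R := xi 0 3.
Definition t_ (xi : 'rV[R]_7) : R := xi 0 4.
Definition s_ (xi : 'rV[R]_7) : R := xi 0 5.
Definition gamma_ (xi : 'rV[R]_7) : R := xi 0 6.

Definition chart_x (xi : 'rV[R]_7) : 'rV[R]_5 :=
  let a := alpha_ xi in let b := beta_ xi in
  let th := theta_ xi in let ph := phi_ xi in
  vec5 (cos a * cos th) (cos a * sin th * cos ph) (cos a * sin th * sin ph)
       (sin a * cos b) (sin a * sin b).

(* The frame dual to the coframe d alpha, sin(alpha) d beta,
   cos(alpha) d theta, cos(alpha) sin(theta) d phi. *)
Definition chart_frame (xi : 'rV[R]_7) : 'M[R]_(4, 5) :=
  let a := alpha_ xi in let b := beta_ xi in
  let th := theta_ xi in let ph := phi_ xi in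
  \matrix_(k < 4) nth 0
    [:: vec5 (- sin a * cos th) (- sin a * sin th * cos ph) (- sin a * sin th * sin ph)
             (cos a * cos b) (cos a * sin b);
        vec5 0 0 0 (- sin b) (cos b);
        vec5 (- sin th) (cos th * cos ph) (cos th * sin ph) 0 0;
        vec5 0 (- sin ph) (cos ph) 0 0] k.

Definition chart (xi : 'rV[R]_7) : E :=
  (chart_x xi,
   t_ xi *: Om (chart_frame xi) 0 +
   (s_ xi * cos (gamma_ xi)) *: Om (chart_frame xi) 1 +
   (s_ xi * sin (gamma_ xi)) *: Om (chart_frame xi) 2).

Definition rho_ (xi : 'rV[R]_7) : R := s_ xi * cos (alpha_ xi).

Definition drho (xi X : 'rV[R]_7) : R :=
  cos (alpha_ xi) * s_ X - s_ xi * sin (alpha_ xi) * alpha_ X.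

Definition sigma1 (xi X : 'rV[R]_7) : R := gamma_ X + cos (theta_ xi) * phi_ X.
Definition sigma2 (xi X : 'rV[R]_7) : R :=
  cos (gamma_ xi) * theta_ X + sin (gamma_ xi) * sin (theta_ xi) * phi_ X.
Definition sigma3 (xi X : 'rV[R]_7) : R :=
  sin (gamma_ xi) * theta_ X - cos (gamma_ xi) * sin (theta_ xi) * phi_ X.

(* sqrt 2 (d rho /\ sigma_3 + rho sigma_1 /\ sigma_2) *)
Definition omega_chart (xi X Y : 'rV[R]_7) : R :=
  Num.sqrt 2 * ((drho xi X * sigma3 xi Y - drho xi Y * sigma3 xi X) +
    rho_ xi * (sigma1 xi X * sigma2 xi Y - sigma1 xi Y * sigma2 xi X)).

(* Where the coordinates are regular on the fibres; alpha = 0 is allowed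
   because beta is constant on a fibre. *)
Definition regular_chart (xi : 'rV[R]_7) : Prop :=
  [/\ 0 <= alpha_ xi < pi / 2, 0 < theta_ xi < pi & 0 < s_ xi].

(* The first clause is g = g_c|_N.  The second one is the formula for omega,
   read in the coordinates with constant beta: on a fibre with v = 0, where
   beta is not determined, this depends on the choice of beta.  The third one
   is omega = (sqrt 2 / v) (n_3 _| phi_c)|_N, where du(n_3) = dv(n_3) = 0 and
   d beta(n_3) = 1 say that n_3 is mapped to the vector d/d beta of the base. *)
Definition natural (c u v beta : R) (S : su2data E) : Prop :=
  let N := fibre c (base u v beta) in
  [/\ forall p e X Y, N p -> oframe p.1 e -> tanN c p X -> tanN c p Y ->
        metr S p X Y = gBS c e p X Y,
      forall xi X Y, regular_chart xi -> beta_ xi = beta -> N (chart xi) ->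
        beta_ X = 0 -> tanN c (chart xi) ('d chart xi X) ->
        beta_ Y = 0 -> tanN c (chart xi) ('d chart xi Y) ->
        omeg S (chart xi) ('d chart xi X) ('d chart xi Y) = omega_chart xi X Y &
      v != 0 -> forall p e n3 X Y, N p -> oframe p.1 e -> tanM p n3 ->
        (forall Z, tanN c p Z -> gBS c e p n3 Z = 0) ->
        'd (fibration c) p n3 = (0, - v * sin beta, v * cos beta) ->
        tanN c p X -> tanN c p Y ->
        omeg S p X Y = Num.sqrt 2 / v * phiBS c e p n3 X Y].

(* The zero section of a fibre: the locus rho = 0. *)
Definition bolt (c : R) (P : R^o * R^o * R^o) : set E :=
  [set p | fibre c P p /\ exists xi, [/\ p = chart xi,
     0 <= alpha_ xi <= pi / 2, 0 <= s_ xi & rho_ xi = 0]].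

Definition SLag_in_fibre (c u v beta : R) (Sigma : set E) : Prop :=
  exists S : su2data E,
    [/\ su2_structure (fibre c (base u v beta)) (tanN c) S,
        natural c u v beta S &
        exists iota, embedded_sphere iota Sigma /\ special_lagrangian S iota].

(* The intrinsic g_c-diameter of Sigma tau tends to 0 as tau tends to 1 from
   below (for c = 0 there is no limit point in M_0: it is the cone point). *)
Definition collapses (c : R) (Sigma : R -> set E) : Prop :=
  forall eps : R, 0 < eps -> \forall tau \near 1^'-, forall p q,
    Sigma tau p -> Sigma tau q -> exists h : R -> E,
    [/\ h 0 = p, h 1 = q &
        forall l, 0 <= l <= 1 ->
          [/\ Sigma tau (h l), derivable h l 1 &
              forall e, oframe (h l).1 e ->
                gBS c e (h l) ('D_1 h l) ('D_1 h l) < eps ^+ 2]].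

Definition path_to_singular (c : R) (P : R -> R^o * R^o * R^o) : Prop :=
  [/\ {within `[0, 1], continuous P},
      forall tau, 0 <= tau < 1 -> ~ singular c (P tau) &
      singular c (P 1)].

Definition vanishing_cycle (c : R) (P : R -> R^o * R^o * R^o) (Sigma : set E) : Prop :=
  Sigma = bolt c (P 0) /\ collapses c (fun tau => bolt c (P tau)).

End BryantSalamon.

(* Main.v *)
Require Import Defs.
From HB Require Import structures.
From mathcomp Require Import all_boot all_order all_algebra.
From mathcomp Require Import all_classical all_reals all_analysis.
From mathcomp Require Import ring lra.
Import Order.TTheory GRing.Theory Num.Theory.
Import numFieldNormedType.Exports.
Set Implicit Arguments.
Unset Strict Implicit.
Unset Printing Implicit Defensive.
Local Open Scope classical_set_scope.
Local Open Scope ring_scope.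

(* A rotation by beta in the plane of the last two coordinates brings the fibre
   over (u, v cos beta, v sin beta) to a normal form: x = (x', m, 0), and A is
   determined by its last column a = (a', u, 0), where |x| = 1, x . a = 0 and
   v = 2 (c + |a|^2)^(1/4) m.  In these coordinates omega = sqrt 2 sum da_i /\ dx_i,
   and with l = sqrt 2 (c + |a|^2)^(1/2) the almost complex structure multiplies
   the C^4-valued form l dx - i da by i, modulo x.  Hence, e being the fourth
   unit vector, k det(x, l e - i m a, l dx - i da, l dx - i da) is of type (2,0)
   for every complex constant k; the geometry of the fibre makes it nowhere zero.

   The bolt is the image of the sphere y |-> x = C y + S e, a = t (C e - S y),
   with C^2 + S^2 = 1, t C = u and 2 (c + t^2)^(1/4) S = v.  There omega vanishes
   and the determinant form is a constant complex multiple of the area form,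
   which k normalises to 1.  The bolt carries a multiple of the round metric,
   and the factor tends to 0 on the way to a singular fibre, so that the image
   of the path which is affine in polar coordinates is short. *)

(** Origin of the determinant form: put p = l e + i m a, with e projected off x. On the fibre every
    w = l dx - i da satisfies p . w = 0 modulo x: the real part says that q m is constant, the
    imaginary part is the derivative of x . a = 0. So w stays in a complex plane of the complement
    of x, and the conjugate l e - i m a is transverse to this plane because p . conj p > 0 off the
    singular points; the determinant is thus a complex area form of that plane. The same relation
    gives omega: n_3 satisfies it too, three vectors of a complex plane have zero 3x3 determinant,
    and this removes from n_3 _| phi_c everything but a multiple of omega. Two obstacles shape the
    rest. The metric and the 3-form are given through arbitrary frames, so they are first rewritten
    as traces and then evaluated in one convenient frame. And C, S, t have in general no simple
    closed form: for u <> 0, q = C^2 is a root in [0, 1] of (c q + u^2) (1 - q)^2 = (v/2)^4 q, so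
    existence, uniqueness and the collapse are all drawn from this equation. *)

Local Notation tanN := Defs.tanN.
Local Notation total := Defs.total.

(** * Smooth maps *)

Section Smooth.
Context {R : realType} {V : normedModType R}.
Implicit Types (U : set V).

Lemma near_eq_differentiable (W : normedModType R) (f g : V -> W) x :
  (\forall y \near x, f y = g y) -> differentiable f x -> differentiable g x.
Proof.
move=> fg df.
have gE : g \o shift x = cst (g x) + 'd f x +o_ 0 id.
  apply/eqaddoP => e e0.
  have /diff_locally/eqaddoP/(_ e e0) := df.
  have := fg; rewrite (near_shift 0) => fg0.
  apply: filterS2 fg0 => y /=; rewrite subr0.
  have -> : f x = g x by exact: nbhs_singleton fg.
  by rewrite /= !fctE /= => ->.
apply/diff_locallyP; have cdf : continuous ('d f x) by exact: diff_continuous.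
by rewrite (diff_unique cdf gE).
Qed.

(** The rules of differentiation used below hold only at points of [U]. As [U] is open, equality on
    [U] passes to directional derivatives there, which lets the inductions on [k] replace a
    derivative by its formula. *)
Lemma Ck_ext (W : normedModType R) k U (f g : V -> W) :
  open U -> (forall x, U x -> f x = g x) -> Ck k U f -> Ck k U g.
Proof.
move=> oU; elim: k f g => [|k IH] f g fg /=.
  move=> cf x Ux; rewrite /prop_for/continuous_at -fg//.
  apply: cvg_trans (cf x Ux); apply: near_eq_cvg.
  by near do rewrite fg//; exact: open_nbhs_nbhs.
have nfg x : U x -> \forall y \near x, f y = g y.
  by move=> Ux; near do rewrite fg//; exact: open_nbhs_nbhs.
case=> df dfk; split=> [x Ux|v].
  by apply: near_eq_differentiable (df x Ux); exact: nfg.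
by apply: IH (dfk v) => x Ux; apply: near_eq_derive; exact: nfg.
Unshelve. all: by end_near. Qed.

Lemma CkW (W : normedModType R) k U (f : V -> W) : Ck k.+1 U f -> Ck k U f.
Proof.
elim: k f => [|k IH] f [df dfk].
  by move=> x /df; exact: differentiable_continuous.
by split=> // v; apply: IH.
Qed.

Lemma smooth_differentiable (W : normedModType R) U (f : V -> W) x :
  smooth_on U f -> U x -> differentiable f x.
Proof. by move=> /(_ 1%N)[df _] /df. Qed.

Lemma smooth_cst (W : normedModType R) U (w : W) : smooth_on U (fun _ : V => w).
Proof.
move=> k; elim: k w => [|k IH] w; first by move=> x _; exact: cst_continuous.
split=> [x _|v]; first exact: differentiable_cst.
by under eq_fun do rewrite derive_cst.
Qed.

Lemma smooth_linear (W : normedModType R) U (f : {linear V -> W}) :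
  continuous f -> smooth_on U f.
Proof.
move=> cf [|k]; first by move=> x _; exact: cf.
split=> [x _|v]; first exact: linear_differentiable.
have -> : (fun x => 'D_v f x) = fun=> f v.
  apply/funext => x; rewrite deriveE; last exact: linear_differentiable.
  by rewrite diff_lin.
exact: smooth_cst.
Qed.

Lemma CkD (W : normedModType R) k U (f g : V -> W) :
  open U -> Ck k U f -> Ck k U g -> Ck k U (fun x => f x + g x).
Proof.
move=> oU; elim: k f g => [|k IH] f g.
  by move=> cf cg x Ux; apply: continuousD; [exact: cf|exact: cg].
move=> [df dfk] [dg dgk]; split=> [x Ux|v].
  by apply: differentiableD; [exact: df|exact: dg].
apply: Ck_ext (IH _ _ (dfk v) (dgk v)) => // x Ux.
by rewrite deriveD//; apply: diff_derivable; [exact: df|exact: dg].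
Qed.

Lemma CkM k U (f g : V -> R^o) :
  open U -> Ck k U f -> Ck k U g -> Ck k U (fun x => f x * g x : R^o).
Proof.
move=> oU; elim: k f g => [|k IH] f g.
  by move=> cf cg x Ux; apply: continuousM; [exact: cf|exact: cg].
move=> cf cg; have [df dfk] := cf; have [dg dgk] := cg; split=> [x Ux|v].
  by apply: differentiableM; [exact: df|exact: dg].
apply: (@Ck_ext _ _ _ (fun x => f x * 'D_v g x + g x * 'D_v f x : R^o)) => //.
  move=> x Ux; rewrite deriveM//; apply: diff_derivable; [exact: df|exact: dg].
by apply: CkD => //; apply: IH => //; try exact: CkW; [exact: dgk|exact: dfk].
Qed.

Lemma CkZl (W : normedModType R) k U (f : V -> R^o) (w : W) :
  open U -> Ck k U f -> Ck k U (fun x => f x *: w).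
Proof.
move=> oU; elim: k f => [|k IH] f.
  by move=> cf x Ux; apply: continuousZr_tmp; exact: cf.
move=> [df dfk]; split=> [x Ux|v].
  by apply: differentiableZl; exact: df.
apply: Ck_ext (IH _ (dfk v)) => // x Ux.
rewrite [RHS]deriveE; last by apply: differentiableZl; exact: df.
by rewrite diffZl ?deriveE//; exact: df.
Qed.

Lemma smoothD (W : normedModType R) U (f g : V -> W) :
  open U -> smooth_on U f -> smooth_on U g -> smooth_on U (fun x => f x + g x).
Proof. by move=> oU sf sg k; exact: CkD. Qed.

Lemma smoothM U (f g : V -> R^o) :
  open U -> smooth_on U f -> smooth_on U g -> smooth_on U (fun x => f x * g x : R^o).
Proof. by move=> oU sf sg k; exact: CkM. Qed.

Lemma smoothZl (W : normedModType R) U (f : V -> R^o) (w : W) :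
  open U -> smooth_on U f -> smooth_on U (fun x => f x *: w).
Proof. by move=> oU sf k; exact: CkZl. Qed.

Lemma smoothN U (f : V -> R^o) :
  open U -> smooth_on U f -> smooth_on U (fun x => - f x : R^o).
Proof.
move=> oU sf; under eq_fun do rewrite -mulN1r.
by apply: smoothM => //; exact: smooth_cst.
Qed.

Lemma smoothB U (f g : V -> R^o) :
  open U -> smooth_on U f -> smooth_on U g -> smooth_on U (fun x => f x - g x : R^o).
Proof. by move=> oU sf sg; apply: smoothD => //; exact: smoothN. Qed.

Lemma smoothX U (f : V -> R^o) n :
  open U -> smooth_on U f -> smooth_on U (fun x => f x ^+ n : R^o).
Proof.
move=> oU sf; elim: n => [|n IH].
  by under eq_fun do rewrite expr0; exact: smooth_cst.
by under eq_fun do rewrite exprS; apply: smoothM.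
Qed.

Lemma smooth_sum (W : normedModType R) U (I : Type) (r : seq I) (P : pred I) (F : I -> V -> W) :
  open U -> (forall i, smooth_on U (F i)) ->
  smooth_on U (fun x => \sum_(i <- r | P i) F i x).
Proof.
move=> oU sF; elim: r => [|i r IH].
  by under eq_fun do rewrite big_nil; exact: smooth_cst.
under eq_fun do rewrite big_cons; case: (P i) => //.
by apply: smoothD.
Qed.

Lemma differentiable_powR (a : R) (x : R) :
  0 < x -> differentiable (fun y : R => y `^ a : R^o) x.
Proof.
move=> x0; apply/derivable1_diffP; apply: derivable_powR.
by rewrite in_itv/= x0.
Qed.

Lemma derive_powR (f : V -> R^o) (a : R) x v :
  differentiable f x -> 0 < f x ->
  'D_v (fun y => f y `^ a : R^o) x = a * f x `^ (a - 1) * 'D_v f x.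
Proof.
move=> df fx0; have dp := differentiable_powR a fx0.
rewrite [LHS]deriveE; last exact: (differentiable_comp df dp).
rewrite [LHS](congr1 (fun h => h v) (diff_comp df dp)) /=.
rewrite -[X in 'd _ _ X = _]mulr1 [LHS]linearZ /=.
rewrite -[RHS]mulrC -deriveE//; congr (_ *: _); rewrite -deriveE//.
exact: (@derive_val _ _ _ _ _ _ _ (is_derive1_powR a fx0)).
Qed.

Lemma smooth_powR U (f : V -> R^o) (a : R) :
  open U -> (forall x, U x -> 0 < f x) -> smooth_on U f ->
  smooth_on U (fun x => f x `^ a : R^o).
Proof.
move=> oU f0 sf k.
have dpf b x : U x -> differentiable (fun x => f x `^ b : R^o) x.
  move=> Ux; have df := smooth_differentiable sf Ux.
  exact: (differentiable_comp df (differentiable_powR b (f0 _ Ux))).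
(* Each derivative lowers the exponent by one, so the induction runs over all [a] at once. *)
elim: k a => [|k IH] a.
  by move=> x Ux; apply: differentiable_continuous; exact: dpf.
split=> [x Ux|v]; first exact: dpf.
apply: (@Ck_ext _ _ _ (fun x => a * f x `^ (a - 1) * 'D_v f x : R^o)) => //.
  move=> x Ux; rewrite derive_powR//; last exact: f0.
  exact: smooth_differentiable sf Ux.
apply: CkM => //; first by apply: CkM => //; exact: smooth_cst.
exact: (sf k.+1).2.
Qed.

End Smooth.

(** * The Hodge star *)

Lemma big_ord5 (S : nmodType) (F : 'I_5 -> S) :
  \sum_(i < 5) F i = F 0 + F 1 + F 2 + F 3 + F 4.
Proof.
rewrite !big_ord_recl big_ord0 addr0 !addrA.
by congr (F _ + F _ + F _ + F _ + F _); apply: val_inj.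
Qed.

Lemma ord5P (P : 'I_5 -> Prop) : P 0 -> P 1 -> P 2 -> P 3 -> P 4 -> forall i, P i.
Proof.
move=> P0 P1 P2 P3 P4 i.
have : i \in [:: 0; 1; 2; 3; 4] by case: i => -[|[|[|[|[|]]]]].
by rewrite !inE => /orP[/eqP->|/orP[/eqP->|/orP[/eqP->|/orP[/eqP->|/eqP->]]]].
Qed.

Section Star.
Context {R : realType}.
Implicit Types (x y z u w : 'rV[R]_5) (A Q : 'M[R]_5).

Definition vol x y z u w : R := \det (row5 x y z u w).

Local Ltac rows := by apply/matrixP => -[[|[|[|[|?]]]] ?] ?; rewrite !mxE.
Lemma volP1 a x x' y z u w : vol (a *: x + x') y z u w = a * vol x y z u w + vol x' y z u w.
Proof.
rewrite -[X in _ = _ + X]mul1r /vol.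
apply: (@determinant_multilinear _ _ _ _ _ 0); last 2 first.
- rows.
- rows.
by rewrite scale1r !rowK.
Qed.
Lemma volP2 a x y y' z u w : vol x (a *: y + y') z u w = a * vol x y z u w + vol x y' z u w.
Proof.
rewrite -[X in _ = _ + X]mul1r /vol.
apply: (@determinant_multilinear _ _ _ _ _ 1); last 2 first.
- rows.
- rows.
by rewrite scale1r !rowK.
Qed.
Lemma volP3 a x y z z' u w : vol x y (a *: z + z') u w = a * vol x y z u w + vol x y z' u w.
Proof.
rewrite -[X in _ = _ + X]mul1r /vol.
apply: (@determinant_multilinear _ _ _ _ _ 2); last 2 first.
- rows.
- rows.
by rewrite scale1r !rowK.
Qed.
Lemma volP4 a x y z u u' w : vol x y z (a *: u + u') w = a * vol x y z u w + vol x y z u' w.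
Proof.
rewrite -[X in _ = _ + X]mul1r /vol.
apply: (@determinant_multilinear _ _ _ _ _ 3); last 2 first.
- rows.
- rows.
by rewrite scale1r !rowK.
Qed.
Lemma volP5 a x y z u w w' : vol x y z u (a *: w + w') = a * vol x y z u w + vol x y z u w'.
Proof.
rewrite -[X in _ = _ + X]mul1r /vol.
apply: (@determinant_multilinear _ _ _ _ _ 4); last 2 first.
- rows.
- rows.
by rewrite scale1r !rowK.
Qed.

Lemma linear_suml (W : lmodType R) (f : W -> R) n (c : 'I_n -> R) (v : 'I_n -> W) :
  (forall a v v', f (a *: v + v') = a * f v + f v') ->
  f (\sum_(k < n) c k *: v k) = \sum_(k < n) c k * f (v k).
Proof.
move=> fl; have f0 : f 0 = 0.
  by have := fl (-1) 0 0; rewrite scaler0 addr0 mulN1r addNr.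
elim: n c v => [|n IH] c v; first by rewrite !big_ord0.
by rewrite !big_ord_recl fl IH.
Qed.

Lemma volM x y z u w Q :
  vol (x *m Q) (y *m Q) (z *m Q) (u *m Q) (w *m Q) = vol x y z u w * \det Q.
Proof.
rewrite /vol -det_mulmx; congr (\det _); apply/row_matrixP => i; rewrite row_mul.
by elim/ord5P: i; rewrite !rowK.
Qed.

Lemma starE x A i j : star x A i j =
  2^-1 * \sum_(k < 5) \sum_(l < 5) A k l *
    vol x (delta_mx 0 i) (delta_mx 0 j) (delta_mx 0 k) (delta_mx 0 l).
Proof. by rewrite mxE. Qed.

Lemma evE A y z : ev A y z = \sum_(i < 5) y 0 i * \sum_(j < 5) z 0 j * A i j.
Proof.
rewrite /ev mxE; under eq_bigr do rewrite !mxE big_distrl/=.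
rewrite exchange_big/=; apply: eq_bigr => i _; rewrite big_distrr/=.
by apply: eq_bigr => j _; rewrite -mulrA [A i j * _]mulrC.
Qed.

Lemma evZ a A y z : ev (a *: A) y z = a * ev A y z.
Proof. by rewrite /ev -scalemxAr -scalemxAl mxE. Qed.

Lemma evD A B y z : ev (A + B) y z = ev A y z + ev B y z.
Proof. by rewrite /ev mulmxDr mulmxDl mxE. Qed.

Lemma ev0 y z : ev 0 y z = 0.
Proof. by rewrite /ev mulmx0 mul0mx mxE. Qed.

Lemma ev_sum n (F : 'I_n -> 'M[R]_5) y z :
  ev (\sum_(k < n) F k) y z = \sum_(k < n) ev (F k) y z.
Proof. by apply: (big_morph (fun A => ev A y z)) => [A B|]; [exact: evD|exact: ev0]. Qed.

Lemma ev_star x A y z : ev (star x A) y z =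
  2^-1 * \sum_(k < 5) \sum_(l < 5) A k l * vol x y z (delta_mx 0 k) (delta_mx 0 l).
Proof.
pose M k l : 'M[R]_5 := \matrix_(i, j)
  vol x (delta_mx 0 i) (delta_mx 0 j) (delta_mx 0 k) (delta_mx 0 l).
have -> : star x A = 2^-1 *: \sum_(k < 5) \sum_(l < 5) A k l *: M k l.
  apply/matrixP => i j; rewrite starE mxE summxE; congr (_ * _).
  apply: eq_bigr => k _; rewrite summxE; apply: eq_bigr => l _.
  by rewrite !mxE.
rewrite evZ ev_sum; congr (_ * _); apply: eq_bigr => k _.
rewrite ev_sum; apply: eq_bigr => l _; rewrite evZ; congr (_ * _).
rewrite evE {2}[y]row_sum_delta (linear_suml (f := fun y => vol x y z _ _)); last first.
  by move=> *; exact: volP2.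
apply: eq_bigr => i _; congr (_ * _).
rewrite {2}[z]row_sum_delta (linear_suml (f := fun z => vol x _ z _ _)).
  by apply: eq_bigr => j _; rewrite mxE.
by move=> *; exact: volP3.
Qed.

Lemma sum_orth Q (f : 'rV[R]_5 -> R) : Q^T *m Q = 1%:M ->
  (forall a v v', f (a *: v + v') = a * f v + f v') ->
  forall k, \sum_(a < 5) Q a k * f (row a Q) = f (delta_mx 0 k).
Proof.
move=> Q1 fl k; rewrite -linear_suml//; congr f.
apply/rowP => j; rewrite summxE.
have := congr1 (fun M : 'M[R]_5 => M k j) Q1; rewrite !mxE eqxx /= eq_sym => <-.
by apply: eq_bigr => a _; rewrite !mxE.
Qed.

Lemma evM A y z Q : ev (Q *m A *m Q^T) y z = ev A (y *m Q) (z *m Q).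
Proof. by rewrite /ev trmx_mul !mulmxA. Qed.

(** The sum over two indices in the star is a contraction, so it may be taken in any orthonormal
    basis; here the basis consists of the rows of [Q]. *)
Lemma ev_star_orth x A y z Q : Q^T *m Q = 1%:M -> ev (star x A) y z =
  2^-1 * \sum_(a < 5) \sum_(b < 5) (Q *m A *m Q^T) a b * vol x y z (row a Q) (row b Q).
Proof.
move=> Q1; rewrite ev_star; congr (_ * _).
have E k l : vol x y z (delta_mx 0 k) (delta_mx 0 l) =
    \sum_(a < 5) \sum_(b < 5) Q a k * Q b l * vol x y z (row a Q) (row b Q).
  rewrite -(sum_orth (f := fun w => vol x y z w _) Q1); last first.
    by move=> *; exact: volP4.
  apply: eq_bigr => a _; rewrite -(sum_orth (f := fun w => vol x y z _ w) Q1).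
    by rewrite big_distrr/=; apply: eq_bigr => b _; rewrite mulrA.
  by move=> *; exact: volP5.
transitivity (\sum_(k < 5) \sum_(l < 5) \sum_(a < 5) \sum_(b < 5)
    A k l * (Q a k * Q b l * vol x y z (row a Q) (row b Q))).
  apply: eq_bigr => k _; apply: eq_bigr => l _; rewrite E big_distrr/=.
  by apply: eq_bigr => a _; rewrite big_distrr.
under eq_bigr => k _ do rewrite exchange_big.
rewrite exchange_big; apply: eq_bigr => a _ /=.
under eq_bigr => k _ do rewrite exchange_big.
rewrite exchange_big; apply: eq_bigr => b _ /=.
rewrite -mulmxA [(Q *m _) a b]mxE mulr_suml; apply: eq_bigr => k _.
rewrite [(A *m _) k b]mxE mulr_sumr mulr_suml; apply: eq_bigr => l _.
by rewrite [Q^T _ _]mxE; ring.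
Qed.

Lemma ev_delta A i j : ev A (delta_mx 0 i) (delta_mx 0 j) = A i j.
Proof. by rewrite /ev trmx_delta -rowE -colE !mxE. Qed.

(** SO(5)-equivariance: the contraction does not see the orthonormal basis, and [vol] is invariant
    because [\det Q = 1]. This transports statements to the coordinates rotated by beta and to bases
    adapted to x. *)
Lemma star_equiv x A Q : Q^T *m Q = 1%:M -> \det Q = 1 ->
  star (x *m Q^T) (Q *m A *m Q^T) = Q *m star x A *m Q^T.
Proof.
move=> Q1 dQ; apply/matrixP => i j.
have -> : (Q *m star x A *m Q^T) i j = ev (star x A) (row i Q) (row j Q).
  by rewrite -(ev_delta (Q *m _ *m _)) evM !rowE.
rewrite (ev_star_orth _ _ _ _ Q1) starE; congr (_ * _).
apply: eq_bigr => a _; apply: eq_bigr => b _; congr (_ * _).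
by rewrite !rowE -[in LHS](mulr1 (vol _ _ _ _ _)) -{1}dQ -volM -mulmxA Q1 mulmx1.
Qed.
End Star.

(* A Laplace expansion along the first row that computes. *)
Fixpoint laplace (S : comNzRingType) (n : nat) (f : nat -> nat -> S) : S :=
  if n is n'.+1 then
    foldr +%R 0 [seq (-1) ^+ j * f 0%N j * laplace n' (fun i k => f i.+1 (bump j k))
                | j <- iota 0 n]
  else 1.

Lemma det_laplace (S : comNzRingType) n (f : nat -> nat -> S) :
  \det (\matrix_(i < n, j < n) f i j) = laplace n f.
Proof.
elim: n f => [|n IH] f; first by rewrite det_mx00.
rewrite (expand_det_row _ ord0) /laplace -/laplace foldrE big_map.
rewrite -[n.+1 in RHS]subn0 -[iota _ _]/(index_iota 0 n.+1) big_mkord; apply: eq_bigr => j _; rewrite mxE /cofactor add0n.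
rewrite mulrCA -mulrA; congr (_ * (_ * _)).
by rewrite -IH; congr (\det _); apply/matrixP => i k; rewrite !mxE.
Qed.

Lemma laplace_int (S : comNzRingType) n (f : nat -> nat -> int) :
  laplace n (fun i j => (f i j)%:~R : S) = (laplace n f)%:~R.
Proof.
elim: n f => [|n IH] f //; rewrite /laplace -/laplace !foldrE !big_map rmorph_sum /=; apply: eq_bigr => j _.
by rewrite IH !rmorphM rmorphXn rmorphN1.
Qed.

Section Star.
Context {R : realType}.

(** The Levi-Civita symbol in five indices, as an integer obtained by evaluation. *)
Definition eps (n i j k l : nat) : int :=
  laplace 5 (fun a b => (nth 0 [:: n; i; j; k; l] a == b)%:R).

Lemma vol_delta (x : 'rV[R]_5) (i j k l : 'I_5) :
  vol x (delta_mx 0 i) (delta_mx 0 j) (delta_mx 0 k) (delta_mx 0 l) =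
  \sum_(n < 5) x 0 n * (eps n i j k l)%:~R.
Proof.
rewrite {1}[x]row_sum_delta (linear_suml (f := fun x => vol x _ _ _ _)); last first.
  by move=> *; exact: volP1.
apply: eq_bigr => n _; congr (_ * _); rewrite /eps -laplace_int -det_laplace.
congr (\det _); apply/matrixP => a b; rewrite !mxE.
by elim/ord5P: a; rewrite /= ?mxE eqxx /= eq_sym -val_eqE /=; case: eqP.
Qed.

Lemma star_sum (x : 'rV[R]_5) A (i j : 'I_5) : star x A i j =
  2^-1 * \sum_(k < 5) \sum_(l < 5) \sum_(n < 5) A k l * x 0 n * (eps n i j k l)%:~R.
Proof.
rewrite starE; congr (_ * _); apply: eq_bigr => k _; apply: eq_bigr => l _.
by rewrite vol_delta mulr_sumr; apply: eq_bigr => n _; rewrite mulrA.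
Qed.

(** For i <> j only the six orderings (k, l, n) of the remaining indices survive, each with its
    sign. [star_compute] evaluates this list, so that an entry of the star becomes an explicit short
    sum. *)
Definition eps_terms (i j : nat) : seq (nat * (nat * nat) * int) :=
  [seq t <- [seq (t, eps t.2.2 i j t.1 t.2.1) |
               t <- [seq (k, t) | k <- iota 0 5, t <- [seq (l, n) | l <- iota 0 5, n <- iota 0 5]]]
   | t.2 != 0].

Lemma big_ord5_iota (S : nmodType) (F : 'I_5 -> S) :
  \sum_(i < 5) F i = \sum_(i <- iota 0 5) F (inord i).
Proof.
rewrite -[iota 0 5]/(index_iota 0 5) big_mkord.
by apply: eq_bigr => i _; rewrite inord_val.
Qed.

Lemma star_terms (x : 'rV[R]_5) A (i j : 'I_5) : star x A i j =
  2^-1 * foldr +%R 0 [seq A (inord t.1.1) (inord t.1.2.1) * x 0 (inord t.1.2.2) * t.2%:~R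
                     | t <- eps_terms i j].
Proof.
rewrite star_sum; congr (_ * _); rewrite foldrE big_map big_filter [RHS]big_mkcond.
rewrite big_map big_allpairs big_ord5_iota; apply: eq_big_seq => k.
rewrite mem_iota => /andP[_ k5].
rewrite big_allpairs big_ord5_iota; apply: eq_big_seq => l.
rewrite mem_iota => /andP[_ l5].
rewrite big_ord5_iota; apply: eq_big_seq => n.
rewrite mem_iota => /andP[_ n5] /=; rewrite !inordK//.
by case: eqP => // ->; rewrite mulr0z mulr0.
Qed.

Lemma inord5 : (inord 0 = 0 :> 'I_5) * (inord 1 = 1 :> 'I_5) * (inord 2 = 2 :> 'I_5) *
  (inord 3 = 3 :> 'I_5) * (inord 4 = 4 :> 'I_5).
Proof. by do !split; apply: ord_inj; rewrite inordK. Qed.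

Ltac star_compute :=
  rewrite star_terms;
  (match goal with |- context [eps_terms ?i ?j] =>
    let v := eval vm_compute in (eps_terms i j) in
    change (eps_terms i j) with v end);
  rewrite /= !inord5.
Lemma antisymE (A : 'M[R]_5) : A^T = - A -> forall i j, A j i = - A i j.
Proof. by move=> /matrixP h i j; have := h i j; rewrite !mxE. Qed.

Ltac star_antisym aA := star_compute;
  rewrite ?(aA 0 1) ?(aA 0 2) ?(aA 0 3) ?(aA 0 4) ?(aA 1 2) ?(aA 1 3) ?(aA 1 4)
    ?(aA 2 3) ?(aA 2 4) ?(aA 3 4); field.

(** [vol] changes sign when its second and third arguments are exchanged, whatever [A] is. Hence any
    solution of A = - star x A is antisymmetric, and so is the matrix part of any tangent vector of
    M. *)
Lemma star_tr (x : 'rV[R]_5) A : (star x A)^T = - star x A.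
Proof.
have sw y z u w : vol x y z u w = - vol x z y u w.
  have alt y' u' w' : vol x y' y' u' w' = 0.
    by apply: (@determinant_alternate _ _ _ 1 2) => // j; rewrite !mxE.
  have := alt (1 *: y + z) u w.
  rewrite volP2 !volP3 !alt => E; apply/eqP; rewrite -subr_eq0 opprK -E; apply/eqP; ring.
apply/matrixP => i j; rewrite !mxE -mulrN -sumrN; congr (_ * _).
apply: eq_bigr => k _; rewrite -sumrN; apply: eq_bigr => l _.
by rewrite -mulrN -[\det _]/(vol _ _ _ _ _) sw.
Qed.

Lemma star01 (x : 'rV[R]_5) A : A^T = - A -> star x A 0 1 =
  x 0 2 * A 3 4 + x 0 3 * (- A 2 4) + x 0 4 * A 2 3.
Proof. by move=> /antisymE h; star_antisym h. Qed.

Lemma star02 (x : 'rV[R]_5) A : A^T = - A -> star x A 0 2 =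
  x 0 1 * (- A 3 4) + x 0 4 * (- A 1 3) + x 0 3 * A 1 4.
Proof. by move=> /antisymE h; star_antisym h. Qed.

Lemma star03 (x : 'rV[R]_5) A : A^T = - A -> star x A 0 3 =
  x 0 1 * A 2 4 + x 0 2 * (- A 1 4) + x 0 4 * A 1 2.
Proof. by move=> /antisymE h; star_antisym h. Qed.

Lemma star04 (x : 'rV[R]_5) A : A^T = - A -> star x A 0 4 =
  x 0 1 * (- A 2 3) + x 0 3 * (- A 1 2) + x 0 2 * A 1 3.
Proof. by move=> /antisymE h; star_antisym h. Qed.

Lemma star12 (x : 'rV[R]_5) A : A^T = - A -> star x A 1 2 =
  x 0 0 * A 3 4 + x 0 3 * (- A 0 4) + x 0 4 * A 0 3.
Proof. by move=> /antisymE h; star_antisym h. Qed.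

Lemma star13 (x : 'rV[R]_5) A : A^T = - A -> star x A 1 3 =
  x 0 0 * (- A 2 4) + x 0 4 * (- A 0 2) + x 0 2 * A 0 4.
Proof. by move=> /antisymE h; star_antisym h. Qed.

Lemma star14 (x : 'rV[R]_5) A : A^T = - A -> star x A 1 4 =
  x 0 0 * A 2 3 + x 0 2 * (- A 0 3) + x 0 3 * A 0 2.
Proof. by move=> /antisymE h; star_antisym h. Qed.

Lemma star23 (x : 'rV[R]_5) A : A^T = - A -> star x A 2 3 =
  x 0 0 * A 1 4 + x 0 1 * (- A 0 4) + x 0 4 * A 0 1.
Proof. by move=> /antisymE h; star_antisym h. Qed.

Lemma star24 (x : 'rV[R]_5) A : A^T = - A -> star x A 2 4 =
  x 0 0 * (- A 1 3) + x 0 3 * (- A 0 1) + x 0 1 * A 0 3.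
Proof. by move=> /antisymE h; star_antisym h. Qed.

Lemma star34 (x : 'rV[R]_5) A : A^T = - A -> star x A 3 4 =
  x 0 0 * A 1 2 + x 0 1 * (- A 0 2) + x 0 2 * A 0 1.
Proof. by move=> /antisymE h; star_antisym h. Qed.

End Star.

(** * Tangent spaces of M and the differential of the fibration *)

Section Diff.
Context {R : realType}.
Local Notation E := ('rV[R]_5 * 'M[R]_5)%type.

Lemma is_derive_curve {V W : normedModType R} (f : V -> W) (p w : V) (L : W) :
  is_derive (0 : R^o) (1 : R^o) (fun h : R^o => f (h *: w + p)) L -> is_derive p w f L.
Proof.
move=> [df dL]; split; first exact/derivable1P.
rewrite -dL /derive; set g1 := fun h => h^-1 *: _; set g2 := fun h => h^-1 *: _.
suff -> : g1 = g2 by [].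
by apply/funext => h; rewrite /g1 /g2 /= addr0 scale0r add0r [_%:A]mulr1.
Qed.

(** The constraint, the coordinates and r^2 are at most quadratic in the point, so along a line the
    derivative is read off as the coefficient of [h]. *)
Lemma is_derive_quad {V : normedModType R} (f : V -> R^o) (p w : V) (L Q : R) :
  (forall h : R, f (h *: w + p) = f p + h * L + h ^+ 2 * Q) -> is_derive p w f L.
Proof.
move=> fE; apply: is_derive_curve; under eq_fun do rewrite fE.
apply: is_derive_eq.
by rewrite /GRing.scale/=; ring.
Qed.

Lemma diff_is_derive {V W : normedModType R} (f : V -> W) p w L :
  differentiable f p -> is_derive p w f L -> 'd f p w = L.
Proof. by move=> df dL; rewrite -deriveE// derive_val. Qed.

Lemma continuous_x i : continuous (fun q : E => q.1 0 i : R^o).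
Proof.
move=> q; apply: (@continuous_comp _ _ _ fst (fun x : 'rV[R]_5 => x 0 i : R^o)).
  exact: cvg_fst.
exact: coord_continuous.
Qed.

Lemma continuous_A i j : continuous (fun q : E => q.2 i j : R^o).
Proof.
move=> q; apply: (@continuous_comp _ _ _ snd (fun x : 'M[R]_5 => x i j : R^o)).
  exact: cvg_snd.
exact: coord_continuous.
Qed.

Lemma smooth_lin {V W : normedModType R} (U : set V) (f : V -> W) :
  (forall a X Y, f (a *: X + Y) = a *: f X + f Y) -> continuous f -> smooth_on U f.
Proof.
move=> fl cf; pose fL := GRing.isLinear.Build _ _ _ _ f fl.
exact: (@smooth_linear _ _ _ U (HB.pack f fL : {linear V -> W})).
Qed.

Lemma smooth_x U i : smooth_on U (fun q : E => q.1 0 i : R^o).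
Proof. by apply: smooth_lin; [move=> a X Y; rewrite !mxE|exact: continuous_x]. Qed.

Lemma smooth_A U i j : smooth_on U (fun q : E => q.2 i j : R^o).
Proof. by apply: smooth_lin; [move=> a X Y; rewrite !mxE|exact: continuous_A]. Qed.

Lemma smooth_mx {V : normedModType R} U m n (f : V -> 'M[R]_(m, n)) : open U ->
  (forall i j, smooth_on U (fun q => f q i j : R^o)) -> smooth_on U f.
Proof.
move=> oU sf.
have -> : f = fun q => \sum_(i < m) \sum_(j < n) f q i j *: delta_mx i j.
  by apply/funext => q; exact: matrix_sum_delta.
do 2 (apply: smooth_sum => // ?); exact: smoothZl.
Qed.

Lemma smooth_pair {V W W' : normedModType R} U (f : V -> W) (g : V -> W') :
  open U -> smooth_on U f -> smooth_on U g -> smooth_on U (fun q => (f q, g q)).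
Proof.
move=> oU sf sg k; elim: k f g sf sg => [|k IH] f g sf sg.
  by move=> x Ux; apply: cvg_pair; [exact: (sf 0%N)|exact: (sg 0%N)].
have df x : U x -> differentiable f x by exact: smooth_differentiable.
have dg x : U x -> differentiable g x by exact: smooth_differentiable.
split=> [x Ux|v]; first by apply: differentiable_pair; [exact: df|exact: dg].
apply: (@Ck_ext _ _ _ _ _ (fun x => ('D_v f x, 'D_v g x))) => //.
  move=> x Ux; rewrite [in RHS]deriveE; last by apply: differentiable_pair; [exact: df|exact: dg].
  by rewrite diff_pair ?deriveE; [|exact: dg|exact: df|exact: df|exact: dg].
by apply: IH => k'; [exact: (sf k'.+1).2|exact: (sg k'.+1).2].
Qed.

Lemma dotE n (x y : 'rV[R]_n) : dot x y = \sum_(i < n) x 0 i * y 0 i.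
Proof. by rewrite /dot mxE; apply: eq_bigr => i _; rewrite mxE. Qed.

Lemma starDl (x x' : 'rV[R]_5) A a : star (a *: x + x') A = a *: star x A + star x' A.
Proof.
apply/matrixP => i j; rewrite !mxE mulrCA -mulrDr; congr (_ * _).
rewrite mulr_sumr -big_split/=; apply: eq_bigr => k _.
rewrite mulr_sumr -big_split/=; apply: eq_bigr => l _.
by rewrite -[\det _]/(vol _ _ _ _ _) volP1 mulrDr mulrCA.
Qed.

Lemma starDr (x : 'rV[R]_5) A B a : star x (a *: A + B) = a *: star x A + star x B.
Proof.
apply/matrixP => i j; rewrite !mxE mulrCA -mulrDr; congr (_ * _).
rewrite mulr_sumr -big_split/=; apply: eq_bigr => k _.
rewrite mulr_sumr -big_split/=; apply: eq_bigr => l _.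
by rewrite !mxE mulrDl mulrA.
Qed.

Lemma smooth_dot U : open U -> smooth_on U (fun p : E => dot p.1 p.1 - 1 : R^o).
Proof.
move=> oU; under eq_fun do rewrite dotE.
apply: smoothB => //; last exact: smooth_cst.
by apply: smooth_sum => // i; apply: smoothM => //; exact: smooth_x.
Qed.

Lemma smooth_star U i j : open U -> smooth_on U (fun p : E => star p.1 p.2 i j : R^o).
Proof.
move=> oU; under eq_fun do rewrite star_sum.
apply: smoothM => //; first exact: smooth_cst.
do 3 (apply: smooth_sum => // ?); apply: smoothM => //; last exact: smooth_cst.
by apply: smoothM => //; [exact: smooth_A|exact: smooth_x].
Qed.

Lemma smooth_rsq U : open U -> smooth_on U (fun p : E => rsq p.2 : R^o).
Proof.
move=> oU; apply: smoothM => //; first exact: smooth_cst.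
by do 2 (apply: smooth_sum => // ?); apply: smoothX => //; exact: smooth_A.
Qed.

Lemma tanMP (p w : E) : tanM p w <->
  dot p.1 w.1 = 0 /\ w.2 + star w.1 p.2 + star p.1 w.2 = 0.
Proof.
have s1 : smooth_on setT (fun p : E => dot p.1 p.1 - 1 : R^o).
  by apply: smooth_dot; exact: openT.
have s2 : smooth_on setT (fun p : E => p.2 + star p.1 p.2).
  apply: smooth_mx => [|i j]; first exact: openT.
  under eq_fun do rewrite mxE.
  by apply: smoothD; [exact: openT|exact: smooth_A|apply: smooth_star; exact: openT].
have d1 := smooth_differentiable s1 (I : setT p).
have d2 := smooth_differentiable s2 (I : setT p).
have e1 : 'd (fun p : E => dot p.1 p.1 - 1 : R^o) p w = 2 * dot p.1 w.1.
  apply: diff_is_derive => //; apply: (@is_derive_quad _ _ _ _ _ (dot w.1 w.1)) => h.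
  by rewrite /= !dotE !big_ord5 /= !mxE; ring.
have e2 : 'd (fun p : E => p.2 + star p.1 p.2) p w = w.2 + star w.1 p.2 + star p.1 w.2.
  rewrite -deriveE// derive_mx; last exact: diff_derivable.
  apply/matrixP => i j; rewrite [LHS]mxE.
  apply: derive_val; apply: (@is_derive_quad _ _ _ _ _ (star w.1 w.2 i j)) => h.
  rewrite /= starDl !starDr !mxE; ring.
rewrite /tanM /= /constraint [X in X = 0 <-> _](congr1 (fun f => f w) (diff_pair d1 d2)) /= e1 e2.
split=> [[/eqP]|[-> ->]]; last by rewrite mulr0.
by rewrite mulf_eq0 pnatr_eq0 /= => /eqP -> ->.
Qed.

(** The differential of [rsq] at [A] in the direction [B], as [rsqD] shows. *)
Definition drsq (A B : 'M[R]_5) : R := 2^-1 * \sum_(i < 5) \sum_(j < 5) A i j * B i j.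

Definition pos_radius c : set E := [set p | 0 < c + rsq p.2].

Lemma smooth_radius U c : open U -> smooth_on U (fun p : E => c + rsq p.2 : R^o).
Proof. by move=> oU; apply: smoothD; [|exact: smooth_cst|exact: smooth_rsq]. Qed.

Lemma open_pos_radius c : open (pos_radius c).
Proof.
apply: (@open_comp _ _ (fun p : E => c + rsq p.2 : R^o) [set y | 0 < y]).
  by move=> p _; apply: (smooth_radius c openT 0%N).
exact: open_gt.
Qed.

Lemma smooth_powR_radius c b : smooth_on (pos_radius c) (fun p : E => (c + rsq p.2) `^ b : R^o).
Proof.
apply: smooth_powR => //; first exact: open_pos_radius.
by apply: smooth_radius; exact: open_pos_radius.
Qed.

Lemma rsqD A B h : rsq (h *: B + A) = rsq A + h * drsq A B + h ^+ 2 * rsq B.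
Proof.
rewrite /rsq /drsq !mulr_sumr -!big_split/=; apply: eq_bigr => i _.
rewrite !mulr_sumr -!big_split/=; apply: eq_bigr => j _.
by rewrite !mxE; field.
Qed.

Lemma derive_fibration_comp c (p w : E) i : 0 < c + rsq p.2 ->
  differentiable (fun p : E => 2 * (c + rsq p.2) `^ (4^-1) * p.1 0 i : R^o) p /\
  'd (fun p : E => 2 * (c + rsq p.2) `^ (4^-1) * p.1 0 i : R^o) p w =
  2 * ((c + rsq p.2) `^ (4^-1) * w.1 0 i +
       4^-1 * (c + rsq p.2) `^ (4^-1 - 1) * drsq p.2 w.2 * p.1 0 i).
Proof.
move=> p0; have oU := @open_pos_radius c.
have sf : smooth_on (pos_radius c) (fun p : E => 2 * (c + rsq p.2) `^ (4^-1) * p.1 0 i : R^o).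
  apply: smoothM => //; last exact: smooth_x.
  by apply: smoothM => //; [exact: smooth_cst|exact: smooth_powR_radius].
split; first exact: smooth_differentiable sf p0.
apply: diff_is_derive; first exact: smooth_differentiable sf p0.
have dx : is_derive p w (fun p : E => p.1 0 i : R^o) (w.1 0 i).
  by apply: (@is_derive_quad _ _ _ _ _ 0) => h; rewrite /= !mxE; ring.
have dr : is_derive p w (fun p : E => c + rsq p.2 : R^o) (drsq p.2 w.2).
  by apply: (@is_derive_quad _ _ _ _ _ (rsq w.2)) => h; rewrite /= rsqD; ring.
have dP : is_derive p w (fun p : E => (c + rsq p.2) `^ (4^-1) : R^o)
    (4^-1 * (c + rsq p.2) `^ (4^-1 - 1) * drsq p.2 w.2).
  have sP := @smooth_powR_radius c 4^-1.
  apply: DeriveDef; first by apply: diff_derivable; exact: smooth_differentiable sP p0.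
  rewrite derive_powR ?derive_val//.
  exact: smooth_differentiable (smooth_radius c openT) I.
apply: is_derive_eq.
by rewrite /GRing.scale/=; ring.
Qed.

Lemma fibration_diff c (p w : E) : 0 < c + rsq p.2 ->
  'd (fibration c) p w =
  (w.2 3 4, 2 * ((c + rsq p.2) `^ (4^-1) * w.1 0 3 +
               4^-1 * (c + rsq p.2) `^ (4^-1 - 1) * drsq p.2 w.2 * p.1 0 3),
            2 * ((c + rsq p.2) `^ (4^-1) * w.1 0 4 +
               4^-1 * (c + rsq p.2) `^ (4^-1 - 1) * drsq p.2 w.2 * p.1 0 4)).
Proof.
move=> p0.
have [d3 e3] := derive_fibration_comp w 3 p0.
have [d4 e4] := derive_fibration_comp w 4 p0.
have dA : differentiable (fun p : E => p.2 3 4 : R^o) p.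
  by apply: (@smooth_differentiable _ _ _ setT) => //; exact: smooth_A.
have eA : 'd (fun p : E => p.2 3 4 : R^o) p w = w.2 3 4.
  by apply: diff_is_derive => //; apply: (@is_derive_quad _ _ _ _ _ 0) => h; rewrite /= !mxE; ring.
have dA3 := differentiable_pair dA d3.
rewrite /fibration [LHS](congr1 (fun f => f w) (diff_pair dA3 d4)) /=.
by rewrite [X in (X, _)](congr1 (fun f => f w) (diff_pair dA d3)) /= eA e3 e4.
Qed.
End Diff.

(** * Normal form of the fibres *)

Section Coordinates.
Context {R : realType}.
Local Notation E := ('rV[R]_5 * 'M[R]_5)%type.

Definition rot (b : R) : 'M[R]_5 := \matrix_(i < 5, j < 5) nth 0 (nth [::]
  [:: [:: 1; 0; 0; 0; 0]; [:: 0; 1; 0; 0; 0]; [:: 0; 0; 1; 0; 0];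
      [:: 0; 0; 0; cos b; sin b]; [:: 0; 0; 0; - sin b; cos b]] i) j.

Lemma rotT b : rot b *m (rot b)^T = 1%:M.
Proof.
have cs := cos2Dsin2 b; apply/matrixP => i j; rewrite !mxE big_ord5 !mxE.
by elim/ord5P: i; elim/ord5P: j; rewrite /= ?mulr0 ?mul0r ?mulr1 ?addr0 ?add0r//;
  rewrite -?expr2 ?sqrrN ?[sin b ^+ 2 + _]addrC ?cs// ?mulrN ?mulNr [sin b * _]mulrC
   ?subrr ?addNr.
Qed.

Lemma rotTV b : (rot b)^T *m rot b = 1%:M.
Proof. exact: mulmx1C (rotT b). Qed.

Lemma det_rot b : \det (rot b) = 1.
Proof.
rewrite /rot (det_laplace _ (fun i j => nth 0 (nth [::] _ i) j)) /=.
rewrite ?mulr0 ?mul0r ?mulr1 ?mul1r ?addr0 ?add0r.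
rewrite -[RHS](cos2Dsin2 b). ring.
Qed.

(** Vectors are rows, hence the transpose on points and the conjugation on forms. A point at angle
    [b] in the plane of the last two coordinates is turned to angle 0. *)
Definition Phi b (p : E) : E := (p.1 *m (rot b)^T, rot b *m p.2 *m (rot b)^T).
Definition PhiV b (p : E) : E := (p.1 *m rot b, (rot b)^T *m p.2 *m rot b).

Lemma PhiK b : cancel (Phi b) (PhiV b).
Proof.
move=> [x A]; rewrite /Phi /PhiV /= -mulmxA rotTV mulmx1 !mulmxA rotTV mul1mx.
by rewrite -!mulmxA rotTV mulmx1.
Qed.

Lemma PhiVK b : cancel (PhiV b) (Phi b).
Proof.
move=> [x A]; rewrite /Phi /PhiV /= -mulmxA rotT mulmx1 !mulmxA rotT mul1mx.
by rewrite -!mulmxA rotT mulmx1.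
Qed.

Lemma Phi_linear b a X Y : Phi b (a *: X + Y) = a *: Phi b X + Phi b Y.
Proof.
rewrite /Phi /= mulmxDl -scalemxAl mulmxDr mulmxDl -scalemxAr -scalemxAl.
by [].
Qed.

Lemma PhiV_linear b a X Y : PhiV b (a *: X + Y) = a *: PhiV b X + PhiV b Y.
Proof.
rewrite /PhiV /= mulmxDl -scalemxAl mulmxDr mulmxDl -scalemxAr -scalemxAl.
by [].
Qed.

Lemma dot_Phi b (x y : E) : dot (Phi b x).1 (Phi b y).1 = dot x.1 y.1.
Proof. by rewrite /dot /= trmx_mul trmxK mulmxA -(mulmxA x.1) rotTV mulmx1. Qed.

Lemma drsq_tr (A B : 'M[R]_5) : drsq A B = 2^-1 * \tr (A *m B^T).
Proof.
congr (_ * _); apply: eq_bigr => i _; rewrite mxE; apply: eq_bigr => j _.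
by rewrite mxE.
Qed.

Lemma drsq_Phi b (x y : E) : drsq (Phi b x).2 (Phi b y).2 = drsq x.2 y.2.
Proof.
rewrite !drsq_tr /Phi /= !trmx_mul trmxK !mulmxA mxtrace_mulC !mulmxA rotTV mul1mx.
by rewrite -(mulmxA x.2) rotTV mulmx1.
Qed.

Lemma rsq_drsq (A : 'M[R]_5) : rsq A = 2^-1 * drsq A A.
Proof.
rewrite /rsq /drsq mulrA; congr (_ * _); first by field.
Qed.

Lemma rsq_Phi b (x : E) : rsq (Phi b x).2 = rsq x.2.
Proof. by rewrite !rsq_drsq drsq_Phi. Qed.

Lemma star_Phi b (x y : E) : star (Phi b x).1 (Phi b y).2 =
  rot b *m star x.1 y.2 *m (rot b)^T.
Proof. by rewrite star_equiv ?rotTV ?det_rot. Qed.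

Lemma conj_eq0 b (A : 'M[R]_5) : rot b *m A *m (rot b)^T = 0 <-> A = 0.
Proof.
split=> [h|->]; last by rewrite mulmx0 mul0mx.
have : (rot b)^T *m (rot b *m A *m (rot b)^T) *m rot b = 0 by rewrite h mulmx0 mul0mx.
by rewrite !mulmxA rotTV mul1mx -mulmxA rotTV mulmx1.
Qed.

Lemma tanM_Phi b (p w : E) : tanM (Phi b p) (Phi b w) <-> tanM p w.
Proof.
rewrite !tanMP dot_Phi !star_Phi.
have -> : (Phi b w).2 + rot b *m star w.1 p.2 *m (rot b)^T +
    rot b *m star p.1 w.2 *m (rot b)^T =
  rot b *m (w.2 + star w.1 p.2 + star p.1 w.2) *m (rot b)^T.
  by rewrite !mulmxDr !mulmxDl.
by rewrite conj_eq0.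
Qed.

Definition asd (p : E) := p.2 + star p.1 p.2 = 0.

Lemma asd_Phi b (p : E) : asd (Phi b p) <-> asd p.
Proof.
rewrite /asd star_Phi.
have -> : (Phi b p).2 + rot b *m star p.1 p.2 *m (rot b)^T =
  rot b *m (p.2 + star p.1 p.2) *m (rot b)^T by rewrite !mulmxDr !mulmxDl.
exact: conj_eq0.
Qed.

Lemma asd_antisym (p : E) : asd p -> p.2^T = - p.2.
Proof. by move=> /(canRL (addrK _)) ->; rewrite sub0r opprK linearN /= star_tr opprK. Qed.

Lemma tanM_antisym (p w : E) : tanM p w -> w.2^T = - w.2.
Proof.
move=> /tanMP[_]; rewrite -addrA => /(canRL (addrK _)) ->; rewrite sub0r opprK.
by rewrite linearN linearD /= !star_tr !opprD !opprK.
Qed.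

Lemma totalE c (p : E) : Defs.total c p <-> [/\ dot p.1 p.1 = 1, asd p & 0 < c + rsq p.2].
Proof.
rewrite /Defs.total /= /constraint /asd; split=> [[[/eqP]]|[-> -> ->]]; last by rewrite subrr.
by rewrite subr_eq0 => /eqP.
Qed.

Lemma Phi_x b (p : E) : [/\ (Phi b p).1 0 0 = p.1 0 0, (Phi b p).1 0 1 = p.1 0 1,
  (Phi b p).1 0 2 = p.1 0 2, (Phi b p).1 0 3 = cos b * p.1 0 3 + sin b * p.1 0 4 &
  (Phi b p).1 0 4 = - sin b * p.1 0 3 + cos b * p.1 0 4].
Proof. by split; rewrite mxE big_ord5 !mxE /=; ring. Qed.

Lemma Phi_A34 b (p : E) : p.2^T = - p.2 -> (Phi b p).2 3 4 = p.2 3 4.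
Proof.
move=> /antisymE h; rewrite -[RHS]mul1r -(cos2Dsin2 b).
rewrite mxE big_ord5 !mxE /= !big_ord5 !mxE /= (h 3 4).
have -> : p.2 3 3 = 0 by have := h 3 3; lra.
have -> : p.2 4 4 = 0 by have := h 4 4; lra.
ring.
Qed.

Lemma rot_pair b (x y x' y' : R) : (cos b * x + sin b * y = x' /\ - sin b * x + cos b * y = y')
  <-> (x = x' * cos b - y' * sin b /\ y = x' * sin b + y' * cos b).
Proof.
have cs := cos2Dsin2 b; split=> [[<- <-]|[-> ->]]; split.
- by rewrite -[LHS]mul1r -cs; ring.
- by rewrite -[LHS]mul1r -cs; ring.
- by rewrite -[RHS]mul1r -cs; ring.
- by rewrite -[RHS]mul1r -cs; ring.
Qed.

Definition quarter c (p : E) : R := (c + rsq p.2) `^ (4^-1).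

Lemma fibre_Phi c u v b (p : E) : fibre c (base u v b) p <->
  [/\ dot (Phi b p).1 (Phi b p).1 = 1, asd (Phi b p), 0 < c + rsq (Phi b p).2 &
   [/\ (Phi b p).2 3 4 = u, 2 * quarter c p * (Phi b p).1 0 3 = v & (Phi b p).1 0 4 = 0]].
Proof.
have [_ _ _ e3 e4] := Phi_x b p.
rewrite dot_Phi (propext (asd_Phi b p)) rsq_Phi /fibre /= (propext (totalE c p)) /fibration /base e3 e4 -/(quarter c p).
have rp := rot_pair b (2 * quarter c p * p.1 0 3) (2 * quarter c p * p.1 0 4) v 0.
rewrite !mul0r subr0 addr0 in rp.
split=> [[[d a r] [<- E3 E4]]|[d a r [<- E3 E4]]].
  have q0 : quarter c p != 0 by rewrite gt_eqF// powR_gt0.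
  have [F3 F4] := rp.2 (conj E3 E4); split=> //; split.
  - by rewrite Phi_A34//; exact: asd_antisym.
  - by rewrite -F3; ring.
  - apply/eqP; have /eqP : 2 * quarter c p * (- sin b * p.1 0 3 + cos b * p.1 0 4) = 0.
      by rewrite -F4; ring.
    by rewrite !mulf_eq0 pnatr_eq0 (negPf q0).
have [|F3 F4] := rp.1.
  by split; [rewrite -E3; ring|rewrite -(mulr0 (2 * quarter c p)) -E4; ring].
by rewrite -F3 -F4 Phi_A34//; exact: asd_antisym.
Qed.

Lemma quarter4 c (p : E) : 0 < c + rsq p.2 -> quarter c p ^+ 4 = c + rsq p.2.
Proof.
move=> r0; rewrite -powR_mulrn ?powR_ge0// -powRrM mulVf ?pnatr_eq0//.
by rewrite powRr1// ltW.
Qed.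

Lemma quarter_gt0 c (p : E) : 0 < c + rsq p.2 -> 0 < quarter c p.
Proof. exact: powR_gt0. Qed.

(** The real powers in the metric, in the 3-form and in the differential of the fibration all become
    integer powers of one positive quantity, so that the identities to come are rational. *)
Lemma quarter_pow c (p : E) : 0 < c + rsq p.2 ->
  [/\ (c + rsq p.2) `^ (2^-1) = quarter c p ^+ 2,
      (c + rsq p.2) `^ (- 2^-1) = quarter c p ^- 2,
      (c + rsq p.2) `^ (- (3 / 4)) = quarter c p ^- 3 &
      (c + rsq p.2) `^ (4^-1 - 1) = quarter c p ^- 3].
Proof.
move=> r0; have e n : (c + rsq p.2) `^ (4^-1 * n%:R) = quarter c p ^+ n.
  by rewrite powRrM powR_mulrn// powR_ge0.
have eN n : (c + rsq p.2) `^ (- (4^-1 * n%:R)) = quarter c p ^- n.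
  by rewrite powRN e.
split; [rewrite -(e 2%N)|rewrite -(eN 2%N)|rewrite -(eN 3%N)|rewrite -(eN 3%N)];
  by congr (_ `^ _); field.
Qed.

(** The base vector is (0, xi, eta) turned by [b]. The choice (0, 0, 0) describes the tangent
    vectors of a fibre, and (0, 0, v) the normal field n_3. *)
Lemma dfibration_Phi c b (p w : E) xi eta : 0 < c + rsq p.2 -> w.2^T = - w.2 ->
  'd (fibration c) p w = (0, cos b * xi - sin b * eta, sin b * xi + cos b * eta) <->
  [/\ (Phi b w).2 3 4 = 0,
   2 * (quarter c p * (Phi b w).1 0 3 +
     4^-1 * quarter c p ^- 3 * drsq (Phi b p).2 (Phi b w).2 * (Phi b p).1 0 3) = xi &
   2 * (quarter c p * (Phi b w).1 0 4 +
     4^-1 * quarter c p ^- 3 * drsq (Phi b p).2 (Phi b w).2 * (Phi b p).1 0 4) = eta].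
Proof.
move=> r0 wT; rewrite fibration_diff// Phi_A34// drsq_Phi.
have [_ _ _ -> ->] := Phi_x b p; have [_ _ _ -> ->] := Phi_x b w.
have [_ _ _ ->] := quarter_pow r0; rewrite -/(quarter c p).
set D := drsq _ _; set q := quarter c p.
have rp := rot_pair b (2 * (q * w.1 0 3 + 4^-1 * q ^- 3 * D * p.1 0 3))
  (2 * (q * w.1 0 4 + 4^-1 * q ^- 3 * D * p.1 0 4)) xi eta.
split=> [[-> E3 E4]|[-> E3 E4]].
  have [|<- <-] := rp.2; last by split=> //; ring.
  by split; rewrite ?E3 ?E4; ring.
have [|-> ->] := rp.1; first by split; [rewrite -E3|rewrite -E4]; ring.
by congr (_, _, _); ring.
Qed.

Lemma tanN_Phi c b (p w : E) : 0 < c + rsq p.2 -> (Phi b p).1 0 4 = 0 ->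
  tanN c p w <-> tanM p w /\ [/\ (Phi b w).2 3 4 = 0, (Phi b w).1 0 4 = 0 &
   4 * quarter c p ^+ 4 * (Phi b w).1 0 3 + drsq (Phi b p).2 (Phi b w).2 * (Phi b p).1 0 3 = 0].
Proof.
move=> r0 p4; rewrite /tanN /=.
have q0 : quarter c p != 0 by rewrite gt_eqF// powR_gt0.
suff H : tanM p w -> 'd (fibration c) p w = 0 <-> [/\ (Phi b w).2 3 4 = 0, (Phi b w).1 0 4 = 0 &
   4 * quarter c p ^+ 4 * (Phi b w).1 0 3 + drsq (Phi b p).2 (Phi b w).2 * (Phi b p).1 0 3 = 0].
  by split=> -[h1 h2]; split=> //; apply/(H h1).
move=> /tanM_antisym wT; have := dfibration_Phi b 0 0 r0 wT.
rewrite !mulr0 subr0 addr0 p4 mulr0 addr0 => H; split.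
  move=> /H[-> /eqP E3 /eqP E4]; split=> //.
    by move: E4; rewrite !mulf_eq0 pnatr_eq0 (negPf q0) => /eqP.
  have := congr1 ( *%R (2 * quarter c p ^+ 3)) (eqP E3); rewrite mulr0 => <-.
  by field.
move=> [E1 E2 E3]; apply/H; split=> //; last by rewrite E2 !mulr0.
rewrite -(mulr0 (2^-1 * quarter c p ^- 3)) -E3; field.
exact: q0.
Qed.

End Coordinates.

Section LinearCombination.
Context {S : fieldType}.
(** Certificates: [lincomb t] proves x = y by a combination t of the differences [dif h] of known
    equations h. [ring] or [field] checks that x - y equals t, and t vanishes since each [dif h]
    does. *)
Definition dif (x y : S) (_ : x = y) := x - y.
Lemma dif0 (x y : S) (e : x = y) : dif e = 0.
Proof. by rewrite /dif e subrr. Qed.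
Lemma lincomb_eq (x y t : S) : x - y = t -> t = 0 -> x = y.
Proof. by move=> <- /eqP; rewrite subr_eq0 => /eqP. Qed.
End LinearCombination.
Ltac lincomb t := apply: (@lincomb_eq _ _ _ t); [rewrite /dif; first [ring | by field] | rewrite ?dif0; ring].

(** * Explicit coordinates on the fibres and on their tangent spaces *)

Section NormalForm.
Context {R : realType}.
Local Notation E := ('rV[R]_5 * 'M[R]_5)%type.

Lemma addmxE m n (A B : 'M[R]_(m, n)) i j : (A + B) i j = A i j + B i j.
Proof. by rewrite mxE. Qed.

Lemma antisym0P (M : 'M[R]_5) : M^T = - M -> M = 0 <->
  [/\ [/\ M 0 1 = 0, M 0 2 = 0, M 0 3 = 0 & M 0 4 = 0],
      [/\ M 1 2 = 0, M 1 3 = 0 & M 1 4 = 0], M 2 3 = 0, M 2 4 = 0 & M 3 4 = 0].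
Proof.
move=> /antisymE h; split=> [->|]; first by rewrite !mxE.
move=> [[h01 h02 h03 h04] [h12 h13 h14] h23 h24 h34].
have d i : M i i = 0 by have := h i i; lra.
apply/matrixP => i j; rewrite [RHS]mxE.
by elim/ord5P: i; elim/ord5P: j => //; rewrite h (h01, h02, h03, h04, h12, h13, h14, h23, h24, h34) oppr0.
Qed.

(** Blocks for R^3 + R + R: p is the axial vector of the 3x3 block, q the fourth column, (a, u) the
    last column. *)
Definition skew (p0 p1 p2 q0 q1 q2 a0 a1 a2 u : R) : 'M[R]_5 :=
  \matrix_(i < 5, j < 5) nth 0 (nth [::]
  [:: [:: 0; p2; - p1; q0; a0]; [:: - p2; 0; p0; q1; a1]; [:: p1; - p0; 0; q2; a2];
      [:: - q0; - q1; - q2; 0; u]; [:: - a0; - a1; - a2; - u; 0]] i) j.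

Lemma skew_tr p0 p1 p2 q0 q1 q2 a0 a1 a2 u :
  (skew p0 p1 p2 q0 q1 q2 a0 a1 a2 u)^T = - skew p0 p1 p2 q0 q1 q2 a0 a1 a2 u.
Proof.
by apply/matrixP => i j; rewrite !mxE; elim/ord5P: i; elim/ord5P: j; rewrite /= ?oppr0 ?opprK.
Qed.

Lemma skewE (M : 'M[R]_5) : M^T = - M -> M =
  skew (M 1 2) (- M 0 2) (M 0 1) (M 0 3) (M 1 3) (M 2 3) (M 0 4) (M 1 4) (M 2 4) (M 3 4).
Proof.
move=> /antisymE h; have d i : M i i = 0 by have := h i i; lra.
apply/matrixP => i j; rewrite mxE.
by elim/ord5P: i; elim/ord5P: j; rewrite /= ?opprK // h.
Qed.

Lemma vec5E (x : 'rV[R]_5) : x = vec5 (x 0 0) (x 0 1) (x 0 2) (x 0 3) (x 0 4).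
Proof. by apply/rowP => i; rewrite mxE; elim/ord5P: i. Qed.

(** An anti-self-dual form is determined by its contraction with one unit tangent vector. Here this
    is the last unit vector, which is tangent to the sphere because x has no component along it.
    Solving A = - star x A for the other entries gives p = m a - u x and q = a cross x. *)
Definition emb (x0 x1 x2 m a0 a1 a2 u : R) : E :=
  (vec5 x0 x1 x2 m 0,
   skew (m * a0 - u * x0) (m * a1 - u * x1) (m * a2 - u * x2)
     (a1 * x2 - a2 * x1) (a2 * x0 - a0 * x2) (a0 * x1 - a1 * x0) a0 a1 a2 u).

(** The derivative of [emb], with u held fixed as it is on a fibre. *)
Definition demb (y : E) (x0 x1 x2 m a0 a1 a2 : R) : E :=
  (vec5 x0 x1 x2 m 0,
   skew (m * y.2 0 4 + y.1 0 3 * a0 - y.2 3 4 * x0)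
        (m * y.2 1 4 + y.1 0 3 * a1 - y.2 3 4 * x1)
        (m * y.2 2 4 + y.1 0 3 * a2 - y.2 3 4 * x2)
     (a1 * y.1 0 2 - a2 * y.1 0 1 + (y.2 1 4 * x2 - y.2 2 4 * x1))
     (a2 * y.1 0 0 - a0 * y.1 0 2 + (y.2 2 4 * x0 - y.2 0 4 * x2))
     (a0 * y.1 0 1 - a1 * y.1 0 0 + (y.2 0 4 * x1 - y.2 1 4 * x0)) a0 a1 a2 0).

(** Six entries of A + star x A = 0 give the block and the fourth column; the entries in the last
    column, contracted with x, give x . a = 0. Those six entries of A are, up to order and sign, the
    components of a /\ x in R^4, so Lagrange's identity with |x| = 1 and x . a = 0 yields the
    norm. *)
Lemma asd_coord (y : E) : asd y -> dot y.1 y.1 = 1 -> y.1 0 4 = 0 ->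
  [/\ y = emb (y.1 0 0) (y.1 0 1) (y.1 0 2) (y.1 0 3) (y.2 0 4) (y.2 1 4) (y.2 2 4) (y.2 3 4),
  y.1 0 0 ^+ 2 + y.1 0 1 ^+ 2 + y.1 0 2 ^+ 2 + y.1 0 3 ^+ 2 = 1,
  y.1 0 0 * y.2 0 4 + y.1 0 1 * y.2 1 4 + y.1 0 2 * y.2 2 4 + y.1 0 3 * y.2 3 4 = 0 &
  rsq y.2 = y.2 0 4 ^+ 2 + y.2 1 4 ^+ 2 + y.2 2 4 ^+ 2 + y.2 3 4 ^+ 2].
Proof.
case: y => x A /= h; rewrite dotE big_ord5 => d x4.
have /= aA := asd_antisym h; move: h => /antisym0P; rewrite /= linearD /= star_tr aA opprD.
move=> /(_ erefl); rewrite !addmxE.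
rewrite (star01 _ aA) (star02 _ aA) (star03 _ aA) (star04 _ aA) (star12 _ aA)
 (star13 _ aA) (star14 _ aA) (star23 _ aA) (star24 _ aA) (star34 _ aA) x4.
move=> [[h01 h02 h03 h04] [h12 h13 h14] h23 h24 h34].
have AE := skewE aA.
have E01 : A 0 1 = x 0 3 * A 2 4 - A 3 4 * x 0 2 by lincomb (dif h01).
have E02 : - A 0 2 = x 0 3 * A 1 4 - A 3 4 * x 0 1 by lincomb (- dif h02).
have E12 : A 1 2 = x 0 3 * A 0 4 - A 3 4 * x 0 0 by lincomb (dif h12).
have E03 : A 0 3 = A 1 4 * x 0 2 - A 2 4 * x 0 1 by lincomb (dif h03).
have E13 : A 1 3 = A 2 4 * x 0 0 - A 0 4 * x 0 2 by lincomb (dif h13).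
have E23 : A 2 3 = A 0 4 * x 0 1 - A 1 4 * x 0 0 by lincomb (dif h23).
have E4 : x 0 0 * A 0 4 + x 0 1 * A 1 4 + x 0 2 * A 2 4 + x 0 3 * A 3 4 = 0.
  lincomb (x 0 0 * dif h04 + x 0 1 * dif h14 + x 0 2 * dif h24 + x 0 3 * dif h34).
split=> //.
- by rewrite /emb -E12 -E02 -E01 -E03 -E13 -E23 -AE -x4 -vec5E.
- by rewrite -d x4; ring.
rewrite AE /rsq !big_ord5 !mxE /= E12 E02 E01 E03 E13 E23; rewrite x4 in d.
lincomb (2^-1 * ((A 0 4 ^+ 2 + A 1 4 ^+ 2 + A 2 4 ^+ 2 + A 3 4 ^+ 2) * dif d
  - (x 0 0 * A 0 4 + x 0 1 * A 1 4 + x 0 2 * A 2 4 + x 0 3 * A 3 4) * dif E4)).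
Qed.

Lemma asd_entries (y : E) : asd y -> dot y.1 y.1 = 1 -> y.1 0 4 = 0 ->
  [/\ y.2 1 2 = y.1 0 3 * y.2 0 4 - y.2 3 4 * y.1 0 0,
      - y.2 0 2 = y.1 0 3 * y.2 1 4 - y.2 3 4 * y.1 0 1 &
      y.2 0 1 = y.1 0 3 * y.2 2 4 - y.2 3 4 * y.1 0 2] /\
  [/\ y.2 0 3 = y.2 1 4 * y.1 0 2 - y.2 2 4 * y.1 0 1,
      y.2 1 3 = y.2 2 4 * y.1 0 0 - y.2 0 4 * y.1 0 2 &
      y.2 2 3 = y.2 0 4 * y.1 0 1 - y.2 1 4 * y.1 0 0].
Proof.
move=> h d y4; have [yE _ _ _] := asd_coord h d y4.
have e i j := congr1 (fun y : E => y.2 i j) yE.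
have /= := e 1 2; rewrite mxE /= => e12.
have /= := e 0 2; rewrite mxE /= => e02.
have /= := e 0 1; rewrite mxE /= => e01.
have /= := e 0 3; rewrite mxE /= => e03.
have /= := e 1 3; rewrite mxE /= => e13.
have /= := e 2 3; rewrite mxE /= => e23.
by split; split; rewrite // e02 opprK.
Qed.

(** Linearised form of [asd_coord]. Only the expression of [z] through [demb] asks for
    [z.1 0 4 = 0]; the other three equations serve also for the normal vector n_3, whose last
    component is v / (2 q). *)
Lemma tan_coord (y z : E) : asd y -> dot y.1 y.1 = 1 -> y.1 0 4 = 0 ->
  tanM y z -> z.2 3 4 = 0 ->
  [/\ z.1 0 4 = 0 -> z = demb y (z.1 0 0) (z.1 0 1) (z.1 0 2) (z.1 0 3) (z.2 0 4) (z.2 1 4) (z.2 2 4),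
   y.1 0 0 * z.1 0 0 + y.1 0 1 * z.1 0 1 + y.1 0 2 * z.1 0 2 + y.1 0 3 * z.1 0 3 = 0,
   y.1 0 0 * z.2 0 4 + y.1 0 1 * z.2 1 4 + y.1 0 2 * z.2 2 4 +
    (y.2 0 4 * z.1 0 0 + y.2 1 4 * z.1 0 1 + y.2 2 4 * z.1 0 2 + y.2 3 4 * z.1 0 3) = 0 &
   drsq y.2 z.2 = 2 * (y.2 0 4 * z.2 0 4 + y.2 1 4 * z.2 1 4 + y.2 2 4 * z.2 2 4)].
Proof.
move=> h d y4 Tz z34; have [[E12 E02 E01] [E03 E13 E23]] := asd_entries h d y4.
have [_ H1 H3 _] := asd_coord h d y4.
have aA := asd_antisym h; have aW := tanM_antisym Tz.
move: Tz => /tanMP[H2]; rewrite dotE big_ord5 y4 mul0r addr0 in H2.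
have MT : (z.2 + star z.1 y.2 + star y.1 z.2)^T = - (z.2 + star z.1 y.2 + star y.1 z.2).
  by rewrite !raddfD /= !star_tr aW.
move=> /(antisym0P MT); rewrite !addmxE.
rewrite !(star01 _ aA, star02 _ aA, star03 _ aA, star04 _ aA, star12 _ aA,
 star13 _ aA, star14 _ aA, star23 _ aA, star24 _ aA, star34 _ aA).
rewrite !(star01 _ aW, star02 _ aW, star03 _ aW, star04 _ aW, star12 _ aW,
 star13 _ aW, star14 _ aW, star23 _ aW, star24 _ aW, star34 _ aW) y4 z34.
have [AE WE] := (skewE aA, skewE aW).
have E02' : y.2 0 2 = - (y.1 0 3 * y.2 1 4 - y.2 3 4 * y.1 0 1) by rewrite -E02 opprK.
rewrite E12 E02' E01 E03 E13 E23.
have zE : z = (z.1, z.2) by case: (z).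
move: zE; rewrite /demb.
move: (y.1) (y.2) (z.1) (z.2) z34 AE WE H1 H2 H3 E12 E02 E02' E01 E03 E13 E23 => x A x' W z34 AE WE H1 H2 H3 E12 E02 E02' E01 E03 E13 E23.
move=> zE [[h01 h02 h03 h04] [h12 h13 h14] h23 h24 h34].
have F12 : W 1 2 = x' 0 3 * A 0 4 + x 0 3 * W 0 4 - A 3 4 * x' 0 0 - x' 0 4 * (A 1 4 * x 0 2 - A 2 4 * x 0 1).
  by lincomb (dif h12).
have F02 : - W 0 2 = x' 0 3 * A 1 4 + x 0 3 * W 1 4 - A 3 4 * x' 0 1 - x' 0 4 * (A 2 4 * x 0 0 - A 0 4 * x 0 2).
  by lincomb (- dif h02).
have F01 : W 0 1 = x' 0 3 * A 2 4 + x 0 3 * W 2 4 - A 3 4 * x' 0 2 - x' 0 4 * (A 0 4 * x 0 1 - A 1 4 * x 0 0).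
  by lincomb (dif h01).
have F03 : W 0 3 = W 1 4 * x 0 2 - W 2 4 * x 0 1 + (A 1 4 * x' 0 2 - A 2 4 * x' 0 1)
    - x' 0 4 * (x 0 3 * A 0 4 - A 3 4 * x 0 0) by lincomb (dif h03).
have F13 : W 1 3 = W 2 4 * x 0 0 - W 0 4 * x 0 2 + (A 2 4 * x' 0 0 - A 0 4 * x' 0 2)
    - x' 0 4 * (x 0 3 * A 1 4 - A 3 4 * x 0 1) by lincomb (dif h13).
have F23 : W 2 3 = W 0 4 * x 0 1 - W 1 4 * x 0 0 + (A 0 4 * x' 0 1 - A 1 4 * x' 0 0)
    - x' 0 4 * (x 0 3 * A 2 4 - A 3 4 * x 0 2) by lincomb (dif h23).
have T2 : x 0 0 * W 0 4 + x 0 1 * W 1 4 + x 0 2 * W 2 4 +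
    (A 0 4 * x' 0 0 + A 1 4 * x' 0 1 + A 2 4 * x' 0 2 + A 3 4 * x' 0 3) = 0.
  lincomb (x 0 0 * dif h04 + x 0 1 * dif h14 + x 0 2 * dif h24 + x 0 3 * dif h34
   - (A 0 4 * x' 0 0 + A 1 4 * x' 0 1 + A 2 4 * x' 0 2 + A 3 4 * x' 0 3) * dif H1
   + (x 0 0 * x' 0 0 + x 0 1 * x' 0 1 + x 0 2 * x' 0 2 + x 0 3 * x' 0 3) * dif H3).
split=> //.
- move=> k0; rewrite zE; rewrite k0 !mul0r !subr0 in F12 F02 F01 F03 F13 F23.
  rewrite -F12 -F02 -F01 -F03 -F13 -F23; congr (_, _).
    by rewrite -k0 -vec5E.
  by rewrite -z34 -WE.
- rewrite AE WE /drsq !big_ord5 !mxE /= E12 E02 E01 E03 E13 E23 F12 F02 F01 F03 F13 F23 z34.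
  lincomb ((A 0 4 * W 0 4 + A 1 4 * W 1 4 + A 2 4 * W 2 4) * dif H1
    + (A 0 4 ^+ 2 + A 1 4 ^+ 2 + A 2 4 ^+ 2 + A 3 4 ^+ 2) * dif H2
    - (x 0 0 * A 0 4 + x 0 1 * A 1 4 + x 0 2 * A 2 4 + x 0 3 * A 3 4) * dif T2).
Qed.

Lemma emb_asd (x0 x1 x2 m a0 a1 a2 u : R) : x0 ^+ 2 + x1 ^+ 2 + x2 ^+ 2 + m ^+ 2 = 1 ->
  x0 * a0 + x1 * a1 + x2 * a2 + m * u = 0 ->
  let y := emb x0 x1 x2 m a0 a1 a2 u in asd y /\ dot y.1 y.1 = 1.
Proof.
move=> H1 H3; split; last by rewrite dotE big_ord5 !mxE /= -H1; ring.
have aA := skew_tr (m * a0 - u * x0) (m * a1 - u * x1) (m * a2 - u * x2)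
     (a1 * x2 - a2 * x1) (a2 * x0 - a0 * x2) (a0 * x1 - a1 * x0) a0 a1 a2 u.
apply/antisym0P; first by rewrite raddfD /= star_tr aA opprD.
rewrite !addmxE /= !(star01 _ aA, star02 _ aA, star03 _ aA, star04 _ aA, star12 _ aA,
 star13 _ aA, star14 _ aA, star23 _ aA, star24 _ aA, star34 _ aA) !mxE /=.
split; [split|split| | |]; try ring.
- lincomb (- a0 * dif H1 + x0 * dif H3).
- lincomb (- a1 * dif H1 + x1 * dif H3).
- lincomb (- a2 * dif H1 + x2 * dif H3).
- lincomb (- u * dif H1 + m * dif H3).
Qed.

Lemma demb_tan (y : E) (x0 x1 x2 m a0 a1 a2 : R) :
  asd y -> dot y.1 y.1 = 1 -> y.1 0 4 = 0 ->
  y.1 0 0 * x0 + y.1 0 1 * x1 + y.1 0 2 * x2 + y.1 0 3 * m = 0 ->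
  y.1 0 0 * a0 + y.1 0 1 * a1 + y.1 0 2 * a2 +
    (y.2 0 4 * x0 + y.2 1 4 * x1 + y.2 2 4 * x2 + y.2 3 4 * m) = 0 ->
  tanM y (demb y x0 x1 x2 m a0 a1 a2).
Proof.
move=> h d y4 H2 H4; have [[E12 E02 E01] [E03 E13 E23]] := asd_entries h d y4.
have [_ H1 H3 _] := asd_coord h d y4.
have aA := asd_antisym h.
apply/tanMP; split; first by rewrite dotE big_ord5 !mxE /= mulr0 addr0.
rewrite /demb /=; set W := skew _ _ _ _ _ _ _ _ _ _; set x' := vec5 _ _ _ _ _.
have aW : W^T = - W by exact: skew_tr.
apply/antisym0P; first by rewrite !raddfD /= !star_tr aW.
have E02' : y.2 0 2 = - (y.1 0 3 * y.2 1 4 - y.2 3 4 * y.1 0 1) by rewrite -E02 opprK.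
rewrite !addmxE !(star01 _ aA, star02 _ aA, star03 _ aA, star04 _ aA, star12 _ aA,
 star13 _ aA, star14 _ aA, star23 _ aA, star24 _ aA, star34 _ aA).
rewrite !(star01 _ aW, star02 _ aW, star03 _ aW, star04 _ aW, star12 _ aW,
 star13 _ aW, star14 _ aW, star23 _ aW, star24 _ aW, star34 _ aW) y4.
rewrite E12 E02' E01 E03 E13 E23 !mxE /=.
move: (y.1) (y.2) H1 H2 H3 H4 => x A H1 H2 H3 H4.
split; [split|split| | |]; try ring.
- lincomb (- a0 * dif H1 - 2 * A 0 4 * dif H2 + x0 * dif H3 + x 0 0 * dif H4).
- lincomb (- a1 * dif H1 - 2 * A 1 4 * dif H2 + x1 * dif H3 + x 0 1 * dif H4).
- lincomb (- a2 * dif H1 - 2 * A 2 4 * dif H2 + x2 * dif H3 + x 0 2 * dif H4).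
- lincomb (- 2 * A 3 4 * dif H2 + m * dif H3 + x 0 3 * dif H4).
Qed.
End NormalForm.

(** * The SU(2)-structure *)

Section Structure.
Context {R : realType}.
Local Notation E := ('rV[R]_5 * 'M[R]_5)%type.
Implicit Types (y z : E).

(* The suffix C marks objects in the rotated coordinates, where beta = 0.
   Throughout, q is (c + r^2)^(1/4) and l is sqrt 2 q^2. *)
Definition fibC (c u v q : R) y : Prop :=
  [/\ asd y, dot y.1 y.1 = 1, y.1 0 4 = 0, y.2 3 4 = u &
  [/\ 0 < q, q ^+ 4 = c + (y.2 0 4 ^+ 2 + y.2 1 4 ^+ 2 + y.2 2 4 ^+ 2 + u ^+ 2) &
      2 * q * y.1 0 3 = v]].

(* a . dx at y = (x, A), where a is the last column of A. *)
Definition pair_ax y z : R :=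
  y.2 0 4 * z.1 0 0 + y.2 1 4 * z.1 0 1 + y.2 2 4 * z.1 0 2 + y.2 3 4 * z.1 0 3.
Definition pair_aa y z : R :=
  y.2 0 4 * z.2 0 4 + y.2 1 4 * z.2 1 4 + y.2 2 4 * z.2 2 4.
Definition pair_xx y z : R :=
  y.1 0 0 * z.1 0 0 + y.1 0 1 * z.1 0 1 + y.1 0 2 * z.1 0 2 + y.1 0 3 * z.1 0 3.

(** The third and fourth clauses are the differentials of x . a = 0 and of q m = const. For the
    latter, q^4 = c + |a|^2 gives 2 q^3 dq = a . da, where a_3 = u does not vary. *)
Definition tanC (q : R) y z : Prop :=
  [/\ z = demb y (z.1 0 0) (z.1 0 1) (z.1 0 2) (z.1 0 3) (z.2 0 4) (z.2 1 4) (z.2 2 4),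
    pair_xx y z = 0,
    y.1 0 0 * z.2 0 4 + y.1 0 1 * z.2 1 4 + y.1 0 2 * z.2 2 4 + pair_ax y z = 0 &
    2 * q ^+ 4 * z.1 0 3 + y.1 0 3 * pair_aa y z = 0].

Lemma fibre_fibC c u v b (p : E) : fibre c (base u v b) p ->
  0 < c + rsq p.2 /\ fibC c u v (quarter c p) (Phi b p).
Proof.
move=> /fibre_Phi[d h r [y34 y3 y4]]; have [_ _ _ rE] := asd_coord h d y4.
have r' : 0 < c + rsq p.2 by rewrite -(rsq_Phi b).
split=> //; split=> //; split=> //; first exact: quarter_gt0.
by rewrite quarter4// -(rsq_Phi b) rE y34.
Qed.

Lemma tanN_tanC c u v b (p w : E) : fibre c (base u v b) p ->
  tanN c p w <-> tanC (quarter c p) (Phi b p) (Phi b w).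
Proof.
move=> fp; have [r [h d y4 y34 [q0 q4 y3]]] := fibre_fibC fp.
rewrite (tanN_Phi w r y4) -(propext (tanM_Phi b p w)); split.
  move=> [Tw [z34 z4 e]]; have [zE T1 T2 D] := tan_coord h d y4 Tw z34.
  split=> //; first exact: zE.
  by move: e; rewrite D /pair_aa => e; lincomb (2^-1 * dif e).
move=> [zE T1 T2 T3]; have Tz : tanM (Phi b p) (Phi b w) by rewrite zE; apply: demb_tan.
have z4 : (Phi b w).1 0 4 = 0 by rewrite zE mxE.
have z34 : (Phi b w).2 3 4 = 0 by rewrite zE mxE.
split=> //; split=> //.
have [_ _ _ ->] := tan_coord h d y4 Tz z34.
by move: T3; rewrite /pair_aa => T3; lincomb (2 * dif T3).
Qed.

Lemma dembE y x0 x1 x2 m a0 a1 a2 : let z := demb y x0 x1 x2 m a0 a1 a2 in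
  ((z.1 0 0 = x0) * (z.1 0 1 = x1) * (z.1 0 2 = x2) * (z.1 0 3 = m) * (z.1 0 4 = 0) *
  (z.2 0 4 = a0) * (z.2 1 4 = a1) * (z.2 2 4 = a2) * (z.2 3 4 = 0))%type.
Proof. by rewrite /= !mxE. Qed.

(** Here [r] stands for q^2 and [ri] for q^-2. The zeta part is |da|^2 - (x . da)^2, because the
    covariant derivative projects off x, and x . da = - a . dx on the fibre. *)
Definition gC (r ri : R) y z z' : R :=
  ri * (z.2 0 4 * z'.2 0 4 + z.2 1 4 * z'.2 1 4 + z.2 2 4 * z'.2 2 4
        - pair_ax y z * pair_ax y z') + 2 * r * pair_xx z z'.

Definition wC z z' : R := Num.sqrt 2 *
  (z.2 0 4 * z'.1 0 0 + z.2 1 4 * z'.1 0 1 + z.2 2 4 * z'.1 0 2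
   - (z'.2 0 4 * z.1 0 0 + z'.2 1 4 * z.1 0 1 + z'.2 2 4 * z.1 0 2)).

(** Multiplication of l dx - i da by i would give l dx |-> da and da |-> - l dx, which leaves the
    tangent space. The multiples of x repair this: the first one restores x . dx = 0, the second one
    restores da_3 = 0. *)
Definition JC (l li : R) y z : E :=
  demb y (li * (z.2 0 4 + pair_ax y z * y.1 0 0)) (li * (z.2 1 4 + pair_ax y z * y.1 0 1))
    (li * (z.2 2 4 + pair_ax y z * y.1 0 2)) (li * (pair_ax y z * y.1 0 3))
    (- l * z.1 0 0 - li * pair_aa y z * y.1 0 0) (- l * z.1 0 1 - li * pair_aa y z * y.1 0 1)
    (- l * z.1 0 2 - li * pair_aa y z * y.1 0 2).

End Structure.

Ltac lincombp t := apply: (@lincomb_eq _ _ _ t);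
  [rewrite /dif /pair_ax /pair_aa /pair_xx ?dembE; first [ring | by field] | rewrite ?dif0; ring].

(** * Compatibility of metric, form, complex structure and determinant form *)

Section Hermitian.
Context {R : realType}.
Local Notation E := ('rV[R]_5 * 'M[R]_5)%type.
Implicit Types (y z : E).

Lemma JC_tan c u v q l y z : fibC c u v q y -> l ^+ 2 = 2 * q ^+ 4 -> l != 0 ->
  tanC q y z -> tanC q y (JC l l^-1 y z).
Proof.
move=> [h d y4 y34 [q0 q4 y3]] l2 l0 [zE T1 T2 T3].
have [_ H1 H3 _] := asd_coord h d y4.
(* The inverse becomes a variable [li] with the single relation l li = 1, so that the certificates
   stay polynomial. *)
have hl : l * l^-1 = 1 by rewrite divff.
move: l^-1 hl => li hl; rewrite /JC; split; first by rewrite !dembE.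
- lincombp (li * dif T2 + li * pair_ax y z * dif H1).
- rewrite !dembE; lincombp (- l * dif T1 - li * pair_aa y z * dif H1 + li * pair_ax y z * dif H3 +
    y.1 0 3 * (li * dif T3 - z.1 0 3 * l * dif hl + z.1 0 3 * li * dif l2)).
- rewrite !dembE; lincombp (y.1 0 3 * (- li * pair_ax y z * dif l2 + l * pair_ax y z * dif hl
    - li * pair_aa y z * dif H3
    + y.2 3 4 * (li * dif T3 - z.1 0 3 * l * dif hl + z.1 0 3 * li * dif l2))).
Qed.

Lemma JC_sq c u v q l y z : fibC c u v q y -> l ^+ 2 = 2 * q ^+ 4 -> l != 0 ->
  tanC q y z -> JC l l^-1 y (JC l l^-1 y z) = - z.
Proof.
move=> [h d y4 y34 [q0 q4 y3]] l2 l0 [zE T1 T2 T3].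
have [_ H1 H3 _] := asd_coord h d y4.
have hl : l * l^-1 = 1 by rewrite divff.
have DN x0 x1 x2 m a0 a1 a2 : - demb y x0 x1 x2 m a0 a1 a2 =
  demb y (- x0) (- x1) (- x2) (- m) (- a0) (- a1) (- a2).
  apply/pair_equal_spec; split; apply/matrixP => i j; rewrite !mxE.
    by elim/ord5P: j; rewrite /= ?oppr0.
  by elim/ord5P: i; elim/ord5P: j; rewrite /=; ring.
rewrite [in RHS]zE DN.
move: l^-1 hl => li hl; rewrite {1}/JC; congr (demb y _ _ _ _ _ _ _).
- rewrite /JC ?dembE; lincombp (- z.1 0 0 * dif hl + li * li * pair_ax y z * y.1 0 0 * dif H3).
- rewrite /JC ?dembE; lincombp (- z.1 0 1 * dif hl + li * li * pair_ax y z * y.1 0 1 * dif H3).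
- rewrite /JC ?dembE; lincombp (- z.1 0 2 * dif hl + li * li * pair_ax y z * y.1 0 2 * dif H3).
- rewrite /JC ?dembE; lincombp (li ^+ 2 * dif T3 + li ^+ 2 * z.1 0 3 * dif l2
    - z.1 0 3 * (l * li + 1) * dif hl + li * li * pair_ax y z * y.1 0 3 * dif H3).
- rewrite /JC ?dembE; lincombp (- z.2 0 4 * dif hl + li ^+ 2 * pair_aa y z * y.1 0 0 * dif H3
    - y.1 0 0 * y.2 3 4 * li * (li * dif T3 - z.1 0 3 * l * dif hl + z.1 0 3 * li * dif l2)).
- rewrite /JC ?dembE; lincombp (- z.2 1 4 * dif hl + li ^+ 2 * pair_aa y z * y.1 0 1 * dif H3
    - y.1 0 1 * y.2 3 4 * li * (li * dif T3 - z.1 0 3 * l * dif hl + z.1 0 3 * li * dif l2)).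
- rewrite /JC ?dembE; lincombp (- z.2 2 4 * dif hl + li ^+ 2 * pair_aa y z * y.1 0 2 * dif H3
    - y.1 0 2 * y.2 3 4 * li * (li * dif T3 - z.1 0 3 * l * dif hl + z.1 0 3 * li * dif l2)).
Qed.

Definition tri (p q r : 'I_5 -> R) : R :=
  p 0 * (q 1 * r 2 - q 2 * r 1) - p 1 * (q 0 * r 2 - q 2 * r 0) + p 2 * (q 0 * r 1 - q 1 * r 0).

(* The determinants of the 4-vectors (x, e, p, q) and (x, a, p, q). *)
Definition D0 (x p q : 'I_5 -> R) : R := tri x p q.
Definition D1 (x a p q : 'I_5 -> R) : R :=
  - x 3 * tri a p q + a 3 * tri x p q - p 3 * tri x a q + q 3 * tri x a p.

Definition reD0 l x P A P' A' : R := l ^+ 2 * D0 x P P' - D0 x A A'.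
Definition imD0 l x P A P' A' : R := - l * (D0 x P A' + D0 x A P').
Definition reD1 l x a P A P' A' : R := l ^+ 2 * D1 x a P P' - D1 x a A A'.
Definition imD1 l x a P A P' A' : R := - l * (D1 x a P A' + D1 x a A P').
(* Real and imaginary parts of det(x, l e - i x_3 a, l P - i A, l P' - i A'). *)
Definition reD l (x a P A P' A' : 'I_5 -> R) : R :=
  l * reD0 l x P A P' A' + x 3 * imD1 l x a P A P' A'.
Definition imD l (x a P A P' A' : 'I_5 -> R) : R :=
  l * imD0 l x P A P' A' - x 3 * reD1 l x a P A P' A'.

(* J acts on l dx - i da as multiplication by i, modulo x. *)
Lemma D_type20 l s t (x a P A P' A' : 'I_5 -> R) : l != 0 ->
  reD l x a (fun i => l^-1 * (A i + s * x i)) (fun i => - l * P i - l^-1 * t * x i) P' A' =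
    - imD l x a P A P' A' /\
  imD l x a (fun i => l^-1 * (A i + s * x i)) (fun i => - l * P i - l^-1 * t * x i) P' A' =
    reD l x a P A P' A'.
Proof.
move=> l0; rewrite /reD /imD /reD0 /imD0 /reD1 /imD1 /D0 /D1 /tri; split.
  by field.
by field.
Qed.

Lemma gC_wC c u v q l r ri y z z' : fibC c u v q y -> l ^+ 2 = 2 * q ^+ 4 -> l != 0 ->
  Num.sqrt 2 * l^-1 = ri -> Num.sqrt 2 * l = 2 * r ->
  tanC q y z -> tanC q y z' -> gC r ri y z z' = wC z (JC l l^-1 y z').
Proof.
move=> [h d y4 y34 [q0 q4 y3]] l2 l0 e1 e2 [_ T1 T2 _] [_ _ _ T3].
have hl : l * l^-1 = 1 by rewrite divff.
rewrite /wC; set s2 := Num.sqrt 2 in e1 e2 *.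
move: l^-1 hl e1 => li hl e1; rewrite /JC ?dembE /gC.
lincombp (- (z.2 0 4 * z'.2 0 4 + z.2 1 4 * z'.2 1 4 + z.2 2 4 * z'.2 2 4
        - pair_ax y z * pair_ax y z') * dif e1 - pair_xx z z' * dif e2
  - s2 * li * pair_ax y z' * dif T2 - s2 * li * pair_aa y z' * dif T1
  + s2 * li * z.1 0 3 * dif T3 - s2 * l * z.1 0 3 * z'.1 0 3 * dif hl
  + s2 * li * z.1 0 3 * z'.1 0 3 * dif l2).
Qed.

Lemma wC_anti z z' : wC z z' = - wC z' z.
Proof. by rewrite /wC; ring. Qed.

Lemma wCN z z' : wC z (- z') = - wC z z'.
Proof. by rewrite /wC !mxE; ring. Qed.

Lemma gC_sym r ri y z z' : gC r ri y z z' = gC r ri y z' z.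
Proof. by rewrite /gC /pair_xx; ring. Qed.

(** Formal from g = w (., J .): g (J z, J z') = w (J z, J J z') = - w (J z, z') = w (z', J z) = g
    (z', z). *)
Lemma gC_J c u v q l r ri y z z' : fibC c u v q y -> l ^+ 2 = 2 * q ^+ 4 -> l != 0 ->
  Num.sqrt 2 * l^-1 = ri -> Num.sqrt 2 * l = 2 * r ->
  tanC q y z -> tanC q y z' ->
  gC r ri y (JC l l^-1 y z) (JC l l^-1 y z') = gC r ri y z z'.
Proof.
move=> f l2 l0 e1 e2 Tz Tz'; have TJ := JC_tan f l2 l0 Tz; have TJ' := JC_tan f l2 l0 Tz'.
rewrite (gC_wC f l2 l0 e1 e2 TJ TJ') (JC_sq f l2 l0 Tz') wCN -wC_anti.
by rewrite -(gC_wC f l2 l0 e1 e2 Tz' Tz) gC_sym.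
Qed.

Lemma demb0 y : demb y 0 0 0 0 0 0 0 = 0.
Proof.
apply/pair_equal_spec; split; apply/matrixP => i j; rewrite !mxE.
  by elim/ord5P: j.
by elim/ord5P: i; elim/ord5P: j; rewrite /=; ring.
Qed.

(** Completing the square turns the zeta part into the squared norm of da + (a . dx) x. If the sum
    vanishes then dx = 0, hence a . dx = 0 and da = 0. *)
Lemma gC_pos c u v q r ri y z : fibC c u v q y -> 0 < r -> 0 < ri ->
  tanC q y z -> z != 0 -> 0 < gC r ri y z z.
Proof.
move=> [h d y4 y34 [q0 q4 y3]] r0 ri0 [zE _ T2 _] z0.
have [_ H1 _ _] := asd_coord h d y4.
have E : gC r ri y z z = ri * ((z.2 0 4 + pair_ax y z * y.1 0 0) ^+ 2
  + (z.2 1 4 + pair_ax y z * y.1 0 1) ^+ 2 + (z.2 2 4 + pair_ax y z * y.1 0 2) ^+ 2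
  + (pair_ax y z * y.1 0 3) ^+ 2) + 2 * r * pair_xx z z.
  rewrite /gC; lincombp (- 2 * ri * pair_ax y z * dif T2 - ri * pair_ax y z ^+ 2 * dif H1).
have x0 : 0 <= pair_xx z z by rewrite /pair_xx -!expr2 !addr_ge0 ?sqr_ge0.
rewrite E lt_neqAle; apply/andP; split; last first.
  by apply: addr_ge0; apply: mulr_ge0; rewrite ?addr_ge0 ?sqr_ge0 ?mulr_ge0// ltW.
apply: contra_neq z0 => /esym /eqP.
rewrite paddr_eq0 ?mulr_ge0 ?addr_ge0 ?sqr_ge0 ?(ltW r0) ?(ltW ri0)//.
rewrite !mulf_eq0 (gt_eqF r0) (gt_eqF ri0) pnatr_eq0 /= /pair_xx -!expr2.
rewrite !paddr_eq0 ?addr_ge0 ?sqr_ge0// !expf_eq0 /=.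
move=> /andP[/andP[/andP[/andP[/eqP A0 /eqP A1] /eqP A2] _]].
move=> /andP[/andP[/andP[/eqP X0 /eqP X1] /eqP X2] /eqP X3].
have s0 : pair_ax y z = 0 by rewrite /pair_ax X0 X1 X2 X3; ring.
rewrite s0 !mul0r !addr0 in A0 A1 A2.
by rewrite zE X0 X1 X2 X3 A0 A1 A2 demb0.
Qed.

Lemma D_anti l x a P A P' A' : reD l x a P A P' A' = - reD l x a P' A' P A /\
  imD l x a P A P' A' = - imD l x a P' A' P A.
Proof. by rewrite /reD /imD /reD0 /imD0 /reD1 /imD1 /D0 /D1 /tri; split; ring. Qed.

Lemma D_ext l x a P A P' A' Q B : (forall i, i != 4 -> P i = Q i) -> (forall i, i != 4 -> A i = B i) ->
  reD l x a P A P' A' = reD l x a Q B P' A' /\ imD l x a P A P' A' = imD l x a Q B P' A'.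
Proof.
move=> PQ AB; rewrite /reD /imD /reD0 /imD0 /reD1 /imD1 /D0 /D1 /tri.
by rewrite !(PQ 0) ?(PQ 1) ?(PQ 2) ?(PQ 3) ?(AB 0) ?(AB 1) ?(AB 2) ?(AB 3).
Qed.

Definition xs z : 'I_5 -> R := fun i => z.1 0 i.
Definition As z : 'I_5 -> R := fun i => z.2 i 4.
Definition reC l y z z' := reD l (xs y) (As y) (xs z) (As z) (xs z') (As z').
Definition imC l y z z' := imD l (xs y) (As y) (xs z) (As z) (xs z') (As z').

Lemma C_type20 c u v q l y z z' : fibC c u v q y -> l ^+ 2 = 2 * q ^+ 4 -> l != 0 ->
  tanC q y z ->
  reC l y (JC l l^-1 y z) z' = - imC l y z z' /\ imC l y (JC l l^-1 y z) z' = reC l y z z'.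
Proof.
move=> f l2 l0 [zE T1 T2 T3]; rewrite /reC /imC.
have [<- <-] := D_type20 (pair_ax y z) (pair_aa y z) (xs y) (As y) (xs z) (As z) (xs z') (As z') l0.
have hl : l * l^-1 = 1 by rewrite divff.
have z34 : z.2 3 4 = 0 by rewrite zE mxE.
apply: D_ext.
  apply: ord5P => //= _; rewrite /xs /As /JC dembE //.
  by rewrite z34 add0r.
apply: ord5P => //= _; rewrite /xs /As /JC dembE //.
move: l^-1 hl => li hl.
(* [JC] has da_3 = 0, whereas the formula in [D_type20] has - l dm - l^-1 (a . da) m; the latter
   vanishes because q m is constant on the fibre. *)
lincombp (li * dif T3 - z.1 0 3 * l * dif hl + z.1 0 3 * li * dif l2).
Qed.

(** The infinitesimal rotation of R^3 about the axis e: x moves by e cross x and a by e cross a.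
    Rotations preserve the fibration, so this is tangent to the fibre; such vectors suffice to
    detect Omega. *)
Definition gen y (e0 e1 e2 : R) : E :=
  demb y (e1 * y.1 0 2 - e2 * y.1 0 1) (e2 * y.1 0 0 - e0 * y.1 0 2)
     (e0 * y.1 0 1 - e1 * y.1 0 0) 0
     (e1 * y.2 2 4 - e2 * y.2 1 4) (e2 * y.2 0 4 - e0 * y.2 2 4) (e0 * y.2 1 4 - e1 * y.2 0 4).

Lemma gen_tan q y e0 e1 e2 : tanC q y (gen y e0 e1 e2).
Proof.
rewrite /gen; split; first by rewrite !dembE.
- by rewrite /pair_xx !dembE; ring.
- by rewrite /pair_ax !dembE; ring.
- by rewrite /pair_aa !dembE; ring.
Qed.

(** With h = e cross g, the determinant form takes the value H (l x - i a) . h on two rotation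
    fields, where H is the squared norm of l e_3 + i m a after projection off x, e_3 being the
    fourth unit vector. *)
Lemma C_gen c u v q l y (e0 e1 e2 g0 g1 g2 : R) : fibC c u v q y ->
  let H := l ^+ 2 * (y.1 0 0 ^+ 2 + y.1 0 1 ^+ 2 + y.1 0 2 ^+ 2)
     + y.1 0 3 ^+ 2 * (y.2 0 4 ^+ 2 + y.2 1 4 ^+ 2 + y.2 2 4 ^+ 2 + u ^+ 2) in
  let h0 := e1 * g2 - e2 * g1 in let h1 := e2 * g0 - e0 * g2 in
  let h2 := e0 * g1 - e1 * g0 in
  reC l y (gen y e0 e1 e2) (gen y g0 g1 g2) =
    H * l * (y.1 0 0 * h0 + y.1 0 1 * h1 + y.1 0 2 * h2) /\
  imC l y (gen y e0 e1 e2) (gen y g0 g1 g2) =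
    - H * (y.2 0 4 * h0 + y.2 1 4 * h1 + y.2 2 4 * h2).
Proof.
move=> [h d y4 y34 _] /=; have [_ H1 H3 _] := asd_coord h d y4.
rewrite /reC /imC /gen /reD /imD /reD0 /imD0 /reD1 /imD1 /D0 /D1 /tri /xs /As !dembE !y34.
rewrite y34 in H3.
move: (y.1 0 0) (y.1 0 1) (y.1 0 2) (y.1 0 3) (y.2 0 4) (y.2 1 4) (y.2 2 4) H1 H3.
move=> x0 x1 x2 m a0 a1 a2 H1 H3; split.
  lincomb (- l * (x0 * (e1 * g2 - e2 * g1) + x1 * (e2 * g0 - e0 * g2) + x2 * (e0 * g1 - e1 * g0))
    * (m * u * dif H3) + l * (a0 * (e1 * g2 - e2 * g1) + a1 * (e2 * g0 - e0 * g2) + a2 * (e0 * g1 - e1 * g0))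
    * ((x0 * a0 + x1 * a1 + x2 * a2) * dif H1 - (x0 ^+ 2 + x1 ^+ 2 + x2 ^+ 2) * dif H3)).
lincomb ((a0 * (e1 * g2 - e2 * g1) + a1 * (e2 * g0 - e0 * g2) + a2 * (e0 * g1 - e1 * g0))
    * (m * u * dif H3) + l ^+ 2 * (x0 * (e1 * g2 - e2 * g1) + x1 * (e2 * g0 - e0 * g2) + x2 * (e0 * g1 - e1 * g0))
    * ((x0 * a0 + x1 * a1 + x2 * a2) * dif H1 - (x0 ^+ 2 + x1 ^+ 2 + x2 ^+ 2) * dif H3)).
Qed.

(** The first three components of x and of a vanish together only at fixed points of the rotations.
    There m = 1, since v >= 0 rules out -1; then x . a = 0 gives u = 0, and q^4 = c gives the
    excluded value of v. *)
Lemma fibC_nonsing c u v q y : 0 <= c -> 0 <= v -> fibC c u v q y ->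
  ~ (u = 0 /\ v = 2 * c `^ (4^-1)) ->
  0 < y.1 0 0 ^+ 2 + y.1 0 1 ^+ 2 + y.1 0 2 ^+ 2 + (y.2 0 4 ^+ 2 + y.2 1 4 ^+ 2 + y.2 2 4 ^+ 2).
Proof.
move=> c0 v0 [h d y4 y34 [q0 q4 y3]] ns; have [_ H1 H3 _] := asd_coord h d y4.
rewrite lt_neqAle !addr_ge0 ?sqr_ge0// andbT; apply/eqP => /esym /eqP.
rewrite !paddr_eq0 ?addr_ge0 ?sqr_ge0// !expf_eq0 /=.
move=> /andP[/andP[/andP[/eqP x0 /eqP x1] /eqP x2] /andP[/andP[/eqP a0 /eqP a1] /eqP a2]].
have m0 : 0 <= y.1 0 3 by rewrite -(pmulr_rge0 _ (mulr_gt0 (ltr0Sn R 1) q0)) y3.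
have m1 : y.1 0 3 = 1.
  apply/eqP; rewrite -(@eqrXn2 _ 2)// expr1n -H1 x0 x1 x2; apply/eqP; ring.
have u0 : u = 0 by rewrite -y34 -H3 a0 a1 a2 m1; ring.
apply: ns; split=> //; rewrite -y3 m1 mulr1; congr (_ * _).
have -> : c = q ^+ 4 by rewrite q4 a0 a1 a2 u0; ring.
by rewrite -powR_mulrn ?(ltW q0)// -powRrM mulfV ?pnatr_eq0// powRr1// ltW.
Qed.

Lemma C_nonzero c u v q l k1 k2 y : 0 <= c -> 0 <= v -> fibC c u v q y ->
  ~ (u = 0 /\ v = 2 * c `^ (4^-1)) -> 0 < l -> k1 ^+ 2 + k2 ^+ 2 != 0 ->
  exists z z', [/\ tanC q y z, tanC q y z' &
    k1 * reC l y z z' + k2 * imC l y z z' != 0 \/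
    k1 * imC l y z z' - k2 * reC l y z z' != 0].
Proof.
move=> c0 v0 f ns l0 k0; have pos := fibC_nonsing c0 v0 f ns.
have [h d y4 y34 [q0 q4 y3]] := f; have [_ H1 H3 _] := asd_coord h d y4.
have key (e0 e1 e2 g0 g1 g2 : R) :
    (y.1 0 0 * (e1 * g2 - e2 * g1) + y.1 0 1 * (e2 * g0 - e0 * g2) + y.1 0 2 * (e0 * g1 - e1 * g0)) ^+ 2 +
    (y.2 0 4 * (e1 * g2 - e2 * g1) + y.2 1 4 * (e2 * g0 - e0 * g2) + y.2 2 4 * (e0 * g1 - e1 * g0)) ^+ 2
    != 0 -> exists z z', [/\ tanC q y z, tanC q y z' &
    k1 * reC l y z z' + k2 * imC l y z z' != 0 \/
    k1 * imC l y z z' - k2 * reC l y z z' != 0].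
  have [re im] := C_gen l e0 e1 e2 g0 g1 g2 f; move: re im => /=.
  set H := (X in X * l * _); set X := (X in H * l * X); set A := (X in - H * X) => re im XA.
  exists (gen y e0 e1 e2), (gen y g0 g1 g2); split; [exact: gen_tan|exact: gen_tan|].
  (* If H = 0 then the first three components of x vanish, so m^2 = 1, and then a vanishes as
     well. *)
  have H0 : H != 0.
    apply: contraTneq pos => /eqP.
    rewrite paddr_eq0; [|by rewrite mulr_ge0// ?addr_ge0 ?sqr_ge0 ..].
    rewrite mulf_eq0 expf_eq0 (gt_eqF l0) /= => /andP[/eqP x0].
    have -> : y.1 0 3 ^+ 2 = 1 by rewrite -H1 x0 add0r.
    rewrite mul1r paddr_eq0 ?addr_ge0 ?sqr_ge0// => /andP[/eqP -> _].
    by rewrite x0 addr0 ltxx.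
  apply/orP; rewrite -negb_and; apply: contra XA => /andP[/eqP E1 /eqP E2].
  have R0 : reC l y (gen y e0 e1 e2) (gen y g0 g1 g2) = 0.
    by apply: (mulfI k0); lincomb (k1 * dif E1 - k2 * dif E2).
  have I0 : imC l y (gen y e0 e1 e2) (gen y g0 g1 g2) = 0.
    by apply: (mulfI k0); lincomb (k2 * dif E1 + k1 * dif E2).
  change (X ^+ 2 + A ^+ 2 == 0); move: R0 I0; rewrite re im => /eqP; rewrite mulf_eq0 mulf_eq0 (negPf H0) (gt_eqF l0) /= => /eqP ->.
  by move=> /eqP; rewrite mulf_eq0 oppr_eq0 (negPf H0) /= => /eqP ->; rewrite expr0n addr0.
have [k12|/norP[n0 /norP[n1 n2]]] := boolP [|| y.1 0 0 ^+ 2 + y.2 0 4 ^+ 2 != 0,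
    y.1 0 1 ^+ 2 + y.2 1 4 ^+ 2 != 0 | y.1 0 2 ^+ 2 + y.2 2 4 ^+ 2 != 0]; last first.
  move: n0 n1 n2 pos; rewrite !negbK => /eqP n0 /eqP n1 /eqP n2.
  suff -> : y.1 0 0 ^+ 2 + y.1 0 1 ^+ 2 + y.1 0 2 ^+ 2 +
    (y.2 0 4 ^+ 2 + y.2 1 4 ^+ 2 + y.2 2 4 ^+ 2) = 0 by rewrite ltxx.
  by lincomb (dif n0 + dif n1 + dif n2).
(* In each case e and g are two unit vectors whose cross product is the third one, taken along a
   coordinate where x or a does not vanish. *)
case/or3P: k12 => H.
- by apply: (key 0 1 0 0 0 1); rewrite !(mulr0, mul0r, mulr1, subr0, sub0r, addr0, add0r, oppr0).
- by apply: (key 0 0 1 1 0 0); rewrite !(mulr0, mul0r, mulr1, subr0, sub0r, addr0, add0r, oppr0).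
- by apply: (key 1 0 0 0 1 0); rewrite !(mulr0, mul0r, mulr1, subr0, sub0r, addr0, add0r, oppr0).
Qed.
End Hermitian.

(** * Smoothness of the structure *)

Section SU2.
Context {R : realType}.
Local Notation E := ('rV[R]_5 * 'M[R]_5)%type.
Context (c b : R).

Lemma coord_linear a (z z' : E) : (forall i, (a *: z + z').1 0 i = a * z.1 0 i + z'.1 0 i) *
  (forall i j, (a *: z + z').2 i j = a * z.2 i j + z'.2 i j).
Proof. by split=> *; rewrite !mxE. Qed.

Lemma smooth_Phi_x (U : set E) i : open U -> smooth_on U (fun q : E => (Phi b q).1 0 i : R^o).
Proof.
move=> oU; under eq_fun do rewrite /Phi /= mxE.
by apply: smooth_sum => // j; apply: smoothM => //; [exact: smooth_x|exact: smooth_cst].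
Qed.

Lemma smooth_Phi_A (U : set E) i j : open U -> smooth_on U (fun q : E => (Phi b q).2 i j : R^o).
Proof.
move=> oU; under eq_fun do rewrite /Phi /= mxE.
apply: smooth_sum => // k; apply: smoothM => //; last exact: smooth_cst.
under eq_fun do rewrite mxE.
by apply: smooth_sum => // l; apply: smoothM => //; [exact: smooth_cst|exact: smooth_A].
Qed.

Definition root_radius (q : E) : R := (c + rsq q.2) `^ (2^-1).
Definition inv_root_radius (q : E) : R := (c + rsq q.2) `^ (- 2^-1).
Definition lam (q : E) : R := Num.sqrt 2 * root_radius q.
(** The inverse of [lam] where c + r^2 > 0, written as a real power so that its smoothness is that
    of powers of the radius. *)
Definition lami (q : E) : R := (Num.sqrt 2)^-1 * inv_root_radius q.

(* Omega is (k1 - i k2) times the determinant form. *)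
Definition su2 (k1 k2 : R) : su2data E := {|
  metr p X Y := gC (root_radius p) (inv_root_radius p) (Phi b p) (Phi b X) (Phi b Y);
  cplx p X := PhiV b (JC (lam p) (lami p) (Phi b p) (Phi b X));
  omeg p X Y := wC (Phi b X) (Phi b Y);
  ReO p X Y := k1 * reC (lam p) (Phi b p) (Phi b X) (Phi b Y)
             + k2 * imC (lam p) (Phi b p) (Phi b X) (Phi b Y);
  ImO p X Y := k1 * imC (lam p) (Phi b p) (Phi b X) (Phi b Y)
             - k2 * reC (lam p) (Phi b p) (Phi b X) (Phi b Y) |}.

Lemma radius_facts (p : E) : 0 < c + rsq p.2 ->
  [/\ root_radius p = quarter c p ^+ 2, inv_root_radius p = quarter c p ^- 2,
    lami p = (lam p)^-1, 0 < lam p & lam p ^+ 2 = 2 * quarter c p ^+ 4] /\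
  (Num.sqrt 2 * (lam p)^-1 = inv_root_radius p /\ Num.sqrt 2 * lam p = 2 * root_radius p).
Proof.
move=> r0; have [e1 e2 _ _] := quarter_pow r0; have q0 := quarter_gt0 r0.
have s20 : (0 : R) < Num.sqrt 2 by rewrite sqrtr_gt0.
have s2 : Num.sqrt 2 ^+ 2 = 2 :> R by rewrite sqr_sqrtr.
rewrite /lami /lam /root_radius /inv_root_radius e1 e2.
split; [split=> //|split].
- by field; rewrite !gt_eqF.
- by rewrite mulr_gt0// exprn_gt0.
- by rewrite exprMn s2; ring.
- by field; rewrite !gt_eqF.
- by rewrite mulrA -expr2 s2.
Qed.

Ltac smooth_tac :=
  repeat first
    [ exact: smooth_cst | apply: smooth_Phi_x | apply: smooth_Phi_A | exact: smooth_powR_radius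
    | apply: smoothD | apply: smoothB | apply: smoothN | apply: smoothM | apply: smoothX
    | exact: open_pos_radius ].

(** The formulas make sense on the whole open set c + r^2 > 0, so one and the same expression is the
    ambient extension at every point of the fibre. *)
Lemma smooth_bilin_glob (N : set E) (T : E -> set E) (B : E -> E -> E -> R) :
  (forall p, N p -> 0 < c + rsq p.2) -> (forall q, bilin (B q)) ->
  (forall X Y, smooth_on (pos_radius c) (fun q => B q X Y : R^o)) -> smooth_bilin N T B.
Proof.
move=> Nr Bb Bs p Np; exists (pos_radius c), B; split=> //.
- exact: open_pos_radius.
- exact: Nr.
Qed.

Lemma metr_smooth k1 k2 (N : set E) (T : E -> set E) :
  (forall p, N p -> 0 < c + rsq p.2) -> smooth_bilin N T (metr (su2 k1 k2)).
Proof.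
move=> Nr; apply: smooth_bilin_glob => // [q|X Y].
  by split=> a X Y Z; rewrite /= Phi_linear /gC /pair_ax /pair_xx !mxE; ring.
rewrite /= /gC /pair_ax /pair_xx; smooth_tac.
Qed.

Lemma omeg_smooth k1 k2 (N : set E) (T : E -> set E) :
  (forall p, N p -> 0 < c + rsq p.2) -> smooth_bilin N T (omeg (su2 k1 k2)).
Proof.
move=> Nr; apply: smooth_bilin_glob => // [q|X Y].
  by split=> a X Y Z; rewrite /= Phi_linear /wC !mxE; ring.
exact: smooth_cst.
Qed.

Lemma C_linear (l : R) (y z z' w : E) (a : R) :
  [/\ reC l y (a *: z + z') w = a * reC l y z w + reC l y z' w,
      reC l y w (a *: z + z') = a * reC l y w z + reC l y w z',
      imC l y (a *: z + z') w = a * imC l y z w + imC l y z' w &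
      imC l y w (a *: z + z') = a * imC l y w z + imC l y w z'].
Proof.
rewrite /reC /imC /reD /imD /reD0 /imD0 /reD1 /imD1 /D0 /D1 /tri /xs /As !coord_linear.
by split; ring.
Qed.

Lemma smooth_tri (U : set E) (f g h : E -> 'I_5 -> R) : open U ->
  (forall i, smooth_on U (fun q => f q i : R^o)) ->
  (forall i, smooth_on U (fun q => g q i : R^o)) ->
  (forall i, smooth_on U (fun q => h q i : R^o)) ->
  smooth_on U (fun q => tri (f q) (g q) (h q) : R^o).
Proof.
move=> oU sf sg sh; rewrite /tri.
by repeat first [ exact: sf | exact: sg | exact: sh | apply: smoothD | apply: smoothB | apply: smoothM | apply: smoothN | exact: oU].
Qed.

Lemma smooth_D1 (U : set E) (f g h k : E -> 'I_5 -> R) : open U ->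
  (forall i, smooth_on U (fun q => f q i : R^o)) ->
  (forall i, smooth_on U (fun q => g q i : R^o)) ->
  (forall i, smooth_on U (fun q => h q i : R^o)) ->
  (forall i, smooth_on U (fun q => k q i : R^o)) ->
  smooth_on U (fun q => D1 (f q) (g q) (h q) (k q) : R^o).
Proof.
move=> oU sf sg sh sk; rewrite /D1.
by repeat first [ exact: sf | exact: sg | exact: sh | exact: sk | exact: oU
  | apply: smooth_tri | apply: smoothD | apply: smoothB | apply: smoothM | apply: smoothN].
Qed.

Lemma C_smooth (X Y : E) :
  smooth_on (pos_radius c) (fun q => reC (lam q) (Phi b q) X Y : R^o) /\
  smooth_on (pos_radius c) (fun q => imC (lam q) (Phi b q) X Y : R^o).
Proof.
have oU := @open_pos_radius R c.
have sx i : smooth_on (pos_radius c) (fun q => xs (Phi b q) i : R^o) by exact: smooth_Phi_x.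
have sA i : smooth_on (pos_radius c) (fun q => As (Phi b q) i : R^o) by exact: smooth_Phi_A.
have sl : smooth_on (pos_radius c) (fun q => lam q : R^o).
  by apply: smoothM => //; [exact: smooth_cst|exact: smooth_powR_radius].
have sc (f : 'I_5 -> R) i : smooth_on (pos_radius c) (fun _ : E => f i : R^o) by exact: smooth_cst.
rewrite /reC /imC /reD /imD /reD0 /imD0 /reD1 /imD1 /D0; split;
by repeat first [ exact: sx | exact: sA | exact: sl | exact: sc | exact: oU | apply: smooth_D1
  | apply: smooth_tri | apply: smoothD | apply: smoothB | apply: smoothM | apply: smoothN | apply: smoothX].
Qed.

Lemma ReO_smooth k1 k2 (N : set E) (T : E -> set E) :
  (forall p, N p -> 0 < c + rsq p.2) -> smooth_bilin N T (ReO (su2 k1 k2)).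
Proof.
move=> Nr; apply: smooth_bilin_glob => // [q|X Y].
  split=> a X Y Z; rewrite /= Phi_linear.
    by have [-> _ -> _] := C_linear (lam q) (Phi b q) (Phi b X) (Phi b Y) (Phi b Z) a; ring.
  by have [_ -> _ ->] := C_linear (lam q) (Phi b q) (Phi b X) (Phi b Y) (Phi b Z) a; ring.
have [sr si] := C_smooth (Phi b X) (Phi b Y); have oU := @open_pos_radius R c.
by apply: smoothD => //; apply: smoothM => //; exact: smooth_cst.
Qed.

Lemma ImO_smooth k1 k2 (N : set E) (T : E -> set E) :
  (forall p, N p -> 0 < c + rsq p.2) -> smooth_bilin N T (ImO (su2 k1 k2)).
Proof.
move=> Nr; apply: smooth_bilin_glob => // [q|X Y].
  split=> a X Y Z; rewrite /= Phi_linear.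
    by have [-> _ -> _] := C_linear (lam q) (Phi b q) (Phi b X) (Phi b Y) (Phi b Z) a; ring.
  by have [_ -> _ ->] := C_linear (lam q) (Phi b q) (Phi b X) (Phi b Y) (Phi b Z) a; ring.
have [sr si] := C_smooth (Phi b X) (Phi b Y); have oU := @open_pos_radius R c.
by apply: smoothB => //; apply: smoothM => //; exact: smooth_cst.
Qed.

Lemma demb_linear (y : E) (a x0 x1 x2 m a0 a1 a2 x0' x1' x2' m' a0' a1' a2' : R) :
  demb y (a * x0 + x0') (a * x1 + x1') (a * x2 + x2') (a * m + m')
    (a * a0 + a0') (a * a1 + a1') (a * a2 + a2') =
  a *: demb y x0 x1 x2 m a0 a1 a2 + demb y x0' x1' x2' m' a0' a1' a2'.
Proof.
apply/pair_equal_spec; split; apply/matrixP => i j; rewrite !mxE.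
  by elim/ord5P: j; rewrite /=; ring.
by elim/ord5P: i; elim/ord5P: j; rewrite /=; ring.
Qed.

Lemma JC_linear (l li a : R) (y z z' : E) : JC l li y (a *: z + z') = a *: JC l li y z + JC l li y z'.
Proof.
by rewrite /JC -demb_linear /pair_ax /pair_aa !coord_linear; congr (demb _ _ _ _ _ _ _ _); ring.
Qed.

Lemma smooth_mulmx_entry (U : set E) m n k l (A : 'M[R]_(m, n)) (M : E -> 'M[R]_(n, k)) (B : 'M[R]_(k, l)) i j :
  open U -> (forall i j, smooth_on U (fun q => M q i j : R^o)) ->
  smooth_on U (fun q => (A *m M q *m B) i j : R^o).
Proof.
move=> oU sM; under eq_fun do rewrite mxE.
apply: smooth_sum => // s; apply: smoothM => //; last exact: smooth_cst.
under eq_fun do rewrite mxE.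
by apply: smooth_sum => // t; apply: smoothM => //; exact: smooth_cst.
Qed.

Lemma smooth_demb (U : set E) (y : E -> E) (x0 x1 x2 m a0 a1 a2 : E -> R) : open U ->
  (forall i, smooth_on U (fun q => (y q).1 0 i : R^o)) ->
  (forall i j, smooth_on U (fun q => (y q).2 i j : R^o)) ->
  smooth_on U (x0 : E -> R^o) -> smooth_on U (x1 : E -> R^o) -> smooth_on U (x2 : E -> R^o) ->
  smooth_on U (m : E -> R^o) ->
  smooth_on U (a0 : E -> R^o) -> smooth_on U (a1 : E -> R^o) -> smooth_on U (a2 : E -> R^o) ->
  smooth_on U (fun q => PhiV b (demb (y q) (x0 q) (x1 q) (x2 q) (m q) (a0 q) (a1 q) (a2 q))).
Proof.
move=> oU sy1 sy2 sx0 sx1 sx2 sm sa0 sa1 sa2; apply: smooth_pair => //; apply: smooth_mx => // i j.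
  under eq_fun do rewrite -[_ *m rot b]mul1mx mulmxA.
  apply: smooth_mulmx_entry => // k {}j; under eq_fun do rewrite mxE.
  by elim/ord5P: j; rewrite /=; first [exact: smooth_cst | done].
apply: smooth_mulmx_entry => // {}i {}j; under eq_fun do rewrite mxE.
by elim/ord5P: i; elim/ord5P: j; rewrite /=; repeat first [ exact: smooth_cst | done | exact: sy1
  | exact: sy2 | apply: smoothD | apply: smoothB | apply: smoothM | apply: smoothN].
Qed.

Lemma cplx_smooth k1 k2 X : smooth_on (pos_radius c) (fun q => cplx (su2 k1 k2) q X).
Proof.
have oU := @open_pos_radius R c.
rewrite /= /JC; apply: smooth_demb => //; rewrite /pair_ax /pair_aa /lam /lami;
  try (by move=> *; first [exact: smooth_Phi_x | exact: smooth_Phi_A]); smooth_tac.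
Qed.

End SU2.

Section SU2Structure.
Context {R : realType}.
Local Notation E := ('rV[R]_5 * 'M[R]_5)%type.

Lemma Phi_eq0 b (X : E) : Phi b X = 0 -> X = 0.
Proof.
move=> h; rewrite -[X](PhiK b) h /PhiV /=.
by apply/pair_equal_spec; split; rewrite ?mulmx0 mul0mx.
Qed.

Lemma PhiVN b (X : E) : PhiV b (- X) = - PhiV b X.
Proof. by rewrite -scaleN1r -[_ *: X]addr0 PhiV_linear /PhiV /= !mul0mx mulmx0 mul0mx addr0 scaleN1r. Qed.

Lemma su2_is_structure (c u v b k1 k2 : R) : 0 <= c -> 0 <= v -> ~ (u = 0 /\ v = 2 * c `^ (4^-1)) ->
  k1 ^+ 2 + k2 ^+ 2 != 0 ->
  su2_structure (fibre c (base u v b)) (tanN c) (su2 c b k1 k2).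
Proof.
move=> c0 v0 ns k0; set N := fibre _ _.
have Nr p : N p -> 0 < c + rsq p.2 by move=> /fibre_fibC[].
have facts p : N p -> _ := fun Np => radius_facts (Nr p Np).
have Tn p X : N p -> tanN c p X -> tanC (quarter c p) (Phi b p) (Phi b X).
  by move=> Np /(tanN_tanC X Np).
have lE p : N p -> lami c p = (lam c p)^-1 by move=> /facts[[]].
have l0 p : N p -> lam c p != 0 by move=> /facts[[_ _ _ /gt_eqF ->]].
have l2 p : N p -> lam c p ^+ 2 = 2 * quarter c p ^+ 4 by move=> /facts[[]].
have e1 p : N p -> Num.sqrt 2 * (lam c p)^-1 = inv_root_radius c p by move=> /facts[_ []].
have e2 p : N p -> Num.sqrt 2 * lam c p = 2 * root_radius c p by move=> /facts[_ []].
have f p : N p -> fibC c u v (quarter c p) (Phi b p) by move=> /fibre_fibC[].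
have rr p : N p -> 0 < root_radius c p /\ 0 < inv_root_radius c p.
  by move=> /Nr r; split; exact: powR_gt0.
split.
- split.
  + split; first exact: metr_smooth.
    * by move=> p X Y _ _ _; rewrite /= gC_sym.
    * move=> p X Np TX X0; have [r0 ri0] := rr p Np.
      apply: (gC_pos (f p Np) r0 ri0 (Tn p X Np TX)).
      by apply: contra_neq X0; exact: Phi_eq0.
  + split=> [p X Np TX|p Np].
      rewrite /= (propext (tanN_tanC _ Np)) PhiVK lE//.
      by apply: (JC_tan (f p Np)); [exact: l2|exact: l0|exact: Tn].
    exists (pos_radius c), (cplx (su2 c b k1 k2)); split=> //.
    * exact: open_pos_radius.
    * exact: Nr.
    * by move=> q a X Y; rewrite /= Phi_linear JC_linear PhiV_linear.
    * exact: cplx_smooth.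
  + split; first exact: omeg_smooth.
    by move=> p X _ _; rewrite /= /wC subrr mulr0.
  + move=> p X Np TX; rewrite /= PhiVK lE// (JC_sq (f p Np) (l2 p Np) (l0 p Np) (Tn p X Np TX)).
    by rewrite PhiVN PhiK.
  + move=> p X Y Np /(Tn p X Np) TX /(Tn p Y Np) TY; rewrite /= !PhiVK lE//.
    by split; [apply: (gC_J (f p Np))|apply: (gC_wC (f p Np))] => //;
      [exact: l2|exact: l0|exact: e1|exact: e2|exact: l2|exact: l0|exact: e1|exact: e2].
- split; first exact: ReO_smooth.
  move=> p X Np _ /=; have [hr hi] := D_anti (lam c p) (xs (Phi b p)) (As (Phi b p)) (xs (Phi b X))
    (As (Phi b X)) (xs (Phi b X)) (As (Phi b X)).
  have -> : reC (lam c p) (Phi b p) (Phi b X) (Phi b X) = 0 by rewrite /reC; lra.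
  have -> : imC (lam c p) (Phi b p) (Phi b X) (Phi b X) = 0 by rewrite /imC; lra.
  by rewrite !mulr0 addr0.
- split; first exact: ImO_smooth.
  move=> p X Np _ /=; have [hr hi] := D_anti (lam c p) (xs (Phi b p)) (As (Phi b p)) (xs (Phi b X))
    (As (Phi b X)) (xs (Phi b X)) (As (Phi b X)).
  have -> : reC (lam c p) (Phi b p) (Phi b X) (Phi b X) = 0 by rewrite /reC; lra.
  have -> : imC (lam c p) (Phi b p) (Phi b X) (Phi b X) = 0 by rewrite /imC; lra.
  by rewrite !mulr0 subr0.
- move=> p X Y Np TX TY /=; rewrite PhiVK lE//.
  have [-> ->] := C_type20 (Phi b Y) (f p Np) (l2 p Np) (l0 p Np) (Tn p X Np TX).
  by split; ring.
- move=> p Np; have [[_ _ _ lp _] _] := facts p Np.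
  have [z [z' [Tz Tz' nz]]] := C_nonzero c0 v0 (f p Np) ns lp k0.
  exists (PhiV b z), (PhiV b z').
  by rewrite !(propext (tanN_tanC _ Np)) /= !PhiVK.
Qed.
End SU2Structure.

(** * Independence of the frame *)

Lemma ord4P (P : 'I_4 -> Prop) : P 0 -> P 1 -> P 2 -> P 3 -> forall i, P i.
Proof.
move=> P0 P1 P2 P3 i.
have : i \in [:: 0; 1; 2; 3] by case: i => -[|[|[|[|]]]].
by rewrite !inE => /orP[/eqP->|/orP[/eqP->|/orP[/eqP->|/eqP->]]].
Qed.

Lemma big_ord4 (S : nmodType) (F : 'I_4 -> S) : \sum_(i < 4) F i = F 0 + F 1 + F 2 + F 3.
Proof.
rewrite !big_ord_recl big_ord0 addr0 !addrA.
by congr (F _ + F _ + F _ + F _); apply: val_inj.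
Qed.

Lemma big_ord3 (S : nmodType) (F : 'I_3 -> S) : \sum_(i < 3) F i = F 0 + F 1 + F 2.
Proof.
rewrite !big_ord_recl big_ord0 addr0 !addrA.
by congr (F _ + F _ + F _); apply: val_inj.
Qed.

Section Frames.
Context {R : realType}.
Local Notation E := ('rV[R]_5 * 'M[R]_5)%type.
Implicit Types (p w : E) (e : 'M[R]_(4, 5)).

Lemma oframe_orth (x : 'rV[R]_5) e : oframe x e ->
  [/\ x *m x^T = 1%:M, e *m x^T = 0, e *m e^T = 1%:M & x^T *m x + e^T *m e = 1%:M].
Proof.
rewrite /oframe /= => -[QQ _]; have QQ' := mulmx1C QQ; split.
- have E : (col_mx x e : 'M[R]_(1 + 4, 5)) *m (col_mx x e)^T = 1%:M := QQ.
  by move: E; rewrite tr_col_mx mul_col_row (@scalar_mx_block _ 1 4) => /eq_block_mx[].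
- have E : (col_mx x e : 'M[R]_(1 + 4, 5)) *m (col_mx x e)^T = 1%:M := QQ.
  by move: E; rewrite tr_col_mx mul_col_row (@scalar_mx_block _ 1 4) => /eq_block_mx[].
- have E : (col_mx x e : 'M[R]_(1 + 4, 5)) *m (col_mx x e)^T = 1%:M := QQ.
  by move: E; rewrite tr_col_mx mul_col_row (@scalar_mx_block _ 1 4) => /eq_block_mx[].
have E : (col_mx x e : 'M[R]_(1 + 4, 5))^T *m col_mx x e = 1%:M := QQ'.
by move: E; rewrite tr_col_mx mul_row_col.
Qed.

Definition zmx e w : 'M[R]_4 := e *m w.2 *m e^T.

Lemma zmxE e w i j : zmx e w i j = ev w.2 (row i e) (row j e).
Proof.
rewrite /zmx /ev -row_mul [LHS]mxE [RHS]mxE; apply: eq_bigr => k _.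
by congr (_ * _); [rewrite [RHS]mxE|rewrite !mxE].
Qed.

Lemma zetaE e i w : zeta e i w = zmx e w 0 (lift 0 i).
Proof. by rewrite zmxE. Qed.

(** A tangent vector satisfies w.2 + star w.1 p.2 + star x w.2 = 0, so w.2 itself is not
    anti-self-dual. But x lies in the kernel of p.2 and w.1 is orthogonal to x, so the middle term
    has no component on pairs of vectors tangent to the sphere; the tangential part of w.2 is
    anti-self-dual. *)
Lemma zmx_asd p w e : asd p -> oframe p.1 e -> tanM p w ->
  [/\ (zmx e w)^T = - zmx e w, zmx e w 2 3 = - zmx e w 0 1, zmx e w 1 3 = zmx e w 0 2 &
    zmx e w 1 2 = - zmx e w 0 3].
Proof.
move=> ap fr Tw; have [x1 ex ee xe] := oframe_orth fr.
have wT := tanM_antisym Tw; have [dxw H] := (tanMP p w).1 Tw.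
have zT : (zmx e w)^T = - zmx e w.
  by rewrite /zmx !trmx_mul trmxK wT mulNmx mulmxN mulmxA.
(* In the basis of the rows of [Q] the point x is the first unit vector, and [B], [W] are the
   matrices of p.2 and w.2. *)
have [QQ dQ] := fr; move: QQ dQ => /=; set Q : 'M[R]_5 := col_mx p.1 e => QQ dQ.
have QQ' := mulmx1C QQ.
pose B := Q *m p.2 *m Q^T; pose W := Q *m w.2 *m Q^T.
have WZ (i j : 'I_4) : W (lift 0 i) (lift 0 j) = zmx e w i j.
  rewrite zmxE -(ev_delta W) /W evM -!rowE; congr (ev _ _ _).
    by rewrite -[lift 0 i](@rshift1 _ i) /Q; apply: (@rowKd _ 1 4).
  by rewrite -[lift 0 j](@rshift1 _ j) /Q; apply: (@rowKd _ 1 4).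
have rx : row 0 Q = p.1.
  rewrite -[0 : 'I_5](_ : lshift 4 (0 : 'I_1) = 0); last exact: val_inj.
  by rewrite /Q; apply: etrans (@rowKu _ 1 4 _ _ _ _) _; apply/rowP => j; rewrite mxE.
have x0 : p.1 *m Q^T = delta_mx 0 0 by rewrite -rx rowE -mulmxA QQ mulmx1.
have HB : B + star (delta_mx 0 0) B = 0.
  rewrite -x0 star_equiv//.
  have -> : B + Q *m star p.1 p.2 *m Q^T = Q *m (p.2 + star p.1 p.2) *m Q^T.
    by rewrite mulmxDr mulmxDl.
  by move: ap; rewrite /asd => ->; rewrite mulmx0 mul0mx.
pose xi := w.1 *m Q^T.
have HW : W + star xi B + star (delta_mx 0 0) W = 0.
  rewrite -x0 !star_equiv//.
  have -> : W + Q *m star w.1 p.2 *m Q^T + Q *m star p.1 w.2 *m Q^T =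
      Q *m (w.2 + star w.1 p.2 + star p.1 w.2) *m Q^T by rewrite !mulmxDr !mulmxDl.
  by rewrite H mulmx0 mul0mx.
have xi0 : xi 0 0 = 0.
  rewrite -dxw dotE /xi -[in RHS]rx mxE; apply: eq_bigr => j _.
  by rewrite [Q^T _ _]mxE [row _ _ _ _]mxE mulrC.
have aB : B^T = - B by rewrite /B !trmx_mul trmxK (asd_antisym ap) mulNmx mulmxN mulmxA.
have aW : W^T = - W by rewrite /W !trmx_mul trmxK wT mulNmx mulmxN mulmxA.
have d0 i : (delta_mx 0 0 : 'rV[R]_5) 0 i = (i == 0)%:R by rewrite mxE.
have B0 j : j != 0 -> B 0 j = 0.
  have HBj k : (B + star (delta_mx 0 0) B) 0 k = 0 by rewrite HB mxE.
  elim/ord5P: j => // _.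
  - have := HBj 1; rewrite addmxE (star01 _ aB) !d0 /= => h; lincomb (dif h).
  - have := HBj 2; rewrite addmxE (star02 _ aB) !d0 /= => h; lincomb (dif h).
  - have := HBj 3; rewrite addmxE (star03 _ aB) !d0 /= => h; lincomb (dif h).
  - have := HBj 4; rewrite addmxE (star04 _ aB) !d0 /= => h; lincomb (dif h).
have HWE i j : (W + star xi B + star (delta_mx 0 0) W) i j = 0 by rewrite HW mxE.
have e12 := HWE 1 2; have e13 := HWE 1 3; have e14 := HWE 1 4.
rewrite !addmxE (star12 _ aB) (star12 _ aW) !d0 /= xi0 !B0// in e12.
rewrite !addmxE (star13 _ aB) (star13 _ aW) !d0 /= xi0 !B0// in e13.
rewrite !addmxE (star14 _ aB) (star14 _ aW) !d0 /= xi0 !B0// in e14.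
have l0 : lift 0 (0 : 'I_4) = 1 :> 'I_5 by exact: val_inj.
have l1 : lift 0 (1 : 'I_4) = 2 :> 'I_5 by exact: val_inj.
have l2 : lift 0 (2 : 'I_4) = 3 :> 'I_5 by exact: val_inj.
have l3 : lift 0 (3 : 'I_4) = 4 :> 'I_5 by exact: val_inj.
rewrite -!WZ l0 l1 l2 l3; split=> //.
- lincomb (dif e12).
- lincomb (- dif e13).
- lincomb (dif e14).
Qed.

Definition asd4 (a b c : R) : 'M[R]_4 := \matrix_(i < 4, j < 4) nth 0 (nth [::]
  [:: [:: 0; a; b; c]; [:: - a; 0; - c; b]; [:: - b; c; 0; - a]; [:: - c; - b; a; 0]] i) j.

Lemma zmx_asd4 p w e : asd p -> oframe p.1 e -> tanM p w ->
  zmx e w = asd4 (zeta e 0 w) (zeta e 1 w) (zeta e 2 w).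
Proof.
move=> ap fr Tw; have [zT h23 h13 h12] := zmx_asd ap fr Tw.
have l0 : lift 0 (0 : 'I_3) = 1 :> 'I_4 by exact: val_inj.
have l1 : lift 0 (1 : 'I_3) = 2 :> 'I_4 by exact: val_inj.
have l2 : lift 0 (2 : 'I_3) = 3 :> 'I_4 by exact: val_inj.
rewrite !zetaE l0 l1 l2.
have h i j : zmx e w j i = - zmx e w i j by move/matrixP: zT => /(_ i j); rewrite !mxE.
have d i : zmx e w i i = 0 by have := h i i; lra.
apply/matrixP => i j; rewrite [RHS]mxE.
by elim/ord4P: i; elim/ord4P: j; rewrite /= ?h23 ?h13 ?h12 ?opprK // h ?h23 ?h13 ?h12 ?opprK.
Qed.

(** Anti-self-dual 4x4 matrices multiply like imaginary quaternions, so traces of products of two or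
    three of them are inner and triple products of the coefficients. This makes the metric and the
    3-form frame-free. *)
Lemma tr_asd4_2 a b c a' b' c' : \tr (asd4 a b c *m asd4 a' b' c') =
  - 4 * (a * a' + b * b' + c * c').
Proof. by rewrite /mxtrace big_ord4 !mxE !big_ord4 !mxE /=; ring. Qed.

Lemma tr_asd4_3 a b c a' b' c' a'' b'' c'' :
  \tr (asd4 a b c *m asd4 a' b' c' *m asd4 a'' b'' c'') =
  - 4 * (a * (b' * c'' - c' * b'') - b * (a' * c'' - c' * a'') + c * (a' * b'' - b' * a'')).
Proof. by rewrite /mxtrace big_ord4 !mxE !big_ord4 !mxE !big_ord4 !mxE /=; ring. Qed.

Lemma dotC n (x y : 'rV[R]_n) : dot x y = dot y x.
Proof. by rewrite !dotE; apply: eq_bigr => i _; rewrite mulrC. Qed.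

Lemma ev_outer (U V X Y : 'rV[R]_5) : ev (U^T *m V) X Y = dot U X * dot V Y.
Proof. by rewrite /ev mulmxA -mulmxA mxE big_ord1 (dotC U X). Qed.

Lemma bformE e k w : bform e k w = (w.1 *m e^T) 0 k.
Proof.
rewrite /bform /dot [LHS]mxE [RHS]mxE; apply: eq_bigr => j _.
by rewrite [row _ _ _ _]mxE [w.1^T _ _]mxE [e^T _ _]mxE mulrC.
Qed.

Lemma sum_bform p w1 w2 e : oframe p.1 e -> dot p.1 w1.1 = 0 ->
  \sum_(k < 4) bform e k w1 * bform e k w2 = dot w1.1 w2.1.
Proof.
move=> /oframe_orth[_ _ _ xe] d1.
have -> : \sum_(k < 4) bform e k w1 * bform e k w2 = (w1.1 *m e^T *m (w2.1 *m e^T)^T) 0 0.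
  by rewrite [RHS]mxE; apply: eq_bigr => k _; rewrite !bformE [(_ ^T) k 0]mxE.
have -> : w1.1 *m e^T *m (w2.1 *m e^T)^T = w1.1 *m (e^T *m e) *m w2.1^T.
  by rewrite trmx_mul trmxK !mulmxA.
have -> : e^T *m e = 1%:M - p.1^T *m p.1 by rewrite -xe addrAC subrr add0r.
have d1' : w1.1 *m p.1^T = 0.
  apply/matrixP => i j; rewrite !ord1 [RHS]mxE -[RHS]d1 /dot !mxE.
  by apply: eq_bigr => k _; rewrite !mxE mulrC.
by rewrite mulmxBr mulmx1 mulmxA d1' mul0mx subr0.
Qed.

Lemma frame_proj (x : 'rV[R]_5) e : oframe x e -> e^T *m e = 1%:M - x^T *m x.
Proof. by move=> /oframe_orth[_ _ _ <-]; rewrite addrAC subrr add0r. Qed.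

Lemma tan_proj (x X : 'rV[R]_5) e : oframe x e -> dot x X = 0 -> X *m e^T *m e = X.
Proof.
move=> fr d1; rewrite -mulmxA (frame_proj fr) mulmxBr mulmx1 mulmxA.
have -> : X *m x^T = 0 by apply/matrixP => i j; rewrite !ord1 [RHS]mxE -[RHS]d1 dotC.
by rewrite mul0mx subr0.
Qed.

Lemma ev_frame (x X Y : 'rV[R]_5) A e : oframe x e -> dot x X = 0 -> dot x Y = 0 ->
  ev A X Y = (X *m e^T *m (e *m A *m e^T) *m (Y *m e^T)^T) 0 0.
Proof.
move=> fr dX dY; rewrite /ev -{1}(tan_proj fr dX) -{1}(tan_proj fr dY).
by rewrite !trmx_mul !trmxK !mulmxA.
Qed.

Lemma zeta_sum_ev p w e X Y : asd p -> oframe p.1 e -> tanM p w ->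
  dot p.1 X = 0 -> dot p.1 Y = 0 ->
  \sum_(i < 3) zeta e i w * ev (Om e i) X Y = ev w.2 X Y.
Proof.
move=> ap fr Tw dX dY.
rewrite (ev_frame w.2 fr dX dY) -/(zmx e w) (zmx_asd4 ap fr Tw).
have dE k Z : dot (row k e) Z = (Z *m e^T) 0 k.
  by rewrite dotC dotE [RHS]mxE; apply: eq_bigr => j _; rewrite [row _ _ _ _]mxE [_^T _ _]mxE.
have evB A B Z Z' : ev (A - B) Z Z' = ev A Z Z' - ev B Z Z'.
  by rewrite -scaleN1r evD evZ mulN1r.
rewrite big_ord3 /Om /= !evB !ev_outer !dE.
rewrite [RHS]mxE big_ord4 ![((_ *m asd4 _ _ _) _ _)]mxE !big_ord4 ![asd4 _ _ _ _ _]mxE /=.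
rewrite ![(_^T) _ _]mxE; ring.
Qed.


Lemma inord3 : (inord 0 = 0 :> 'I_3) * (inord 1 = 1 :> 'I_3) * (inord 2 = 2 :> 'I_3).
Proof. by do !split; apply: ord_inj; rewrite inordK. Qed.

Lemma det3E (M : 'M[R]_3) : \det M =
  M 0 0 * (M 1 1 * M 2 2 - M 1 2 * M 2 1) - M 0 1 * (M 1 0 * M 2 2 - M 1 2 * M 2 0)
  + M 0 2 * (M 1 0 * M 2 1 - M 1 1 * M 2 0).
Proof.
have {1}-> : M = \matrix_(i < 3, j < 3) (fun a b => M (inord a) (inord b)) i j.
  by apply/matrixP => i j; rewrite mxE !inord_val.
by rewrite (det_laplace _ (fun a b => M (inord a) (inord b))) /= !inord3; ring.
Qed.

Definition oproj (x : 'rV[R]_5) : 'M[R]_5 := 1%:M - x^T *m x.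

(** The frame has disappeared from the right-hand side. Rewriting once with an arbitrary frame and
    once backwards with [qframe] therefore changes the frame; [phiBS_intrinsic] does the same for
    the 3-form. *)
Lemma gBS_intrinsic c p w1 w2 e : asd p -> oframe p.1 e -> tanM p w1 -> tanM p w2 ->
  gBS c e p w1 w2 =
  (c + rsq p.2) `^ (- 2^-1) * (- 4^-1 * \tr (w1.2 *m oproj p.1 *m w2.2 *m oproj p.1)) +
  2 * (c + rsq p.2) `^ (2^-1) * dot w1.1 w2.1.
Proof.
move=> ap fr T1 T2; rewrite /gBS (sum_bform _ fr); last by have [] := (tanMP p w1).1 T1.
congr (_ * _ + _); rewrite /oproj -(frame_proj fr).
have -> : \tr (w1.2 *m (e^T *m e) *m w2.2 *m (e^T *m e)) = \tr (zmx e w1 *m zmx e w2).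
  by rewrite /zmx !mulmxA [LHS]mxtrace_mulC !mulmxA.
by rewrite (zmx_asd4 ap fr T1) (zmx_asd4 ap fr T2) tr_asd4_2 big_ord3; field.
Qed.

Lemma phiBS_intrinsic c p w1 w2 w3 e : asd p -> oframe p.1 e ->
  tanM p w1 -> tanM p w2 -> tanM p w3 ->
  phiBS c e p w1 w2 w3 =
  (c + rsq p.2) `^ (- (3 / 4)) *
    (- 4^-1 * \tr (w1.2 *m oproj p.1 *m w2.2 *m oproj p.1 *m w3.2 *m oproj p.1)) +
  2 * (c + rsq p.2) `^ (4^-1) * (ev w1.2 w2.1 w3.1 + ev w2.2 w3.1 w1.1 + ev w3.2 w1.1 w2.1).
Proof.
move=> ap fr T1 T2 T3; rewrite /phiBS; congr (_ * _ + _ * _).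
  rewrite /oproj -(frame_proj fr).
  have -> : \tr (w1.2 *m (e^T *m e) *m w2.2 *m (e^T *m e) *m w3.2 *m (e^T *m e)) =
      \tr (zmx e w1 *m zmx e w2 *m zmx e w3).
    by rewrite /zmx !mulmxA [LHS]mxtrace_mulC !mulmxA.
  rewrite (zmx_asd4 ap fr T1) (zmx_asd4 ap fr T2) (zmx_asd4 ap fr T3) tr_asd4_3 det3E !mxE /=.
  by field.
have d w : tanM p w -> dot p.1 w.1 = 0 by move=> /tanMP[].
rewrite !big_split /= (zeta_sum_ev ap fr T1 (d _ T2) (d _ T3)).
by rewrite (zeta_sum_ev ap fr T2 (d _ T3) (d _ T1)) (zeta_sum_ev ap fr T3 (d _ T1) (d _ T2)).
Qed.

(* The frame with e_0 the last unit vector, completed by the quaternionic multiples of x. *)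
Definition qmx (y : 'rV[R]_5) : 'M[R]_(4, 5) := \matrix_(i < 4) nth 0
    [:: vec5 0 0 0 0 1;
        vec5 (- y 0 2) (y 0 3) (y 0 0) (- y 0 1) 0;
        vec5 (- y 0 1) (y 0 0) (- y 0 3) (y 0 2) 0;
        vec5 (- y 0 3) (- y 0 2) (y 0 1) (y 0 0) 0] i.

Definition qframe (b : R) (p : E) : 'M[R]_(4, 5) := qmx (Phi b p).1 *m rot b.

Lemma qmx_oframe b (y : 'rV[R]_5) : dot y y = 1 -> y 0 4 = 0 -> oframe (y *m rot b) (qmx y *m rot b).
Proof.
rewrite dotE big_ord5 => H y4; rewrite y4 mulr0 addr0 in H.
rewrite /oframe.
set F := qmx y.
pose F5 : 'M[R]_5 := \matrix_(i < 5, j < 5) nth 0 (nth [::]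
  [:: [:: y 0 0; y 0 1; y 0 2; y 0 3; 0]; [:: 0; 0; 0; 0; 1];
      [:: - y 0 2; y 0 3; y 0 0; - y 0 1; 0]; [:: - y 0 1; y 0 0; - y 0 3; y 0 2; 0];
      [:: - y 0 3; - y 0 2; y 0 1; y 0 0; 0]] i) j.
have FE : (col_mx y F : 'M[R]_(1 + 4, 5)) = F5.
  apply/matrixP => i j; rewrite [RHS]mxE.
  case: (@split_ordP 1 4 i) => k ->; rewrite ?col_mxEu ?col_mxEd.
    by rewrite !ord1; elim/ord5P: j.
  by elim/ord4P: k; rewrite !mxE /=; elim/ord5P: j; rewrite ?mxE.
have -> : col_mx (y *m rot b) (F *m rot b) = F5 *m rot b.
  by rewrite -[LHS]/(col_mx (y *m rot b) (F *m rot b) : 'M[R]_(1 + 4, 5)) -mul_col_mx FE.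
split; last first.
  rewrite det_mulmx det_rot mulr1 /F5 (det_laplace _ (fun i j => nth 0 (nth [::] _ i) j)) /=.
  rewrite ?mulr0 ?mul0r ?mulr1 ?mul1r ?addr0 ?add0r.
  (* The determinant is |y|^4, and |y|^4 - 1 = (|y|^2 + 1) (|y|^2 - 1). *)
  lincomb ((y 0 0 * y 0 0 + y 0 1 * y 0 1 + y 0 2 * y 0 2 + y 0 3 * y 0 3 + 1) * dif H).
rewrite trmx_mul mulmxA -(mulmxA F5) rotT mulmx1.
apply/matrixP => i j; rewrite !mxE big_ord5 !mxE.
by elim/ord5P: i; elim/ord5P: j; rewrite /=; first [ring | lincomb (dif H)].
Qed.

Lemma qframe_oframe b p : dot p.1 p.1 = 1 -> (Phi b p).1 0 4 = 0 -> oframe p.1 (qframe b p).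
Proof.
rewrite -(dot_Phi b) => d y4; have -> : p.1 = (Phi b p).1 *m rot b.
  by rewrite /Phi /= -mulmxA rotTV mulmx1.
exact: qmx_oframe.
Qed.

End Frames.

(** * The induced metric and the form n_3 _| phi_c *)

Section Natural.
Context {R : realType}.
Local Notation E := ('rV[R]_5 * 'M[R]_5)%type.
Implicit Types (p w : E) (e : 'M[R]_(4, 5)).

Lemma ev_vec5 (A : 'M[R]_5) (v0 v1 v2 v3 : R) : A^T = - A ->
  ev A (vec5 0 0 0 0 1) (vec5 v0 v1 v2 v3 0) =
  - (v0 * A 0 4 + v1 * A 1 4 + v2 * A 2 4 + v3 * A 3 4).
Proof.
move=> /antisymE h; rewrite evE !big_ord5 !mxE /= (h 0 4) (h 1 4) (h 2 4) (h 3 4); ring.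
Qed.

Lemma dot_vec5 (v0 v1 v2 v3 v4 : R) (x : 'rV[R]_5) : dot (vec5 v0 v1 v2 v3 v4) x =
  v0 * x 0 0 + v1 * x 0 1 + v2 * x 0 2 + v3 * x 0 3 + v4 * x 0 4.
Proof. by rewrite dotE big_ord5 !mxE. Qed.

Lemma zeta_rot b (F : 'M[R]_(4, 5)) i w :
  zeta (F *m rot b) i w = ev (Phi b w).2 (row 0 F) (row (lift 0 i) F).
Proof. by rewrite /zeta !row_mul -evM. Qed.

Lemma bform_rot b (F : 'M[R]_(4, 5)) k w :
  bform (F *m rot b) k w = dot (row k F) (Phi b w).1.
Proof. by rewrite /bform row_mul /dot /Phi /= trmx_mul trmxK mulmxA. Qed.

Lemma Phi_antisym b w : w.2^T = - w.2 -> (Phi b w).2^T = - (Phi b w).2.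
Proof. by move=> wT; rewrite /Phi /= !trmx_mul trmxK wT mulNmx mulmxN mulmxA. Qed.

(** As e_0 is the last unit vector, the value of the form on (e_0, e_i) is minus the component of
    its last column along e_i. This is why the frame starts with that vector. *)
Lemma zeta_qframe b p w : w.2^T = - w.2 ->
  let y := Phi b p in let z := Phi b w in
  [/\ zeta (qframe b p) 0 w = - (- y.1 0 2 * z.2 0 4 + y.1 0 3 * z.2 1 4 + y.1 0 0 * z.2 2 4 - y.1 0 1 * z.2 3 4),
   zeta (qframe b p) 1 w = - (- y.1 0 1 * z.2 0 4 + y.1 0 0 * z.2 1 4 - y.1 0 3 * z.2 2 4 + y.1 0 2 * z.2 3 4) &
   zeta (qframe b p) 2 w = - (- y.1 0 3 * z.2 0 4 - y.1 0 2 * z.2 1 4 + y.1 0 1 * z.2 2 4 + y.1 0 0 * z.2 3 4)].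
Proof.
move=> /(Phi_antisym b); rewrite /qframe !zeta_rot; move: (Phi b p).1 (Phi b w).2 => y A aA.
by split; rewrite !rowK /= ev_vec5// !mulNr.
Qed.

Lemma bform_qframe b p w :
  let y := Phi b p in let z := Phi b w in
  [/\ bform (qframe b p) 0 w = z.1 0 4,
   bform (qframe b p) 1 w = - y.1 0 2 * z.1 0 0 + y.1 0 3 * z.1 0 1 + y.1 0 0 * z.1 0 2 - y.1 0 1 * z.1 0 3,
   bform (qframe b p) 2 w = - y.1 0 1 * z.1 0 0 + y.1 0 0 * z.1 0 1 - y.1 0 3 * z.1 0 2 + y.1 0 2 * z.1 0 3 &
   bform (qframe b p) 3 w = - y.1 0 3 * z.1 0 0 - y.1 0 2 * z.1 0 1 + y.1 0 1 * z.1 0 2 + y.1 0 0 * z.1 0 3].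
Proof.
rewrite /qframe !bform_rot; move: (Phi b p).1 (Phi b w).1 => y x.
by split; rewrite rowK /= dot_vec5; ring.
Qed.

Lemma gBS_fibre c u v b p e X Y : fibre c (base u v b) p -> oframe p.1 e ->
  tanN c p X -> tanN c p Y ->
  gBS c e p X Y = gC (root_radius c p) (inv_root_radius c p) (Phi b p) (Phi b X) (Phi b Y).
Proof.
move=> fp fr TX TY; have [r0 [ay d y4 y34 _]] := fibre_fibC fp.
have [_ H1 _ _] := asd_coord ay d y4.
have ap : asd p by apply/(asd_Phi b).
have fr' : oframe p.1 (qframe b p) by apply: qframe_oframe => //; rewrite -(dot_Phi b).
have [MX _] := TX; have [MY _] := TY.
rewrite (gBS_intrinsic c ap fr MX MY) -(gBS_intrinsic c ap fr' MX MY).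
have [zX T1 T2 _] := (tanN_tanC X fp).1 TX; have [zY T1' T2' _] := (tanN_tanC Y fp).1 TY.
have X4 : (Phi b X).1 0 4 = 0 by rewrite zX dembE.
have X34 : (Phi b X).2 3 4 = 0 by rewrite zX dembE.
have Y34 : (Phi b Y).2 3 4 = 0 by rewrite zY dembE.
rewrite /gBS big_ord3 big_ord4 /gC.
have [-> -> ->] := zeta_qframe b p (tanM_antisym MX).
have [-> -> ->] := zeta_qframe b p (tanM_antisym MY).
have [-> -> -> ->] := bform_qframe b p X; have [-> -> -> ->] := bform_qframe b p Y.
rewrite -/(root_radius c p) -/(inv_root_radius c p) X4 X34 Y34.
move: (root_radius c p) (inv_root_radius c p) => r ri.
move: (Phi b p) (Phi b X) (Phi b Y) H1 T1 T2 T1' T2' {zX zY X4 X34 Y34 ay d y4 y34} => y z z' H1 T1 T2 T1' T2'.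
lincombp (ri * ((z.2 0 4 * z'.2 0 4 + z.2 1 4 * z'.2 1 4 + z.2 2 4 * z'.2 2 4) * dif H1
   - dif T2 * dif T2' + pair_ax y z * dif T2' + pair_ax y z' * dif T2)
  + 2 * r * (pair_xx z z' * dif H1 - dif T1 * dif T1')).
Qed.

(** Real part of det (A + i B, C + i D, F + i G); [im3] is the imaginary part. *)
Definition re3 (A B C D F G : 'I_5 -> R) : R := tri A C F - tri A D G - tri B C G - tri B D F.
Definition im3 (A B C D F G : 'I_5 -> R) : R := tri A C G + tri A D F + tri B C F - tri B D G.

Ltac lincombr t := apply: (@lincomb_eq _ _ _ t);
  [rewrite /dif /re3 /im3 /tri; ring | rewrite ?dif0; ring].

(* Three vectors A_j + i B_j of C^3 orthogonal to a nonzero vector P + i Q have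
   vanishing determinant. *)
Lemma im3_eq0 (P Q A0 B0 A1 B1 A2 B2 : 'I_5 -> R) :
  let re (A B : 'I_5 -> R) := P 0 * A 0 + P 1 * A 1 + P 2 * A 2 - (Q 0 * B 0 + Q 1 * B 1 + Q 2 * B 2) in
  let im (A B : 'I_5 -> R) := P 0 * B 0 + P 1 * B 1 + P 2 * B 2 + (Q 0 * A 0 + Q 1 * A 1 + Q 2 * A 2) in
  0 < P 0 ^+ 2 + P 1 ^+ 2 + P 2 ^+ 2 + (Q 0 ^+ 2 + Q 1 ^+ 2 + Q 2 ^+ 2) ->
  re A0 B0 = 0 -> im A0 B0 = 0 -> re A1 B1 = 0 -> im A1 B1 = 0 -> re A2 B2 = 0 -> im A2 B2 = 0 ->
  im3 A0 B0 A1 B1 A2 B2 = 0.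
Proof.
move=> /= H r0 i0 r1 i1 r2 i2; apply: (mulfI (lt0r_neq0 H)); rewrite mulr0.
(* Cramer's rule: for p = P + i Q and the vectors v_j, (p . conj p) det (v_0, v_1, v_2) is the sum
   over j of p . v_j times the determinant with v_j replaced by conj p. *)
lincombr (re3 P (fun i => - Q i) A1 B1 A2 B2 * dif i0 + im3 P (fun i => - Q i) A1 B1 A2 B2 * dif r0
  + re3 A0 B0 P (fun i => - Q i) A2 B2 * dif i1 + im3 A0 B0 P (fun i => - Q i) A2 B2 * dif r1
  + re3 A0 B0 A1 B1 P (fun i => - Q i) * dif i2 + im3 A0 B0 A1 B1 P (fun i => - Q i) * dif r2).
Qed.

(* The components v . e_1, v . e_2, v . e_3 in the quaternionic frame. *)
Definition comps (y : E) (v0 v1 v2 v3 : R) : 'I_5 -> R := fun i => nth 0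
  [:: - y.1 0 2 * v0 + y.1 0 3 * v1 + y.1 0 0 * v2 - y.1 0 1 * v3;
      - y.1 0 1 * v0 + y.1 0 0 * v1 - y.1 0 3 * v2 + y.1 0 2 * v3;
      - y.1 0 3 * v0 - y.1 0 2 * v1 + y.1 0 1 * v2 + y.1 0 0 * v3] i.

Lemma comps_dot (y : E) (v0 v1 v2 v3 w0 w1 w2 w3 : R) :
  comps y v0 v1 v2 v3 0 * comps y w0 w1 w2 w3 0 + comps y v0 v1 v2 v3 1 * comps y w0 w1 w2 w3 1
   + comps y v0 v1 v2 v3 2 * comps y w0 w1 w2 w3 2 =
  (v0 * w0 + v1 * w1 + v2 * w2 + v3 * w3) * (y.1 0 0 ^+ 2 + y.1 0 1 ^+ 2 + y.1 0 2 ^+ 2 + y.1 0 3 ^+ 2)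
  - (y.1 0 0 * v0 + y.1 0 1 * v1 + y.1 0 2 * v2 + y.1 0 3 * v3)
    * (y.1 0 0 * w0 + y.1 0 1 * w1 + y.1 0 2 * w2 + y.1 0 3 * w3).
Proof. by rewrite /comps /=; ring. Qed.

(** The equations common to the tangent vectors of the fibre and to n_3. The component [z.1 0 4],
    which distinguishes them, is left free. *)
Definition pretan (q : R) (y z : E) : Prop :=
  [/\ pair_xx y z = 0,
    y.1 0 0 * z.2 0 4 + y.1 0 1 * z.2 1 4 + y.1 0 2 * z.2 2 4 + pair_ax y z = 0,
    2 * q ^+ 4 * z.1 0 3 + y.1 0 3 * pair_aa y z = 0 & z.2 3 4 = 0].

Definition bcomps (y z : E) := comps y (z.1 0 0) (z.1 0 1) (z.1 0 2) (z.1 0 3).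
Definition acomps (y z : E) := comps y (z.2 0 4) (z.2 1 4) (z.2 2 4) (z.2 3 4).

(* Coassociativity: the forms l dx - i da on the fibre are all orthogonal to the
   nonzero vector l e + i m a of C^4. *)
Lemma coassociative c u v q l (y n z z' : E) : 0 <= c -> 0 <= v -> fibC c u v q y ->
  ~ (u = 0 /\ v = 2 * c `^ (4^-1)) -> 0 < l -> l ^+ 2 = 2 * q ^+ 4 ->
  pretan q y n -> pretan q y z -> pretan q y z' ->
  im3 (fun i => l * bcomps y n i) (fun i => - acomps y n i)
   (fun i => l * bcomps y z i) (fun i => - acomps y z i)
   (fun i => l * bcomps y z' i) (fun i => - acomps y z' i) = 0.
Proof.
move=> c0 v0 f ns l0 l2 Tn Tz Tz'; have pos := fibC_nonsing c0 v0 f ns.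
have [h d y4 y34 [q0 q4 y3]] := f; have [_ H1 H3 _] := asd_coord h d y4.
(* The components see vectors only after projection off x, so e contributes w_3 - m (x . w). Then
   the real part vanishes because q m is constant, and in [im0] the imaginary part is m times the
   derivative of x . a. *)
have re0 w : pretan q y w -> l * l * (comps y 0 0 0 1 0 * bcomps y w 0 + comps y 0 0 0 1 1 * bcomps y w 1
    + comps y 0 0 0 1 2 * bcomps y w 2) + y.1 0 3 * (acomps y y 0 * acomps y w 0 +
    acomps y y 1 * acomps y w 1 + acomps y y 2 * acomps y w 2) = 0.
  move=> [T1 T2 T3 T4]; rewrite /bcomps /acomps !comps_dot T4.
  lincombp (dif T3 + w.1 0 3 * dif l2 + (l ^+ 2 * w.1 0 3 + y.1 0 3 * pair_aa y w) * dif H1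
   - l ^+ 2 * y.1 0 3 * dif T1
   - y.1 0 3 * (y.1 0 0 * w.2 0 4 + y.1 0 1 * w.2 1 4 + y.1 0 2 * w.2 2 4) * dif H3).
have im0 w : pretan q y w -> y.1 0 3 * (acomps y y 0 * bcomps y w 0 +
    acomps y y 1 * bcomps y w 1 + acomps y y 2 * bcomps y w 2) -
    (comps y 0 0 0 1 0 * acomps y w 0 + comps y 0 0 0 1 1 * acomps y w 1
    + comps y 0 0 0 1 2 * acomps y w 2) = 0.
  move=> [T1 T2 T3 T4]; rewrite /bcomps /acomps !comps_dot T4.
  lincombp (y.1 0 3 * (dif T2 + pair_ax y w * dif H1 - pair_xx y w * dif H3)).
apply: (@im3_eq0 (fun i => l * comps y 0 0 0 1 i) (fun i => y.1 0 3 * acomps y y i)) => /=.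
- have E : (comps y 0 0 0 1 0 * comps y 0 0 0 1 0 + comps y 0 0 0 1 1 * comps y 0 0 0 1 1
     + comps y 0 0 0 1 2 * comps y 0 0 0 1 2) = y.1 0 0 ^+ 2 + y.1 0 1 ^+ 2 + y.1 0 2 ^+ 2.
    by rewrite comps_dot; ring.
  have F : (acomps y y 0 * acomps y y 0 + acomps y y 1 * acomps y y 1 + acomps y y 2 * acomps y y 2)
     = y.2 0 4 ^+ 2 + y.2 1 4 ^+ 2 + y.2 2 4 ^+ 2 + y.2 3 4 ^+ 2.
    rewrite /acomps comps_dot.
    lincomb ((y.2 0 4 ^+ 2 + y.2 1 4 ^+ 2 + y.2 2 4 ^+ 2 + y.2 3 4 ^+ 2) * dif H1
     - (y.1 0 0 * y.2 0 4 + y.1 0 1 * y.2 1 4 + y.1 0 2 * y.2 2 4 + y.1 0 3 * y.2 3 4) * dif H3).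
  rewrite (_ : _ + _ = l ^+ 2 * (y.1 0 0 ^+ 2 + y.1 0 1 ^+ 2 + y.1 0 2 ^+ 2) + y.1 0 3 ^+ 2 *
     (y.2 0 4 ^+ 2 + y.2 1 4 ^+ 2 + y.2 2 4 ^+ 2 + y.2 3 4 ^+ 2)); last by rewrite -E -F; ring.
  move: pos; set X := y.1 0 0 ^+ 2 + _ + _ => pos.
  have X0 : 0 <= X by rewrite /X !addr_ge0 ?sqr_ge0.
  have [Xp|] := ltP 0 X.
    rewrite ltr_pwDl//; first by rewrite mulr_gt0// exprn_gt0.
    by rewrite mulr_ge0 ?sqr_ge0// !addr_ge0 ?sqr_ge0.
  move=> Xn; have XE : X = 0 by apply/eqP; rewrite eq_le Xn X0.
  have m1 : y.1 0 3 ^+ 2 = 1 by rewrite -H1 -/X XE add0r.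
  by rewrite XE mulr0 add0r m1 mul1r; rewrite XE add0r in pos; rewrite ltr_pwDl// sqr_ge0.
- by apply: etrans (re0 _ Tn); ring.
- by apply: etrans (etrans (congr1 ( *%R l) (im0 _ Tn)) (mulr0 l)); ring.
- by apply: etrans (re0 _ Tz); ring.
- by apply: etrans (etrans (congr1 ( *%R l) (im0 _ Tz)) (mulr0 l)); ring.
- by apply: etrans (re0 _ Tz'); ring.
- by apply: etrans (etrans (congr1 ( *%R l) (im0 _ Tz')) (mulr0 l)); ring.
Qed.

Lemma ev_Om e (X Y : E) : let b k := bform e k X in let b' k := bform e k Y in
  [/\ ev (Om e 0) X.1 Y.1 = b 0 * b' 1 - b 1 * b' 0 - (b 2 * b' 3 - b 3 * b' 2),
   ev (Om e 1) X.1 Y.1 = b 0 * b' 2 - b 2 * b' 0 - (b 3 * b' 1 - b 1 * b' 3) &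
   ev (Om e 2) X.1 Y.1 = b 0 * b' 3 - b 3 * b' 0 - (b 1 * b' 2 - b 2 * b' 1)].
Proof.
have evB A B : ev (A - B) X.1 Y.1 = ev A X.1 Y.1 - ev B X.1 Y.1 by rewrite -scaleN1r evD evZ mulN1r.
by rewrite /Om /=; split; rewrite /bform !evB !ev_outer.
Qed.

Lemma tanC_pretan q (y z : E) : tanC q y z -> pretan q y z /\ z.1 0 4 = 0.
Proof. by move=> [zE T1 T2 T3]; split; [split=> //|]; rewrite zE dembE. Qed.

Lemma normal_pretan c u v b p n : fibre c (base u v b) p -> tanM p n ->
  'd (fibration c) p n = (0, - v * sin b, v * cos b) ->
  pretan (quarter c p) (Phi b p) (Phi b n) /\ 2 * quarter c p * (Phi b n).1 0 4 = v.
Proof.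
move=> fp Mn dn; have [r0 [ay d y4 y34 [q0 q4 y3]]] := fibre_fibC fp.
have nT := tanM_antisym Mn.
have := dfibration_Phi b 0 v r0 nT; rewrite dn !mulr0 sub0r add0r -mulNr mulrC (mulrC (cos b)).
rewrite mulrN -mulNr => /iffLR/(_ erefl) [n34 E3 E4].
have [_ T1 T2 D] := tan_coord ay d y4 ((tanM_Phi b p n).2 Mn) n34.
rewrite y4 mulr0 addr0 in E4; split; last by rewrite -E4; ring.
split=> //; have qn0 : quarter c p != 0 by rewrite gt_eqF.
rewrite D in E3; have := congr1 ( *%R (quarter c p ^+ 3)) E3; rewrite mulr0 => <-.
by rewrite /pair_aa; field.
Qed.

(** In [qframe] the form b_0 vanishes on [X] and [Y] and equals v / (2 q) on n_3. The terms with b_0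
    give 2 q times v / (2 q) times the sum of da_i /\ dx_i. All other terms form a multiple of the
    imaginary determinant in [coassociative], by l^2 = 2 q^4, and drop out. *)
Lemma omeg_phiBS c u v b p e n X Y : 0 <= c -> 0 <= v -> ~ (u = 0 /\ v = 2 * c `^ (4^-1)) ->
  v != 0 -> fibre c (base u v b) p -> oframe p.1 e -> tanM p n ->
  'd (fibration c) p n = (0, - v * sin b, v * cos b) ->
  tanN c p X -> tanN c p Y ->
  wC (Phi b X) (Phi b Y) = Num.sqrt 2 / v * phiBS c e p n X Y.
Proof.
move=> c0 v0 ns vn0 fp fr Mn dn TX TY; have [r0 fC] := fibre_fibC fp.
have [ay d y4 y34 [q0 q4 y3]] := fC; have [_ H1 _ _] := asd_coord ay d y4.
have ap : asd p by apply/(asd_Phi b).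
have fr' : oframe p.1 (qframe b p) by apply: qframe_oframe => //; rewrite -(dot_Phi b).
have [MX _] := TX; have [MY _] := TY.
rewrite (phiBS_intrinsic c ap fr Mn MX MY) -(phiBS_intrinsic c ap fr' Mn MX MY).
have [Pn kn] := normal_pretan fp Mn dn.
have [PX X4] := tanC_pretan ((tanN_tanC X fp).1 TX).
have [PY Y4] := tanC_pretan ((tanN_tanC Y fp).1 TY).
have [[_ _ _ l0 l2] _] := radius_facts r0.
have coas := coassociative c0 v0 fC ns l0 l2 Pn PX PY.
rewrite /phiBS big_ord3 det3E !mxE /=.
have [L0 L1 L2] := ev_Om (qframe b p) X Y.
have [M0 M1 M2] := ev_Om (qframe b p) Y n.
have [N0 N1 N2] := ev_Om (qframe b p) n X.
rewrite L0 L1 L2 M0 M1 M2 N0 N1 N2.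
have [-> -> ->] := zeta_qframe b p (tanM_antisym MX).
have [-> -> ->] := zeta_qframe b p (tanM_antisym MY).
have [-> -> ->] := zeta_qframe b p (tanM_antisym Mn).
have [-> -> -> ->] := bform_qframe b p X; have [-> -> -> ->] := bform_qframe b p Y.
have [-> -> -> ->] := bform_qframe b p n; rewrite X4 Y4.
have [_ _ e3 _] := quarter_pow r0; rewrite e3 -/(quarter c p).
have [T1 _ _ X34] := PX; have [T1' _ _ Y34] := PY; have [_ _ _ n34] := Pn.
move: coas kn l2; rewrite /acomps X34 Y34 n34 -/(quarter c p).
have qn0 : quarter c p != 0 by rewrite gt_eqF.
move: (quarter c p) (lam c p) qn0 => q l qn0 coas kn l2.
pose W := (Phi b X).2 0 4 * (Phi b Y).1 0 0 + (Phi b X).2 1 4 * (Phi b Y).1 0 1 +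
  (Phi b X).2 2 4 * (Phi b Y).1 0 2 - ((Phi b Y).2 0 4 * (Phi b X).1 0 0 +
  (Phi b Y).2 1 4 * (Phi b X).1 0 1 + (Phi b Y).2 2 4 * (Phi b X).1 0 2).
set Z := q ^- 3 * _ + _.
suff -> : Z = v * W by rewrite mulrA divfK.
rewrite /Z /W {Z W fp fr fr' Mn dn TX TY MX MY Pn PX PY fC ay d y4 y34 y3 L0 L1 L2 M0 M1 M2 N0 N1 N2 X34 Y34 n34 X4 Y4}.
move: (Phi b p) (Phi b n) (Phi b X) (Phi b Y) H1 T1 T1' coas kn => y n' z z' H1 T1 T1' coas kn.
pose W := z.2 0 4 * z'.1 0 0 + z.2 1 4 * z'.1 0 1 + z.2 2 4 * z'.1 0 2
   - (z'.2 0 4 * z.1 0 0 + z'.2 1 4 * z.1 0 1 + z'.2 2 4 * z.1 0 2).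
pose S := let a w := comps y (w.2 0 4) (w.2 1 4) (w.2 2 4) 0 in
  tri (bcomps y n') (bcomps y z) (a z') + tri (bcomps y n') (a z) (bcomps y z')
  + tri (a n') (bcomps y z) (bcomps y z').
apply: (@lincomb_eq _ _ _ (2 * q * n'.1 0 4 * W * dif H1 + W * dif kn
  - 2 * q * n'.1 0 4 * ((y.1 0 0 * z.2 0 4 + y.1 0 1 * z.2 1 4 + y.1 0 2 * z.2 2 4) * dif T1'
   - (y.1 0 0 * z'.2 0 4 + y.1 0 1 * z'.2 1 4 + y.1 0 2 * z'.2 2 4) * dif T1)
  - q ^- 3 * dif coas - q ^- 3 * S * dif l2)); last by rewrite !dif0; ring.
rewrite /dif /W /S /im3 /tri /bcomps /comps /pair_xx /=.
by field.
Qed.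
End Natural.

(** * The spherical chart *)

Section Chart.
Context {R : realType}.
Local Notation E := ('rV[R]_5 * 'M[R]_5)%type.
Implicit Types (p w : E) (xi : 'rV[R]_7).

Definition sph (th ph : R) : 'rV[R]_3 := \row_(j < 3) nth 0 [:: cos th; sin th * cos ph; sin th * sin ph] j.

Lemma Phi_chart b xi : exists A, Phi b (chart xi) =
  (vec5 (cos (alpha_ xi) * cos (theta_ xi)) (cos (alpha_ xi) * (sin (theta_ xi) * cos (phi_ xi)))
     (cos (alpha_ xi) * (sin (theta_ xi) * sin (phi_ xi)))
     (sin (alpha_ xi) * (cos b * cos (beta_ xi) + sin b * sin (beta_ xi)))
     (sin (alpha_ xi) * (- sin b * cos (beta_ xi) + cos b * sin (beta_ xi))), A).
Proof.
exists (Phi b (chart xi)).2; rewrite [LHS]surjective_pairing; congr pair.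
apply/rowP => i; rewrite mxE big_ord5 !mxE /= .
by elim/ord5P: i; rewrite /=; ring.
Qed.

Definition wedge_entry (U V : 'rV[R]_5) i j := U 0 i * V 0 j - V 0 i * U 0 j.
Lemma wedgeE (U V : 'rV[R]_5) i j : wedge U V i j = wedge_entry U V i j.
Proof. by rewrite /wedge addmxE !mxE !big_ord1 !mxE. Qed.

Lemma wedge_rot b (U V : 'rV[R]_5) :
  rot b *m wedge U V *m (rot b)^T = wedge (U *m (rot b)^T) (V *m (rot b)^T).
Proof. by rewrite /wedge mulmxBr mulmxBl !trmx_mul !trmxK !mulmxA. Qed.

Definition rotframe b xi : 'M[R]_(4, 5) := chart_frame xi *m (rot b)^T.

Lemma rotframe_rows b xi :
  let al := alpha_ xi in let th := theta_ xi in let ph := phi_ xi in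
  let C := cos b * cos (beta_ xi) + sin b * sin (beta_ xi) in
  let D := - sin b * cos (beta_ xi) + cos b * sin (beta_ xi) in
  [/\ row 0 (rotframe b xi) = vec5 (- sin al * cos th) (- sin al * sin th * cos ph)
       (- sin al * sin th * sin ph) (cos al * C) (cos al * D),
   row 1 (rotframe b xi) = vec5 0 0 0 (- D) C,
   row 2 (rotframe b xi) = vec5 (- sin th) (cos th * cos ph) (cos th * sin ph) 0 0 &
   row 3 (rotframe b xi) = vec5 0 (- sin ph) (cos ph) 0 0].
Proof.
move=> al th ph C D; rewrite /C /D {C D}.
split; rewrite /rotframe row_mul rowK /=; apply/rowP => i; rewrite mxE big_ord5 !mxE /=;
  by elim/ord5P: i; rewrite /=; ring.
Qed.

Lemma chart_A b xi : (Phi b (chart xi)).2 =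
   t_ xi *: Om (rotframe b xi) 0 + (s_ xi * cos (gamma_ xi)) *: Om (rotframe b xi) 1 +
   (s_ xi * sin (gamma_ xi)) *: Om (rotframe b xi) 2.
Proof.
have conjB (U V U' V' : 'rV[R]_5) : rot b *m (wedge U V - wedge U' V') *m (rot b)^T =
    wedge (U *m (rot b)^T) (V *m (rot b)^T) - wedge (U' *m (rot b)^T) (V' *m (rot b)^T).
  by rewrite -!wedge_rot mulmxBr mulmxBl.
rewrite /Phi /chart /= !mulmxDr !mulmxDl -!scalemxAr -!scalemxAl.
by rewrite /Om /= !conjB /rotframe !row_mul.
Qed.

Lemma chart_entries b xi :
  let al := alpha_ xi in let th := theta_ xi in let ph := phi_ xi in let ga := gamma_ xi in
  let C := cos b * cos (beta_ xi) + sin b * sin (beta_ xi) in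
  let D := - sin b * cos (beta_ xi) + cos b * sin (beta_ xi) in
  let w U V i j := wedge_entry U V i j in
  let e0 := vec5 (- sin al * cos th) (- sin al * sin th * cos ph)
       (- sin al * sin th * sin ph) (cos al * C) (cos al * D) in
  let e1 := vec5 0 0 0 (- D) C in
  let e2 := vec5 (- sin th) (cos th * cos ph) (cos th * sin ph) 0 0 in
  let e3 := vec5 0 (- sin ph) (cos ph) 0 0 in
  forall i j, (Phi b (chart xi)).2 i j =
    t_ xi * (w e0 e1 i j - w e2 e3 i j) + s_ xi * cos ga * (w e0 e2 i j - w e3 e1 i j) +
    s_ xi * sin ga * (w e0 e3 i j - w e1 e2 i j).
Proof.
move=> al th ph ga C D w e0 e1 e2 e3 i j; rewrite chart_A.
have [r0 r1 r2 r3] := rotframe_rows b xi.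
have combE (k l m : R) (A B G : 'M[R]_5) : (k *: A + l *: B + m *: G) i j = k * A i j + l * B i j + m * G i j.
  by rewrite !mxE.
rewrite combE /Om /= r0 r1 r2 r3 -/C -/D -/al -/th -/ph -/e0 -/e1 -/e2 -/e3.
have subE (U V U' V' : 'rV[R]_5) : (wedge U V - wedge U' V') i j = wedge_entry U V i j - wedge_entry U' V' i j.
  by rewrite -!wedgeE [LHS]mxE [X in _ + X]mxE.
by rewrite !subE.
Qed.

Section FixedBeta.
Context (b : R) (xi : 'rV[R]_7).
Context (bE : beta_ xi = b).
Let al := alpha_ xi. Let th := theta_ xi. Let ph := phi_ xi. Let ga := gamma_ xi.
Let t := t_ xi. Let s := s_ xi.

Lemma chart_coords : let y := Phi b (chart xi) in
  [/\ [/\ y.1 0 0 = cos al * cos th, y.1 0 1 = cos al * (sin th * cos ph),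
         y.1 0 2 = cos al * (sin th * sin ph), y.1 0 3 = sin al & y.1 0 4 = 0],
      y.2 0 4 = - t * sin al * cos th - s * sin ga * sin th,
      y.2 1 4 = - t * sin al * (sin th * cos ph) + s * (sin ga * (cos th * cos ph) + cos ga * sin ph),
      y.2 2 4 = - t * sin al * (sin th * sin ph) + s * (sin ga * (cos th * sin ph) - cos ga * cos ph) &
      y.2 3 4 = t * cos al].
Proof.
have C1 : cos b * cos (beta_ xi) + sin b * sin (beta_ xi) = 1.
  by rewrite bE -!expr2 cos2Dsin2.
have D0 : - sin b * cos (beta_ xi) + cos b * sin (beta_ xi) = 0 by rewrite bE; ring.
split.
- have [A ->] := Phi_chart b xi; rewrite /= !mxE /= C1 D0 mulr1 mulr0; split=> //.
all: by rewrite /= chart_entries /wedge_entry !mxE /= C1 D0 -/al -/th -/ph -/ga -/t -/s; ring.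
Qed.
End FixedBeta.

Lemma differentiable_mx {V : normedModType R} m n (f : V -> 'M[R]_(m, n)) x :
  (forall i j, differentiable (fun q => f q i j : R^o) x) -> differentiable f x.
Proof.
move=> df.
have -> : f = \sum_(i < m) (fun q => \sum_(j < n) f q i j *: delta_mx i j).
  by apply/funext => q; rewrite fct_sumE; exact: matrix_sum_delta.
apply: differentiable_sum => i.
have -> : (fun q => \sum_(j < n) f q i j *: delta_mx i j) = \sum_(j < n) (fun q => f q i j *: delta_mx i j).
  by apply/funext => q; rewrite fct_sumE.
by apply: differentiable_sum => j; apply: differentiableZl; exact: df.
Qed.

Lemma differentiable_xi i (xi : 'rV[R]_7) : differentiable (fun q : 'rV[R]_7 => q 0 i : R^o) xi.
Proof. exact: differentiable_coord. Qed.

Lemma differentiable_sin_comp (f : 'rV[R]_7 -> R^o) xi :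
  differentiable f xi -> differentiable (fun q => sin (f q) : R^o) xi.
Proof.
move=> df; apply: (differentiable_comp df); apply/derivable1_diffP.
by have [] := is_derive_sin (f xi).
Qed.

Lemma differentiable_cos_comp (f : 'rV[R]_7 -> R^o) xi :
  differentiable f xi -> differentiable (fun q => cos (f q) : R^o) xi.
Proof.
move=> df; apply: (differentiable_comp df); apply/derivable1_diffP.
by have [] := is_derive_cos (f xi).
Qed.

Lemma Phi0 p : Phi 0 p = p.
Proof.
have r0 : rot 0 = 1%:M :> 'M[R]_5.
  apply/matrixP => i j; rewrite !mxE cos0 sin0.
  by elim/ord5P: i; elim/ord5P: j; rewrite /= ?oppr0.
by rewrite /Phi r0 trmx1 !mulmx1 mul1mx; case: p.
Qed.

Ltac diff_tac := repeat first [ exact: differentiable_xi | exact: differentiable_cst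
  | apply: differentiable_sin_comp | apply: differentiable_cos_comp
  | apply: differentiableD | apply: differentiableB | apply: differentiableM | apply: differentiableN ].

Lemma differentiable_chart xi : differentiable chart xi.
Proof.
apply: differentiable_pair; apply: differentiable_mx => i j.
  under eq_fun do rewrite mxE.
  by elim/ord5P: j; rewrite /= /alpha_ /beta_ /theta_ /phi_; diff_tac.
(* The rotation by 0 is the identity, so the entries computed for a general angle apply. *)
have -> : (fun q => (t_ q *: Om (chart_frame q) 0 + (s_ q * cos (gamma_ q)) *: Om (chart_frame q) 1 +
   (s_ q * sin (gamma_ q)) *: Om (chart_frame q) 2) i j : R^o) = (fun q => (Phi 0 (chart q)).2 i j).
  by apply/funext => q; rewrite Phi0.
under eq_fun do rewrite chart_entries /wedge_entry !mxE.
by elim/ord5P: i; elim/ord5P: j; rewrite /= /alpha_ /beta_ /theta_ /phi_ /gamma_ /t_ /s_; diff_tac.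
Qed.
End Chart.

(** * The formula for omega in the spherical chart *)

Section ChartForm.
Context {R : realType}.
Local Notation E := ('rV[R]_5 * 'M[R]_5)%type.
Implicit Types (p w : E) (xi X Y : 'rV[R]_7).

Lemma diff_comp_linear {V W : normedModType R} (f : V -> W) (g : W -> R^o) x v (L : R^o) :
  differentiable f x -> (forall a y z, g (a *: y + z) = a *: g y + g z) -> continuous g ->
  is_derive (0 : R^o) (1 : R^o) (fun h : R^o => g (f (h *: v + x))) L -> g ('d f x v) = L.
Proof.
move=> df gl gc dL; pose gL := GRing.isLinear.Build _ _ _ _ g gl.
pose G : {linear W -> R^o} := HB.pack g gL.
have dG := @linear_differentiable _ _ _ G (f x) gc.
have <- : 'd (G \o f) x v = L.
  by apply: diff_is_derive; [exact: differentiable_comp|exact: is_derive_curve].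
rewrite [RHS](congr1 (fun h => h v) (diff_comp df dG)) /=.
by rewrite (congr1 (fun h => h ('d f x v)) (@diff_lin _ _ _ G (f x) gc)).
Qed.

Lemma continuous_Phi_x b i : continuous (fun q : E => (Phi b q).1 0 i : R^o).
Proof. by move=> q; apply: (@smooth_Phi_x R b setT i openT 0%N). Qed.

Lemma continuous_Phi_A b i j : continuous (fun q : E => (Phi b q).2 i j : R^o).
Proof. by move=> q; apply: (@smooth_Phi_A R b setT i j openT 0%N). Qed.

Lemma chart_diff_x b i xi X (L : R) :
  is_derive (0 : R^o) (1 : R^o) (fun h : R^o => (Phi b (chart (h *: X + xi))).1 0 i : R^o) L ->
  (Phi b ('d chart xi X)).1 0 i = L.
Proof.
move=> dL; apply: (@diff_comp_linear _ _ (@chart R) (fun q => (Phi b q).1 0 i)) => //.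
- exact: differentiable_chart.
- by move=> a y z; rewrite Phi_linear coord_linear.
- exact: continuous_Phi_x.
Qed.

Lemma chart_diff_A b i j xi X (L : R) :
  is_derive (0 : R^o) (1 : R^o) (fun h : R^o => (Phi b (chart (h *: X + xi))).2 i j : R^o) L ->
  (Phi b ('d chart xi X)).2 i j = L.
Proof.
move=> dL; apply: (@diff_comp_linear _ _ (@chart R) (fun q => (Phi b q).2 i j)) => //.
- exact: differentiable_chart.
- by move=> a y z; rewrite Phi_linear coord_linear.
- exact: continuous_Phi_A.
Qed.

Lemma chart_diff_x_ext b i xi X (g : R^o -> R^o) (L L' : R) :
  (forall h, (Phi b (chart (h *: X + xi))).1 0 i = g h) ->
  is_derive (0 : R^o) (1 : R^o) g L' -> L' = L -> (Phi b ('d chart xi X)).1 0 i = L.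
Proof. by move=> /funext gE dg <-; apply: chart_diff_x; rewrite gE. Qed.

Lemma chart_diff_A_ext b i j xi X (g : R^o -> R^o) (L L' : R) :
  (forall h, (Phi b (chart (h *: X + xi))).2 i j = g h) ->
  is_derive (0 : R^o) (1 : R^o) g L' -> L' = L -> (Phi b ('d chart xi X)).2 i j = L.
Proof. by move=> /funext gE dg <-; apply: chart_diff_A; rewrite gE. Qed.

Lemma is_derive_affine (a a' : R) : is_derive (0 : R^o) (1 : R^o) (fun h : R^o => h * a' + a : R^o) a'.
Proof. by apply: is_derive_eq; rewrite /GRing.scale/=; ring. Qed.

Lemma is_derive_cos_affine (a a' : R) :
  is_derive (0 : R^o) (1 : R^o) (fun h : R^o => cos (h * a' + a) : R^o) (- sin a * a').
Proof.
have d1 := is_derive_affine a a'.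
have d2 := @is_derive_cos R (0 * a' + a).
by have := @is_derive1_comp R cos (fun h => h * a' + a) 0 _ _ d2 d1; rewrite mul0r add0r.
Qed.

Lemma is_derive_sin_affine (a a' : R) :
  is_derive (0 : R^o) (1 : R^o) (fun h : R^o => sin (h * a' + a) : R^o) (cos a * a').
Proof.
have d1 := is_derive_affine a a'.
have d2 := @is_derive_sin R (0 * a' + a).
by have := @is_derive1_comp R sin (fun h => h * a' + a) 0 _ _ d2 d1; rewrite mul0r add0r.
Qed.

Section Dir.
Context (b : R) (xi X : 'rV[R]_7).
Context (bE : beta_ xi = b) (bX : beta_ X = 0).
Let al := alpha_ xi. Let th := theta_ xi. Let ph := phi_ xi. Let ga := gamma_ xi.
Let t := t_ xi. Let s := s_ xi.
Let al' := alpha_ X. Let th' := theta_ X. Let ph' := phi_ X. Let ga' := gamma_ X.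
Let t' := t_ X. Let s' := s_ X.

Lemma chart_diff_coords : let z := Phi b ('d chart xi X) in
  [/\ z.1 0 0 = - sin al * al' * cos th - cos al * sin th * th',
      z.1 0 1 = - sin al * al' * (sin th * cos ph) + cos al * (cos th * th' * cos ph - sin th * sin ph * ph') &
      z.1 0 2 = - sin al * al' * (sin th * sin ph) + cos al * (cos th * th' * sin ph + sin th * cos ph * ph')] /\
  [/\ z.2 0 4 = - t' * sin al * cos th - t * cos al * al' * cos th + t * sin al * sin th * th'
        - s' * sin ga * sin th - s * cos ga * ga' * sin th - s * sin ga * cos th * th', 
      z.2 1 4 = - (t' * sin al + t * cos al * al') * (sin th * cos ph)
       - t * sin al * (cos th * th' * cos ph - sin th * sin ph * ph')
       + s' * (sin ga * (cos th * cos ph) + cos ga * sin ph)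
       + s * (cos ga * ga' * (cos th * cos ph) - sin ga * (sin th * th' * cos ph + cos th * sin ph * ph')
           - sin ga * ga' * sin ph + cos ga * cos ph * ph'),
      z.2 2 4 = - (t' * sin al + t * cos al * al') * (sin th * sin ph)
       - t * sin al * (cos th * th' * sin ph + sin th * cos ph * ph')
       + s' * (sin ga * (cos th * sin ph) - cos ga * cos ph)
       + s * (cos ga * ga' * (cos th * sin ph) - sin ga * (sin th * th' * sin ph - cos th * cos ph * ph')
           + sin ga * ga' * cos ph + cos ga * sin ph * ph') &
      z.2 3 4 = t' * cos al - t * sin al * al'].
Proof.
have bh h : beta_ (h *: X + xi) = b by rewrite /beta_ !mxE -/(beta_ X) -/(beta_ xi) bX bE mulr0 add0r.
have E h := chart_coords (bh h).
have lin (i : 'I_7) h : (h *: X + xi) 0 i = h * X 0 i + xi 0 i by rewrite !mxE.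
pose ca (h : R^o) : R^o := cos (h * al' + al); pose sa (h : R^o) : R^o := sin (h * al' + al).
pose ct (h : R^o) : R^o := cos (h * th' + th); pose st (h : R^o) : R^o := sin (h * th' + th).
pose cp (h : R^o) : R^o := cos (h * ph' + ph); pose sp (h : R^o) : R^o := sin (h * ph' + ph).
pose cg (h : R^o) : R^o := cos (h * ga' + ga); pose sg (h : R^o) : R^o := sin (h * ga' + ga).
pose tt (h : R^o) : R^o := h * t' + t; pose ss (h : R^o) : R^o := h * s' + s.
have dca : is_derive (0 : R^o) (1 : R^o) ca _ := is_derive_cos_affine al al'.
have dsa : is_derive (0 : R^o) (1 : R^o) sa _ := is_derive_sin_affine al al'.
have dct : is_derive (0 : R^o) (1 : R^o) ct _ := is_derive_cos_affine th th'.
have dst : is_derive (0 : R^o) (1 : R^o) st _ := is_derive_sin_affine th th'.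
have dcp : is_derive (0 : R^o) (1 : R^o) cp _ := is_derive_cos_affine ph ph'.
have dsp : is_derive (0 : R^o) (1 : R^o) sp _ := is_derive_sin_affine ph ph'.
have dcg : is_derive (0 : R^o) (1 : R^o) cg _ := is_derive_cos_affine ga ga'.
have dsg : is_derive (0 : R^o) (1 : R^o) sg _ := is_derive_sin_affine ga ga'.
have dtt : is_derive (0 : R^o) (1 : R^o) tt _ := is_derive_affine t t'.
have dss : is_derive (0 : R^o) (1 : R^o) ss _ := is_derive_affine s s'.
have at0 : [/\ ca 0 = cos al, sa 0 = sin al, ct 0 = cos th & st 0 = sin th] /\
  [/\ cp 0 = cos ph, sp 0 = sin ph, cg 0 = cos ga & sg 0 = sin ga] /\ tt 0 = t /\ ss 0 = s.
  by rewrite /ca /sa /ct /st /cp /sp /cg /sg /tt /ss !mul0r !add0r.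
have E' h : let y := Phi b (chart (h *: X + xi)) in
  [/\ [/\ y.1 0 0 = ca h * ct h, y.1 0 1 = ca h * (st h * cp h),
         y.1 0 2 = ca h * (st h * sp h), y.1 0 3 = sa h & y.1 0 4 = 0],
      y.2 0 4 = - tt h * sa h * ct h - ss h * sg h * st h,
      y.2 1 4 = - tt h * sa h * (st h * cp h) + ss h * (sg h * (ct h * cp h) + cg h * sp h),
      y.2 2 4 = - tt h * sa h * (st h * sp h) + ss h * (sg h * (ct h * sp h) - cg h * cp h) &
      y.2 3 4 = tt h * ca h].
  by have := E h; rewrite /alpha_ /theta_ /phi_ /gamma_ /t_ /s_ !lin.
move: at0 => [[a1 a2 a3 a4] [[a5 a6 a7 a8] [a9 a10]]].
(* The trigonometric functions become variables known only by their value and derivative at 0, so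
   that the derivative of each coordinate is composed from these. *)
move: ca sa ct st cp sp cg sg tt ss dca dsa dct dst dcp dsp dcg dsg dtt dss a1 a2 a3 a4 a5 a6 a7 a8 a9 a10 {E} E'.
move=> ca sa ct st cp sp cg sg tt ss dca dsa dct dst dcp dsp dcg dsg dtt dss a1 a2 a3 a4 a5 a6 a7 a8 a9 a10 E.
split; split.
- apply: (@chart_diff_x_ext _ _ _ _ (fun h => ca h * ct h)) => [h|].
    by have [[-> _ _ _ _] _ _ _ _] := E h.
  rewrite /GRing.scale /= ?a1 ?a2 ?a3 ?a4 ?a5 ?a6 ?a7 ?a8 ?a9 ?a10; ring.
- apply: (@chart_diff_x_ext _ _ _ _ (fun h => ca h * (st h * cp h))) => [h|].
    by have [[_ -> _ _ _] _ _ _ _] := E h.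
  rewrite /GRing.scale /= ?a1 ?a2 ?a3 ?a4 ?a5 ?a6 ?a7 ?a8 ?a9 ?a10; ring.
- apply: (@chart_diff_x_ext _ _ _ _ (fun h => ca h * (st h * sp h))) => [h|].
    by have [[_ _ -> _ _] _ _ _ _] := E h.
  rewrite /GRing.scale /= ?a1 ?a2 ?a3 ?a4 ?a5 ?a6 ?a7 ?a8 ?a9 ?a10; ring.
- apply: (@chart_diff_A_ext _ _ _ _ _ (fun h => - tt h * sa h * ct h - ss h * sg h * st h)) => [h|].
    by have [_ -> _ _ _] := E h.
  rewrite /GRing.scale /= ?a1 ?a2 ?a3 ?a4 ?a5 ?a6 ?a7 ?a8 ?a9 ?a10; ring.
- apply: (@chart_diff_A_ext _ _ _ _ _ (fun h => - tt h * sa h * (st h * cp h) + ss h * (sg h * (ct h * cp h) + cg h * sp h))) => [h|].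
    by have [_ _ -> _ _] := E h.
  rewrite /GRing.scale /= ?a1 ?a2 ?a3 ?a4 ?a5 ?a6 ?a7 ?a8 ?a9 ?a10; ring.
- apply: (@chart_diff_A_ext _ _ _ _ _ (fun h => - tt h * sa h * (st h * sp h) + ss h * (sg h * (ct h * sp h) - cg h * cp h))) => [h|].
    by have [_ _ _ -> _] := E h.
  rewrite /GRing.scale /= ?a1 ?a2 ?a3 ?a4 ?a5 ?a6 ?a7 ?a8 ?a9 ?a10; ring.
- apply: (@chart_diff_A_ext _ _ _ _ _ (fun h => tt h * ca h)) => [h|].
    by have [_ _ _ _ ->] := E h.
  rewrite /GRing.scale /= ?a1 ?a2 ?a3 ?a4 ?a5 ?a6 ?a7 ?a8 ?a9 ?a10; ring.
Qed.
End Dir.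

Lemma omega_chartE b xi X Y : beta_ xi = b -> beta_ X = 0 -> beta_ Y = 0 ->
  cos (alpha_ xi) != 0 ->
  (Phi b ('d chart xi X)).2 3 4 = 0 -> (Phi b ('d chart xi Y)).2 3 4 = 0 ->
  wC (Phi b ('d chart xi X)) (Phi b ('d chart xi Y)) = omega_chart xi X Y.
Proof.
move=> bE bX bY ca0 X34 Y34.
have [[x0 x1 x2] [x3 x4 x5 x6]] := chart_diff_coords bE bX.
have [[y0 y1 y2] [y3 y4 y5 y6]] := chart_diff_coords bE bY.
rewrite x6 in X34; rewrite y6 in Y34.
rewrite /wC x0 x1 x2 x3 x4 x5 y0 y1 y2 y3 y4 y5 /omega_chart /drho /sigma1 /sigma2 /sigma3 /rho_.
congr (_ * _).
(* Both vectors annihilate d(t cos(alpha)), hence dt is proportional to d alpha on them and dt /\ d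
   alpha vanishes. *)
have tk : t_ X * alpha_ Y = t_ Y * alpha_ X.
  apply: (mulfI ca0).
  lincomb (alpha_ Y * dif X34 - alpha_ X * dif Y34).
have c1 : cos (theta_ xi) ^+ 2 = 1 - sin (theta_ xi) ^+ 2 by rewrite cos2sin2.
have c2 : cos (phi_ xi) ^+ 2 = 1 - sin (phi_ xi) ^+ 2 by rewrite cos2sin2.
have c3 : cos (gamma_ xi) ^+ 2 = 1 - sin (gamma_ xi) ^+ 2 by rewrite cos2sin2.
move: c1 c2 c3 tk.
move: (cos (theta_ xi)) (sin (theta_ xi)) (cos (phi_ xi)) (sin (phi_ xi)) (cos (gamma_ xi)) (sin (gamma_ xi)) => ct st cp sp cg sg.
move: (cos (alpha_ xi)) (sin (alpha_ xi)) => ca sa.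
move: (t_ xi) (s_ xi) (t_ X) (s_ X) (t_ Y) (s_ Y) (alpha_ X) (alpha_ Y) (theta_ X) (theta_ Y) (phi_ X) (phi_ Y) (gamma_ X) (gamma_ Y).
move=> t s tX sX tY sY aX aY thX thY phX phY gX gY c1 c2 c3 tk.
ring: c1 c2 c3 tk.
Qed.
End ChartForm.

(** * The bolt *)

Section SpecialLagrangian.
Context {R : realType}.
Local Notation E := ('rV[R]_5 * 'M[R]_5)%type.

Lemma natural_su2 (c u v b k1 k2 : R) : 0 <= c -> 0 <= v -> ~ (u = 0 /\ v = 2 * c `^ (4^-1)) ->
  natural c u v b (su2 c b k1 k2).
Proof.
move=> c0 v0 ns; split.
- by move=> p e X Y fp fr TX TY; rewrite /= (gBS_fibre fp fr TX TY).
- move=> xi X Y [/andP[a0 a1] _ _] bE fp bX TX bY TY /=.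
  apply: omega_chartE => //.
  + rewrite gt_eqF// cos_gt0_pihalf// a1 andbT.
    by rewrite (lt_le_trans _ a0)// oppr_lt0 divr_gt0 ?pi_gt0.
  + by have [[_ _ _ ->]] := tanC_pretan ((tanN_tanC _ fp).1 TX).
  + by have [[_ _ _ ->]] := tanC_pretan ((tanN_tanC _ fp).1 TY).
- move=> vn0 p e n X Y fp fr Mn _ dn TX TY /=.
  exact: (omeg_phiBS c0 v0 ns vn0 fp fr Mn dn TX TY).
Qed.

Section Sphere.
Context (b C S t : R).

Definition iota_base : E := PhiV b (vec5 0 0 0 S 0, skew 0 0 0 0 0 0 0 0 0 (t * C)).
Definition iota_dir (e0 e1 e2 : R) : E :=
  PhiV b (vec5 (C * e0) (C * e1) (C * e2) 0 0,
    skew (- t * e0) (- t * e1) (- t * e2) 0 0 0 (- t * S * e0) (- t * S * e1) (- t * S * e2) 0).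
(** The linear part of the affine map [iota_pt], hence its differential at every point; written
    through the images of the unit vectors. *)
Definition iota_tan (y : 'rV[R]_3) : E :=
  y 0 0 *: iota_dir 1 0 0 + (y 0 1 *: iota_dir 0 1 0 + y 0 2 *: iota_dir 0 0 1).

(* The zero section: x = C y + S e and a = t (C e - S y). *)
Definition iota_pt (y : 'rV[R]_3) : E := iota_base + iota_tan y.

Lemma PhiD (X Y : E) : Phi b (X + Y) = Phi b X + Phi b Y.
Proof. by rewrite -[X]scale1r Phi_linear !scale1r. Qed.
Lemma PhiZ a (X : E) : Phi b (a *: X) = a *: Phi b X.
Proof. by rewrite -[a *: X]addr0 Phi_linear /Phi /= !mul0mx mulmx0 mul0mx addr0. Qed.

Lemma Phi_iota_tan y : Phi b (iota_tan y) =
  (vec5 (C * y 0 0) (C * y 0 1) (C * y 0 2) 0 0,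
    skew (- t * y 0 0) (- t * y 0 1) (- t * y 0 2) 0 0 0
     (- t * S * y 0 0) (- t * S * y 0 1) (- t * S * y 0 2) 0).
Proof.
rewrite /iota_tan !PhiD !PhiZ /iota_dir !PhiVK; apply/pair_equal_spec; split; apply/matrixP => i j; rewrite !mxE.
  by elim/ord5P: j; rewrite /=; ring.
by elim/ord5P: i; elim/ord5P: j; rewrite /=; ring.
Qed.

Context (CS : C ^+ 2 + S ^+ 2 = 1).

Lemma Phi_iota y : Phi b (iota_pt y) =
  emb (C * y 0 0) (C * y 0 1) (C * y 0 2) S (- t * S * y 0 0) (- t * S * y 0 1) (- t * S * y 0 2) (t * C).
Proof.
rewrite /iota_pt PhiD Phi_iota_tan /iota_base PhiVK.
apply/pair_equal_spec; split; apply/matrixP => i j; rewrite !mxE.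
  by elim/ord5P: j; rewrite /=; ring.
elim/ord5P: i; elim/ord5P: j; rewrite /=; try ring.
- lincomb (t * y 0 2 * dif CS).
- lincomb (- t * y 0 1 * dif CS).
- lincomb (- t * y 0 2 * dif CS).
- lincomb (t * y 0 0 * dif CS).
- lincomb (t * y 0 1 * dif CS).
- lincomb (- t * y 0 0 * dif CS).
Qed.

Lemma dot3E (x y : 'rV[R]_3) : dot x y = x 0 0 * y 0 0 + x 0 1 * y 0 1 + x 0 2 * y 0 2.
Proof. by rewrite dotE big_ord3. Qed.

Lemma iota_tan_linear a x y : iota_tan (a *: x + y) = a *: iota_tan x + iota_tan y.
Proof.
rewrite /iota_tan !mxE !scalerDl !scalerDr !scalerA -!addrA; congr (_ + _).
by rewrite addrCA; congr (_ + _); rewrite [RHS]addrCA; congr (_ + _); rewrite addrCA.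
Qed.

Lemma smooth_iota : smooth_on setT iota_pt.
Proof.
have oT : open (setT : set 'rV[R]_3) := openT.
have sy i : smooth_on setT (fun y : 'rV[R]_3 => y 0 i : R^o).
  apply: smooth_lin; first by move=> a x y; rewrite !mxE.
  by move=> y; exact: coord_continuous.
apply: smoothD => //; first exact: smooth_cst.
by do 2?apply: smoothD => //; apply: smoothZl.
Qed.

Lemma diff_iota y X : 'd iota_pt y X = iota_tan X.
Proof.
have di : differentiable iota_pt y := smooth_differentiable smooth_iota I.
apply: diff_is_derive => //.
have cv : (fun h : R => h^-1 *: ((iota_pt \o shift y) (h *: X) - iota_pt y)) @ 0^' --> iota_tan X.
  apply: cvg_near_cst; near=> h; have h0 : h != 0 by near: h; exact: nbhs_dnbhs_neq.
  rewrite /= /iota_pt iota_tan_linear addrCA addrK scalerA mulVf// scale1r //.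
by split; [apply/cvg_ex; exists (iota_tan X)|exact: cvg_lim].
Unshelve. all: by end_near. Qed.

Lemma iota_inj (y y' : 'rV[R]_3) : C ^+ 2 + (t * S) ^+ 2 != 0 -> iota_tan y = iota_tan y' -> y = y'.
Proof.
move=> n0 e.
have key (a a' : R) : C * a = C * a' -> - t * S * a = - t * S * a' -> a = a'.
  by move=> h1 h2; apply: (mulfI n0); lincomb (C * dif h1 - t * S * dif h2).
have := Phi_iota_tan y; rewrite e Phi_iota_tan => /pair_equal_spec[/rowP ex /matrixP eA].
have := ex 0; rewrite !mxE /= => ex0; have := ex 1; rewrite !mxE /= => ex1.
have := ex 2; rewrite !mxE /= => ex2.
have := eA 0 4; rewrite !mxE /= => eA0; have := eA 1 4; rewrite !mxE /= => eA1.
have := eA 2 4; rewrite !mxE /= => eA2.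
have h0 := key _ _ ex0 eA0; have h1 := key _ _ ex1 eA1; have h2 := key _ _ ex2 eA2.
apply/rowP => i; have : i \in [:: 0; 1; 2] by case: i => -[|[|[|]]].
by rewrite !inE => /orP[/eqP->|/orP[/eqP->|/eqP->]].
Qed.

(** Put kappa = l C + i t S. On the bolt l dx - i da is kappa times the vector of R^3, and in the
    plane of y and e the vectors x and l e - i S a have determinant conj kappa. The result is
    kappa^2 conj kappa times the determinant, and K = |kappa|^2. *)
Lemma iota_D l y X Y : dot y X = 0 -> dot y Y = 0 -> dot y y = 1 ->
  let d := \det (row3 y X Y) in let K := l ^+ 2 * C ^+ 2 + t ^+ 2 * S ^+ 2 in
  reC l (Phi b (iota_pt y)) (Phi b (iota_tan X)) (Phi b (iota_tan Y)) = K * (l * C) * d /\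
  imC l (Phi b (iota_pt y)) (Phi b (iota_tan X)) (Phi b (iota_tan Y)) = K * (t * S) * d.
Proof.
move=> yX yY yy d K; rewrite Phi_iota !Phi_iota_tan /d det3E /row3 !mxE /=.
rewrite /reC /imC /reD /imD /reD0 /imD0 /reD1 /imD1 /D0 /D1 /tri /xs /As !mxE /= /K {d K}.
move: (y 0 0) (y 0 1) (y 0 2) (X 0 0) (X 0 1) (X 0 2) (Y 0 0) (Y 0 1) (Y 0 2) => y0 y1 y2 X0 X1 X2 Y0 Y1 Y2.
have CS' : C ^+ 2 = 1 - S ^+ 2 by rewrite -CS; ring.
split.
ring: CS'.
ring: CS'.
Qed.

Context (c u v : R).
Context (tC : t * C = u) (r0 : 0 < c + t ^+ 2) (Sv : 2 * (c + t ^+ 2) `^ (4^-1) * S = v).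

Lemma rsq_iota y : dot y y = 1 -> rsq (iota_pt y).2 = t ^+ 2.
Proof.
rewrite dot3E => yy; rewrite -(rsq_Phi b) Phi_iota.
have [h d] : asd (emb (C * y 0 0) (C * y 0 1) (C * y 0 2) S (- t * S * y 0 0) (- t * S * y 0 1) (- t * S * y 0 2) (t * C)) /\
  dot (emb (C * y 0 0) (C * y 0 1) (C * y 0 2) S (- t * S * y 0 0) (- t * S * y 0 1) (- t * S * y 0 2) (t * C)).1
   (emb (C * y 0 0) (C * y 0 1) (C * y 0 2) S (- t * S * y 0 0) (- t * S * y 0 1) (- t * S * y 0 2) (t * C)).1 = 1.
  by apply: emb_asd; [lincomb (C ^+ 2 * dif yy + dif CS)|lincomb (- t * S * C * dif yy)].
have [_ _ _ ->] := asd_coord h d (mxE _ _ _ _).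
by rewrite !mxE /=; lincomb (t ^+ 2 * S ^+ 2 * dif yy + t ^+ 2 * dif CS).
Qed.

Lemma iota_fibre y : S2 y -> fibre c (base u v b) (iota_pt y).
Proof.
rewrite /S2 /= => yy; have rE := rsq_iota yy; move: (yy); rewrite dot3E => yy'.
apply/fibre_Phi; rewrite rsq_Phi rE /quarter rE Phi_iota.
have [h d] : asd (emb (C * y 0 0) (C * y 0 1) (C * y 0 2) S (- t * S * y 0 0) (- t * S * y 0 1) (- t * S * y 0 2) (t * C)) /\
  dot (emb (C * y 0 0) (C * y 0 1) (C * y 0 2) S (- t * S * y 0 0) (- t * S * y 0 1) (- t * S * y 0 2) (t * C)).1
   (emb (C * y 0 0) (C * y 0 1) (C * y 0 2) S (- t * S * y 0 0) (- t * S * y 0 1) (- t * S * y 0 2) (t * C)).1 = 1.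
  by apply: emb_asd; [lincomb (C ^+ 2 * dif yy' + dif CS)|lincomb (- t * S * C * dif yy')].
by split=> //; rewrite !mxE /=; split.
Qed.

Lemma iota_tanN y X : S2 y -> dot y X = 0 -> tanN c (iota_pt y) (iota_tan X).
Proof.
move=> Sy; rewrite dot3E => yX; apply/(tanN_tanC _ (iota_fibre Sy)).
move: (Sy); rewrite /S2 /= dot3E => yy.
rewrite Phi_iota Phi_iota_tan; split.
- apply/pair_equal_spec; split; apply/matrixP => i j; rewrite !mxE /=.
    by elim/ord5P: j; rewrite /=; ring.
  elim/ord5P: i; elim/ord5P: j; rewrite /=; try ring.
  + lincomb (t * X 0 2 * dif CS).
  + lincomb (- t * X 0 1 * dif CS).
  + lincomb (- t * X 0 2 * dif CS).
  + lincomb (t * X 0 0 * dif CS).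
  + lincomb (t * X 0 1 * dif CS).
  + lincomb (- t * X 0 0 * dif CS).
- by rewrite /pair_xx !mxE /=; lincomb (C ^+ 2 * dif yX).
- by rewrite /pair_ax !mxE /=; lincomb (- 2 * C * t * S * dif yX).
- by rewrite /pair_aa !mxE /=; lincomb (S * t ^+ 2 * S ^+ 2 * dif yX).
Qed.

Lemma iota_metr y X Y : S2 y -> dot y X = 0 -> dot y Y = 0 ->
  gC (root_radius c (iota_pt y)) (inv_root_radius c (iota_pt y)) (Phi b (iota_pt y))
    (Phi b (iota_tan X)) (Phi b (iota_tan Y)) =
  ((c + t ^+ 2) `^ (- 2^-1) * t ^+ 2 * S ^+ 2 + 2 * (c + t ^+ 2) `^ (2^-1) * C ^+ 2) * dot X Y.
Proof.
move=> Sy; have rE := rsq_iota Sy; rewrite !dot3E => yX yY.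
rewrite /root_radius /inv_root_radius rE Phi_iota !Phi_iota_tan /gC /pair_ax /pair_xx !mxE /=.
move: (_ `^ (- 2^-1)) (_ `^ (2^-1)) => ri r.
lincomb (- ri * t ^+ 2 * S ^+ 2 * C ^+ 2 * dif yX * (y 0 0 * Y 0 0 + y 0 1 * Y 0 1 + y 0 2 * Y 0 2)).
Qed.

Definition bolt_lam : R := Num.sqrt 2 * (c + t ^+ 2) `^ (2^-1).
Definition bolt_kap : R := bolt_lam ^+ 2 * C ^+ 2 + t ^+ 2 * S ^+ 2.
(** Chosen so that k1 - i k2 = (c + t^2)^(-1/2) conj kappa / |kappa|^2 for kappa = l C + i t S.
    Multiplied by the value |kappa|^2 kappa of the determinant form, this gives (c + t^2)^(-1/2)
    |kappa|^2, which is real and is the area density of the bolt. *)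
Definition bolt_k1 : R := (c + t ^+ 2) `^ (- 2^-1) / bolt_kap * (bolt_lam * C).
Definition bolt_k2 : R := (c + t ^+ 2) `^ (- 2^-1) / bolt_kap * (t * S).

(** The Gram determinant of (y, X, Y), whose first row and column are those of the identity. *)
Lemma gram3 (y X Y : 'rV[R]_3) : dot y y = 1 -> dot y X = 0 -> dot y Y = 0 ->
  \det (row3 y X Y) ^+ 2 = dot X X * dot Y Y - dot X Y ^+ 2.
Proof.
rewrite det3E /row3 !mxE /= !dot3E => yy yX yY.
lincomb ((( X 0 0 * X 0 0 + X 0 1 * X 0 1 + X 0 2 * X 0 2) * (Y 0 0 * Y 0 0 + Y 0 1 * Y 0 1 + Y 0 2 * Y 0 2)
  - (X 0 0 * Y 0 0 + X 0 1 * Y 0 1 + X 0 2 * Y 0 2) ^+ 2) * dif yy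
  - (Y 0 0 * Y 0 0 + Y 0 1 * Y 0 1 + Y 0 2 * Y 0 2) * dif yX ^+ 2
  - (X 0 0 * X 0 0 + X 0 1 * X 0 1 + X 0 2 * X 0 2) * dif yY ^+ 2
  + 2 * (X 0 0 * Y 0 0 + X 0 1 * Y 0 1 + X 0 2 * Y 0 2) * dif yX * dif yY).
Qed.

Lemma iota_SL : bolt_kap != 0 -> special_lagrangian (su2 c b bolt_k1 bolt_k2) iota_pt.
Proof.
move=> k0 y X Y Sy yX yY /=; rewrite !diff_iota.
have rE := rsq_iota Sy.
have lE : lam c (iota_pt y) = bolt_lam by rewrite /lam /root_radius rE.
have [re im] := iota_D bolt_lam yX yY Sy; rewrite lE re im -/bolt_kap !iota_metr//.
split.
- by rewrite !Phi_iota_tan /wC !mxE /=; ring.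
- by rewrite /bolt_k1 /bolt_k2; ring.
move=> d0.
have s2 : Num.sqrt 2 ^+ 2 = 2 :> R by rewrite sqr_sqrtr.
have p2 : ((c + t ^+ 2) `^ (2^-1)) ^+ 2 = c + t ^+ 2.
  by rewrite powR12_sqrt ?(ltW r0)// sqr_sqrtr// ltW.
have p0 : 0 < (c + t ^+ 2) `^ (2^-1) by exact: powR_gt0.
have pi' : (c + t ^+ 2) `^ (- 2^-1) = ((c + t ^+ 2) `^ (2^-1))^-1 by rewrite powRN.
set d := \det _ in d0 *.
have kE : (c + t ^+ 2) `^ (- 2^-1) * t ^+ 2 * S ^+ 2 + 2 * (c + t ^+ 2) `^ (2^-1) * C ^+ 2 =
  (c + t ^+ 2) `^ (- 2^-1) * bolt_kap.
  rewrite /bolt_kap /bolt_lam exprMn s2 pi'; field; exact: lt0r_neq0.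
rewrite kE.
have kp : 0 < bolt_kap.
  by rewrite lt_neqAle eq_sym k0 /bolt_kap -!exprMn addr_ge0 ?sqr_ge0.
set q := (c + t ^+ 2) `^ (- 2^-1).
have q0 : 0 < q by exact: powR_gt0.
have -> : q * bolt_kap * dot X X * (q * bolt_kap * dot Y Y) - (q * bolt_kap * dot X Y) ^+ 2 =
   (q * bolt_kap * d) ^+ 2.
  by rewrite [in RHS]exprMn /d (gram3 Sy yX yY); ring.
rewrite sqrtr_sqr ger0_norm; last by rewrite !mulr_ge0// ltW.
rewrite /bolt_k1 /bolt_k2 -/q.
have -> : q / bolt_kap * (bolt_lam * C) * (bolt_kap * (bolt_lam * C) * d) +
   q / bolt_kap * (t * S) * (bolt_kap * (t * S) * d) =
   q * d * (bolt_lam ^+ 2 * C ^+ 2 + t ^+ 2 * S ^+ 2) by field.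
by rewrite -/bolt_kap; ring.
Qed.

Lemma bolt_k_neq0 : bolt_kap != 0 -> bolt_k1 ^+ 2 + bolt_k2 ^+ 2 != 0.
Proof.
move=> k0; have q0 : (c + t ^+ 2) `^ (- 2^-1) != 0 by rewrite gt_eqF// powR_gt0.
have -> : bolt_k1 ^+ 2 + bolt_k2 ^+ 2 = (c + t ^+ 2) `^ (- 2^-1) ^+ 2 / bolt_kap.
  rewrite /bolt_k1 /bolt_k2.
  rewrite (_ : _ + _ = ((c + t ^+ 2) `^ (- 2^-1) / bolt_kap) ^+ 2 *
    (bolt_lam ^+ 2 * C ^+ 2 + t ^+ 2 * S ^+ 2)); last by field.
  by rewrite -/bolt_kap; field.
by rewrite mulf_neq0 ?expf_neq0 ?invr_eq0.
Qed.

(** Degeneration means C = 0 and t S = 0; then S = 1 and t = 0, so that u = 0 and v = 2 c^(1/4). *)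
Lemma bolt_kap_neq0 : 0 <= S -> ~ (u = 0 /\ v = 2 * c `^ (4^-1)) ->
  bolt_kap != 0 /\ C ^+ 2 + (t * S) ^+ 2 != 0.
Proof.
move=> S0 ns.
suff H : C ^+ 2 + (t * S) ^+ 2 != 0.
  split=> //; apply: contra_neq H => /eqP; rewrite /bolt_kap -!exprMn paddr_eq0 ?sqr_ge0//.
  have l0 : bolt_lam != 0 by rewrite gt_eqF// /bolt_lam mulr_gt0 ?sqrtr_gt0 ?powR_gt0.
  rewrite !expf_eq0 /= mulf_eq0 (negPf l0) /= => /andP[/eqP -> /eqP ->].
  by rewrite expr0n addr0.
apply/negP; rewrite paddr_eq0 ?sqr_ge0// !expf_eq0 /= => /andP[/eqP C0 /eqP tS].
have S1 : S = 1.
  by apply/eqP; rewrite -(@eqrXn2 _ 2)// expr1n -CS C0 expr0n add0r.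
apply: ns; rewrite -tC C0 mulr0; split=> //.
have t0 : t = 0 by rewrite -(mulr1 t) -S1.
by rewrite -Sv S1 t0 expr0n addr0 mulr1.
Qed.
End Sphere.
End SpecialLagrangian.

(** * Existence and uniqueness of the parameters of the bolt *)

Section Bolt.
Context {R : realType}.
Local Notation E := ('rV[R]_5 * 'M[R]_5)%type.

Lemma circle_polar (a b : R) : a ^+ 2 + b ^+ 2 = 1 ->
  exists phi, [/\ - pi <= phi <= pi, cos phi = a & sin phi = b].
Proof.
move=> ab; have a1 : -1 <= a <= 1.
  by rewrite -ler_norml -(@expr_le1 _ 2)// real_normK ?num_real// -ab lerDl sqr_ge0.
have [p0 p1] : 0 <= acos a /\ acos a <= pi by rewrite acos_ge0// acos_lepi.
have sE : sin (acos a) = `|b|.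
  by rewrite sin_acos// -sqrtr_sqr; congr Num.sqrt; rewrite -ab; ring.
have [b0|b0] := leP 0 b.
  exists (acos a); rewrite p1 andbT acosK// sE ger0_norm//; split=> //.
  by rewrite (le_trans _ p0)// oppr_le0 pi_ge0.
exists (- acos a); rewrite cosN sinN acosK// sE ltr0_norm// opprK; split=> //.
by rewrite lerN2 p1/= (le_trans _ (pi_ge0 R))// oppr_le0.
Qed.

Lemma plane_polar (x y : R) : exists v b, [/\ 0 <= v, - pi <= b <= pi, x = v * cos b & y = v * sin b].
Proof.
have [xy0|xy0] := eqVneq (x ^+ 2 + y ^+ 2) 0.
  exists 0, 0; move/eqP: xy0; rewrite paddr_eq0 ?sqr_ge0// !expf_eq0 /= => /andP[/eqP -> /eqP ->].
  by rewrite !mul0r oppr_le0 pi_ge0.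
have v0 : 0 < Num.sqrt (x ^+ 2 + y ^+ 2).
  by rewrite sqrtr_gt0 lt_neqAle eq_sym xy0 addr_ge0 ?sqr_ge0.
have v2 : Num.sqrt (x ^+ 2 + y ^+ 2) ^+ 2 = x ^+ 2 + y ^+ 2 by rewrite sqr_sqrtr// addr_ge0 ?sqr_ge0.
have [|b [bp cb sb]] := @circle_polar (x / Num.sqrt (x ^+ 2 + y ^+ 2)) (y / Num.sqrt (x ^+ 2 + y ^+ 2)).
  by rewrite !exprMn !exprVn v2 -mulrDl divff.
exists (Num.sqrt (x ^+ 2 + y ^+ 2)), b; split=> //.
  by rewrite cb mulrC divfK// gt_eqF.
by rewrite sb mulrC divfK// gt_eqF.
Qed.

Lemma sphere_polar (y : 'rV[R]_3) : dot y y = 1 -> exists th ph,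
  [/\ 0 <= th <= pi, - pi <= ph <= pi, y 0 0 = cos th, y 0 1 = sin th * cos ph & y 0 2 = sin th * sin ph].
Proof.
rewrite dot3E => yy; have [v [ph [v0 php e1 e2]]] := plane_polar (y 0 1) (y 0 2).
have c1 := cos2Dsin2 ph.
have [|th [thp cth sth]] := @circle_polar (y 0 0) v.
  by lincomb (dif yy - (y 0 1 + v * cos ph) * dif e1 - (y 0 2 + v * sin ph) * dif e2 - v ^+ 2 * dif c1).
have [th0|th0] := leP 0 th.
  by exists th, ph; rewrite th0 cth sth; split=> //; case/andP: thp.
exists (- th), ph; rewrite cosN cth sinN sth.
have v00 : v = 0.
  apply/eqP; rewrite eq_le v0 andbT -sth -[th]opprK sinN oppr_le0 sin_ge0_pi//.
  by rewrite oppr_ge0 (ltW th0) lerNl; case/andP: thp.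
split=> //; rewrite ?v00 ?oppr0 ?e1 ?e2 ?v00 ?mul0r//.
by rewrite oppr_ge0 (ltW th0) lerNl; case/andP: thp.
Qed.

(** C and S are the cosine and sine of the angle alpha, which is constant along the bolt, and t is
    the fibre coordinate there; the last equations say over which point of the base the bolt
    lies. *)
Definition bolt_param (c u v C S t : R) : Prop :=
  [/\ 0 <= C, 0 <= S, C ^+ 2 + S ^+ 2 = 1, t * C = u & 0 < c + t ^+ 2 /\
      2 * (c + t ^+ 2) `^ (4^-1) * S = v].

Lemma powR4 (r : R) : 0 <= r -> r `^ (4^-1) ^+ 4 = r.
Proof.
by move=> r0; rewrite -powR_mulrn ?powR_ge0// -powRrM mulVf ?pnatr_eq0// powRr1.
Qed.

Lemma quartic_eq (r S v : R) : 0 <= r -> 0 <= S -> 0 <= v ->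
  2 * r `^ (4^-1) * S = v <-> r * S ^+ 4 = (v / 2) ^+ 4.
Proof.
move=> r0 S0 v0; have e : r * S ^+ 4 = (r `^ (4^-1) * S) ^+ 4 by rewrite exprMn powR4.
split=> [<-|]; first by rewrite e; field.
rewrite e => /eqP; rewrite eqrXn2 ?mulr_ge0 ?powR_ge0 ?invr_ge0// => /eqP h.
by rewrite -mulrA h; field.
Qed.

Lemma bolt_param_exists c u v : 0 <= c -> 0 <= v -> ~ (u = 0 /\ v = 2 * c `^ (4^-1)) ->
  exists C S t, bolt_param c u v C S t.
Proof.
move=> c0 v0 ns.
have V0 : 0 <= (v / 2) ^+ 4 by rewrite exprn_ge0// divr_ge0.
have [u0|u0] := eqVneq u 0.
  (* For u = 0 either t = 0 or C = 0: the bolt is a round sphere in the zero section of M, or a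
     sphere of radius t inside the fibre of M over a single point. *)
  have [Vc|cV] := leP ((v / 2) ^+ 4) c.
    have cp : 0 < c.
      rewrite lt_neqAle c0 andbT; apply/eqP => ce; apply: ns; split=> //.
      move: Vc; rewrite -ce => Vc; have /eqP : (v / 2) ^+ 4 = 0 by apply/eqP; rewrite eq_le Vc V0.
      rewrite expf_eq0 /= mulf_eq0 invr_eq0 pnatr_eq0 orbF => /eqP ->.
      by rewrite powR0 ?mulr0// invr_eq0 pnatr_eq0.
    have q0 : 0 < c `^ (4^-1) by exact: powR_gt0.
    pose S := v / (2 * c `^ (4^-1)).
    have S0 : 0 <= S by rewrite divr_ge0// mulr_ge0// ltW.
    have Sv : 2 * c `^ (4^-1) * S = v.
      by rewrite /S mulrC divfK// mulf_neq0 ?pnatr_eq0// gt_eqF.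
    have S1 : S <= 1.
      rewrite -(@expr_le1 _ 4)// -(@ler_pM2l _ c)// mulr1.
      by rewrite ((quartic_eq c0 S0 v0).1 Sv).
    have S2 : S ^+ 2 <= 1 by rewrite expr_le1.
    exists (Num.sqrt (1 - S ^+ 2)), S, 0; split=> //.
    - by rewrite sqr_sqrtr ?subr_ge0// subrK.
    - by rewrite mul0r.
    - by rewrite expr0n addr0.
  exists 0, 1, (Num.sqrt ((v / 2) ^+ 4 - c)); split=> //.
  - by rewrite expr0n expr1n add0r.
  - by rewrite mulr0.
  - have e : c + Num.sqrt ((v / 2) ^+ 4 - c) ^+ 2 = (v / 2) ^+ 4.
      by rewrite sqr_sqrtr ?subr_ge0 ?(ltW cV)// addrC subrK.
    rewrite e; split; first exact: le_lt_trans cV.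
    by apply/quartic_eq => //; rewrite expr1n mulr1.
pose V := (v / 2) ^+ 4.
(* For u <> 0 one has t = u / C, and with q = C^2 the equation (c + t^2) S^4 = (v/2)^4 takes this
   polynomial form. The sign makes p(0) <= 0 <= p(1), as the intermediate value theorem expects. *)
pose p : {poly R} := - ((c%:P * 'X + (u ^+ 2)%:P) * (1 - 'X) ^+ 2 - V%:P * 'X).
have pE q : p.[q] = - ((c * q + u ^+ 2) * (1 - q) ^+ 2 - V * q) by rewrite /p !hornerE.
have [|q /andP[q0 q1] /rootP] := @poly_ivt R p 0 1 ler01.
  rewrite !pE; apply/andP; split.
    have -> : - ((c * 0 + u ^+ 2) * (1 - 0) ^+ 2 - V * 0) = - u ^+ 2 by ring.
    by rewrite oppr_le0 sqr_ge0.
  by have -> : - ((c * 1 + u ^+ 2) * (1 - 1) ^+ 2 - V * 1) = V by ring.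
rewrite pE => eq0.
have qp : 0 < q.
  rewrite lt_neqAle q0 andbT; apply/eqP => qe; move: eq0; rewrite -qe => eq0.
  have /eqP : u ^+ 2 = 0 by lincomb (- dif eq0).
  by rewrite expf_eq0 (negPf u0).
have sq : Num.sqrt q ^+ 2 = q by rewrite sqr_sqrtr.
have sq0 : 0 < Num.sqrt q by rewrite sqrtr_gt0.
have s1q : Num.sqrt (1 - q) ^+ 2 = 1 - q by rewrite sqr_sqrtr// subr_ge0.
have t2 : (u / Num.sqrt q) ^+ 2 = u ^+ 2 / q by rewrite exprMn exprVn sq.
have tp : 0 < u ^+ 2 / q by rewrite divr_gt0// lt_neqAle eq_sym expf_neq0// sqr_ge0.
have rp : 0 < c + u ^+ 2 / q by rewrite ltr_wpDl.
exists (Num.sqrt q), (Num.sqrt (1 - q)), (u / Num.sqrt q); split.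
- exact: ltW.
- exact: sqrtr_ge0.
- by rewrite sq s1q; ring.
- by rewrite divfK// gt_eqF.
rewrite t2; split=> //; apply/quartic_eq => //; first exact: ltW.
rewrite -/V (_ : Num.sqrt (1 - q) ^+ 4 = (1 - q) ^+ 2); last by rewrite -[X in _ = X ^+ 2]s1q; ring.
apply: (mulfI (lt0r_neq0 qp)).
rewrite (_ : q * (_ * _) = (c * q + u ^+ 2) * (1 - q) ^+ 2); last by field; exact: lt0r_neq0.
lincomb (- dif eq0).
Qed.

(** Eliminating V gives a sum of c q1 q2 ((1 - q1)^2 - (1 - q2)^2) and u^2 (q2 (1 - q1)^2 - q1 (1 -
    q2)^2). Since q1 < q2 <= 1, c q1 and u^2 have positive cofactors, so both vanish. *)
Lemma bolt_param_lt (c u V q1 q2 : R) : 0 <= c -> 0 <= q1 -> q1 < q2 -> q2 <= 1 ->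
  (c * q1 + u ^+ 2) * (1 - q1) ^+ 2 = V * q1 -> (c * q2 + u ^+ 2) * (1 - q2) ^+ 2 = V * q2 ->
  u = 0 /\ c * q1 = 0.
Proof.
move=> c0 q10 q12 q21 e1 e2; have q20 : 0 < q2 by exact: le_lt_trans q12.
have h : c * q1 * (q2 * ((q2 - q1) * ((1 - q1) + (1 - q2)))) +
    u ^+ 2 * ((q2 - q1) * (1 - q1) ^+ 2 + q1 * ((q2 - q1) * ((1 - q1) + (1 - q2)))) = 0.
  lincomb (q2 * dif e1 - q1 * dif e2).
have d0 : 0 < q2 - q1 by rewrite subr_gt0.
have a0 : 0 < 1 - q1 by rewrite subr_gt0; exact: lt_le_trans q12 q21.
have b0 : 0 <= 1 - q2 by rewrite subr_ge0.
have ab : 0 < (q2 - q1) * ((1 - q1) + (1 - q2)) by rewrite mulr_gt0// ltr_pwDl.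
have B0 : 0 < (q2 - q1) * (1 - q1) ^+ 2 + q1 * ((q2 - q1) * ((1 - q1) + (1 - q2))).
  by rewrite ltr_pwDl ?mulr_gt0 ?exprn_gt0// mulr_ge0// ltW.
have A0 : 0 < q2 * ((q2 - q1) * ((1 - q1) + (1 - q2))) by rewrite mulr_gt0.
move: h => /eqP; rewrite paddr_eq0; last 2 first.
- by apply: mulr_ge0 (ltW A0); exact: mulr_ge0.
- by apply: mulr_ge0 (ltW B0); exact: sqr_ge0.
rewrite [_ * _ == 0]mulf_eq0 (gt_eqF A0) orbF [u ^+ 2 * _ == 0]mulf_eq0 (gt_eqF B0) orbF expf_eq0 /=.
by move=> /andP[/eqP -> /eqP ->].
Qed.

(** If C1 < C2, then u = 0 and c C1 = 0, so t2 = 0, c > 0, C1 = 0 and S1 = 1. Comparing the quartic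
    equations gives c + t1^2 = c S2^4 <= c, hence t1 = 0: the first solution sits over the excluded
    point. *)
Lemma bolt_param_le c u v C1 S1 t1 C2 S2 t2 : 0 <= c -> 0 <= v ->
  ~ (u = 0 /\ v = 2 * c `^ (4^-1)) ->
  bolt_param c u v C1 S1 t1 -> bolt_param c u v C2 S2 t2 -> C2 <= C1.
Proof.
move=> c0 v0 ns [C10 S10 CS1 tC1 [r1 /[dup] e1' /(quartic_eq (ltW r1) S10 v0) e1]].
move=> [C20 S20 CS2 tC2 [r2 /(quartic_eq (ltW r2) S20 v0) e2]].
rewrite leNgt; apply/negP => C12.
have s1 : S1 ^+ 2 = 1 - C1 ^+ 2 by rewrite -CS1; ring.
have s2 : S2 ^+ 2 = 1 - C2 ^+ 2 by rewrite -CS2; ring.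
have q12 : C1 ^+ 2 < C2 ^+ 2 by rewrite ltrXn2r.
have [|||u0 /eqP] := @bolt_param_lt c u ((v / 2) ^+ 4) _ _ c0 (sqr_ge0 C1) q12.
- by rewrite -subr_ge0 -s2 sqr_ge0.
- by rewrite -s1 -tC1 -e1; ring.
- by rewrite -s2 -tC2 -e2; ring.
rewrite mulf_eq0 expf_eq0 /= => cC1.
have C2p : 0 < C2 by exact: le_lt_trans C12.
have t20 : t2 = 0 by apply: (mulIf (lt0r_neq0 C2p)); rewrite tC2 u0 mul0r.
rewrite t20 expr0n addr0 in r2 e2; rewrite (gt_eqF r2) /= in cC1.
have S11 : S1 = 1 by apply/eqP; rewrite -(@eqrXn2 _ 2)// s1 (eqP cC1) expr0n subr0 expr1n.
have S21 : S2 ^+ 2 <= 1 by rewrite s2 lerBlDr lerDl sqr_ge0.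
have t10 : t1 = 0.
  apply/eqP; rewrite -sqrf_eq0 eq_le sqr_ge0 andbT -(lerD2l c) addr0.
  move: e1; rewrite S11 expr1n mulr1 => ->; rewrite -e2.
  by rewrite ler_piMr// (exprM S2 2 2) expr_le1// sqr_ge0.
apply: ns; split=> //.
by rewrite -e1' S11 t10 mulr1 expr0n addr0.
Qed.

Lemma bolt_param_uniq c u v C1 S1 t1 C2 S2 t2 : 0 <= c -> 0 <= v ->
  ~ (u = 0 /\ v = 2 * c `^ (4^-1)) ->
  bolt_param c u v C1 S1 t1 -> bolt_param c u v C2 S2 t2 ->
  [/\ C1 = C2, S1 = S2 & t1 = t2 \/ C1 = 0 /\ t1 = - t2].
Proof.
move=> c0 v0 ns P1 P2.
have CC : C1 = C2.
  by apply/eqP; rewrite eq_le (bolt_param_le c0 v0 ns P1 P2) (bolt_param_le c0 v0 ns P2 P1).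
move: P1 P2 => [C10 S10 CS1 tC1 [r1 /(quartic_eq (ltW r1) S10 v0) e1]].
move=> [C20 S20 CS2 tC2 [r2 /(quartic_eq (ltW r2) S20 v0) e2]].
have SS : S1 = S2.
  by apply/eqP; rewrite -(@eqrXn2 _ 2)//; apply/eqP; lincomb (dif CS1 - dif CS2 - (C1 + C2) * dif CC).
split=> //; have [C0|C0] := eqVneq C1 0; last first.
  by left; apply: (mulIf C0); rewrite tC1 CC tC2.
have S21 : S2 ^+ 2 = 1 by rewrite -SS -CS1 C0 expr0n add0r.
have : t1 ^+ 2 == t2 ^+ 2.
  apply/eqP; move: e1; rewrite SS -e2 (exprM S2 2 2) S21 expr1n !mulr1; exact: addrI.
by rewrite eqf_sqr => /orP[/eqP|/eqP]; [left|right].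
Qed.
End Bolt.

(** * The bolt as an embedded sphere *)

Section BoltImage.
Context {R : realType}.
Local Notation E := ('rV[R]_5 * 'M[R]_5)%type.
Local Notation nonsing c u v := (~ (u = 0 /\ v = 2 * c `^ (4^-1))).
Implicit Types (c u v b C S t : R).

(** The three entries are a cross x, in the first three components. Either s = 0 and the form is t
    Omega_1, or cos(alpha) = 0 and these components of x vanish. This describes the bolt without the
    chart, which degenerates there. *)
Lemma bolt_cross c u v b (p : E) : bolt c (base u v b) p ->
  [/\ (Phi b p).2 0 3 = 0, (Phi b p).2 1 3 = 0 & (Phi b p).2 2 3 = 0].
Proof.
move=> [fp [xi [pE _ _ /eqP]]]; rewrite /rho_ mulf_eq0.
have [_ [h d y4 _ _]] := fibre_fibC fp.
move=> /orP[/eqP s0|/eqP ca0].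
  have [A PE] := Phi_chart b xi; have sD := y4; rewrite pE PE mxE /= in sD.
  rewrite pE !chart_entries /wedge_entry !mxE /= s0; split.
  - lincomb (t_ xi * cos (theta_ xi) * dif sD).
  - lincomb (t_ xi * (sin (theta_ xi) * cos (phi_ xi)) * dif sD).
  - lincomb (t_ xi * (sin (theta_ xi) * sin (phi_ xi)) * dif sD).
have [_ [-> -> ->]] := asd_entries h d y4.
have [A PE] := Phi_chart b xi.
have [-> -> ->] : [/\ (Phi b p).1 0 0 = 0, (Phi b p).1 0 1 = 0 & (Phi b p).1 0 2 = 0].
  by rewrite pE PE /= !mxE /= ca0 !mul0r.
by split; ring.
Qed.

Lemma Phi_inj b : injective (@Phi R b).
Proof. exact: can_inj (@PhiK R b). Qed.

Lemma row3P (x y : 'rV[R]_3) : x 0 0 = y 0 0 -> x 0 1 = y 0 1 -> x 0 2 = y 0 2 -> x = y.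
Proof.
move=> h0 h1 h2; apply/rowP => i; have : i \in [:: 0; 1; 2] by case: i => -[|[|[|]]].
by rewrite !inE => /orP[/eqP->|/orP[/eqP->|/eqP->]].
Qed.

(** The first three components of a and x are parallel. If those of x do not vanish, their norm is
    C, their direction n, and x . a = 0 fixes those of a; otherwise C = 0, S = 1 and a supplies both
    t and n. *)
Lemma cross_iota c u v b (p : E) : 0 <= c -> 0 <= v -> nonsing c u v ->
  fibre c (base u v b) p ->
  (Phi b p).2 0 3 = 0 -> (Phi b p).2 1 3 = 0 -> (Phi b p).2 2 3 = 0 ->
  exists C S t n, [/\ bolt_param c u v C S t, S2 n & p = iota_pt b C S t n].
Proof.
move=> c0 v0 ns fp q0 q1 q2.
have [r [h d y4 yu [qp q4 qv]]] := fibre_fibC fp.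
have qE : quarter c p = (c + rsq p.2) `^ (4^-1) by [].
have [yE H1 H2 rE] := asd_coord h d y4.
have [_ [k0 k1 k2]] := asd_entries h d y4.
rewrite rsq_Phi in rE; move: qv; rewrite qE rE.
move: r; rewrite rE.
rewrite q0 in k0; rewrite q1 in k1; rewrite q2 in k2.
move: k0 k1 k2 H1 H2 yE; rewrite yu.
move: ((Phi b p).1 0 0) ((Phi b p).1 0 1) ((Phi b p).1 0 2) ((Phi b p).1 0 3).
move: ((Phi b p).2 0 4) ((Phi b p).2 1 4) ((Phi b p).2 2 4).
move=> a0 a1 a2 x0 x1 x2 m k0 k1 k2 H1 H2 yE rp mv.
have m0 : 0 <= m.
  rewrite -(@pmulr_rge0 _ (2 * (c + (a0 ^+ 2 + a1 ^+ 2 + a2 ^+ 2 + u ^+ 2)) `^ 4^-1)) ?mv//.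
  by rewrite mulr_gt0// powR_gt0.
have X0 : 0 <= x0 ^+ 2 + x1 ^+ 2 + x2 ^+ 2 by rewrite !addr_ge0 ?sqr_ge0.
have [Xz|Xn] := eqVneq (x0 ^+ 2 + x1 ^+ 2 + x2 ^+ 2) 0.
  have [x00 x10 x20] : [/\ x0 = 0, x1 = 0 & x2 = 0].
    move: Xz => /eqP; rewrite paddr_eq0 ?addr_ge0 ?sqr_ge0// paddr_eq0 ?sqr_ge0// !expf_eq0 /=.
    by move=> /andP[/andP[/eqP -> /eqP ->] /eqP ->].
  have m1 : m = 1.
    by apply/eqP; rewrite -(@eqrXn2 _ 2)// expr1n; apply/eqP; lincomb (dif H1 - dif Xz).
  have u0 : u = 0 by rewrite -H2 x00 x10 x20 m1; ring.
  have A0 : 0 <= a0 ^+ 2 + a1 ^+ 2 + a2 ^+ 2 by rewrite !addr_ge0 ?sqr_ge0.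
  have t2 : Num.sqrt (a0 ^+ 2 + a1 ^+ 2 + a2 ^+ 2) ^+ 2 = a0 ^+ 2 + a1 ^+ 2 + a2 ^+ 2 by rewrite sqr_sqrtr.
  move: mv rp yE; rewrite m1 u0 x00 x10 x20 expr0n addr0 mulr1 => mv rp yE.
  have [Az|An] := eqVneq (a0 ^+ 2 + a1 ^+ 2 + a2 ^+ 2) 0.
    by case: ns; rewrite u0 -mv Az addr0.
  have tn : Num.sqrt (a0 ^+ 2 + a1 ^+ 2 + a2 ^+ 2) != 0 by rewrite gt_eqF// sqrtr_gt0 lt_neqAle eq_sym An.
  pose t := Num.sqrt (a0 ^+ 2 + a1 ^+ 2 + a2 ^+ 2).
  (* For C = 0 and S = 1 the parametrisation has a = - t n, hence the sign. *)
  exists 0, 1, t, (\row_(j < 3) nth 0 [:: - a0 / t; - a1 / t; - a2 / t] j); split.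
  - split=> //; [by rewrite expr0n expr1n add0r|by rewrite mulr0|].
    by rewrite /t t2; split=> //; rewrite mulr1.
  - rewrite /S2 /= dot3E !mxE /= /t; apply: (mulfI An); rewrite -{1}t2; rewrite -/t in tn t2 *.
    rewrite mulr1 -t2; rewrite [RHS]t2; by field.
  - apply: (@Phi_inj b); rewrite Phi_iota; last by ring.
    rewrite yE !mxE /= -/t in tn *; congr emb; rewrite /t; by field.
have C2 : Num.sqrt (x0 ^+ 2 + x1 ^+ 2 + x2 ^+ 2) ^+ 2 = x0 ^+ 2 + x1 ^+ 2 + x2 ^+ 2 by rewrite sqr_sqrtr.
have Cn : Num.sqrt (x0 ^+ 2 + x1 ^+ 2 + x2 ^+ 2) != 0 by rewrite gt_eqF// sqrtr_gt0 lt_neqAle eq_sym Xn.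
have C0 := sqrtr_ge0 (x0 ^+ 2 + x1 ^+ 2 + x2 ^+ 2).
move: (Num.sqrt _) C2 Cn C0 => C C2 Cn C0.
have CS : C ^+ 2 + m ^+ 2 = 1 by rewrite C2.
have par (x a w : R) : C ^+ 2 * a = - m * u * x -> a = - (u / C) * m * (x / C).
  by move=> e; apply: (mulfI (expf_neq0 2 Cn)); rewrite e; field.
have E0 : a0 = - (u / C) * m * (x0 / C).
  apply: par => //; lincomb (a0 * dif C2 + x0 * dif H2 - x1 * dif k2 + x2 * dif k1).
have E1 : a1 = - (u / C) * m * (x1 / C).
  apply: par => //; lincomb (a1 * dif C2 + x1 * dif H2 + x0 * dif k2 - x2 * dif k0).
have E2 : a2 = - (u / C) * m * (x2 / C).
  apply: par => //; lincomb (a2 * dif C2 + x2 * dif H2 - x0 * dif k1 + x1 * dif k0).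
have tE : a0 ^+ 2 + a1 ^+ 2 + a2 ^+ 2 + u ^+ 2 = (u / C) ^+ 2.
  apply: (mulfI (expf_neq0 4 Cn)).
  have -> : C ^+ 4 * (u / C) ^+ 2 = u ^+ 2 * C ^+ 2 by field.
  have -> : C ^+ 4 * (a0 ^+ 2 + a1 ^+ 2 + a2 ^+ 2 + u ^+ 2) = u ^+ 2 * m ^+ 2 * (x0 ^+ 2 + x1 ^+ 2 + x2 ^+ 2) + C ^+ 4 * u ^+ 2.
    by rewrite E0 E1 E2; field.
  lincomb (u ^+ 2 * C ^+ 2 * dif CS - u ^+ 2 * m ^+ 2 * dif C2).
exists C, m, (u / C), (\row_(j < 3) nth 0 [:: x0 / C; x1 / C; x2 / C] j); split.
- by split=> //; [rewrite divfK|rewrite -tE].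
- rewrite /S2 /= dot3E !mxE /=; apply: (mulfI (expf_neq0 2 Cn)).
  by rewrite mulr1 [RHS]C2; field.
- apply: (@Phi_inj b); rewrite Phi_iota//.
  by rewrite yE !mxE /= -E0 -E1 -E2; congr emb; field.
Qed.

Lemma iota_chart b C S t y : 0 <= C -> 0 <= S -> C ^+ 2 + S ^+ 2 = 1 -> S2 y ->
  exists xi, [/\ iota_pt b C S t y = chart xi, 0 <= alpha_ xi <= pi / 2, 0 <= s_ xi & rho_ xi = 0].
Proof.
move=> C0 S0 CS /sphere_polar[th [ph [_ _ y0 y1 y2]]].
have C1 : C <= 1 by rewrite -(@expr_le1 _ 2)// -CS lerDl sqr_ge0.
have Cb : - 1 <= C <= 1 by rewrite C1 andbT (le_trans _ C0)// lerN10.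
have cE : cos (acos C) = C by rewrite acosK.
have sE : sin (acos C) = S.
  by rewrite sin_acos// (_ : 1 - C ^+ 2 = S ^+ 2) ?sqrtr_sqr ?ger0_norm// -CS; ring.
pose xi : 'rV[R]_7 := \row_(j < 7) nth 0 [:: acos C; b; th; ph; t; 0; 0] j.
have [a1 a2 a3 a4] : [/\ alpha_ xi = acos C, beta_ xi = b, theta_ xi = th & phi_ xi = ph].
  by rewrite /alpha_ /beta_ /theta_ /phi_ !mxE.
have [a5 a6 a7] : [/\ t_ xi = t, s_ xi = 0 & gamma_ xi = 0] by rewrite /t_ /s_ /gamma_ !mxE.
exists xi; rewrite /rho_ a1 a6 mul0r lexx; split=> //; last first.
  rewrite acos_ge0//= leNgt; apply/negP => h.
  have : cos (acos C) < 0.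
    rewrite -(cos_pihalf R) ltr_cos//; rewrite in_itv /= ?divr_ge0 ?pi_ge0//= ?acos_ge0 ?acos_lepi//.
    by rewrite ler_pdivrMr// ler_peMr ?pi_ge0// ler1n.
  by rewrite cE ltNge C0.
apply: (@Phi_inj b); rewrite Phi_iota// y0 y1 y2.
have [A PE] := Phi_chart b xi; have P1 := congr1 fst PE.
have b1 : cos b * cos b + sin b * sin b = 1 by rewrite -!expr2 cos2Dsin2.
have b0 : - sin b * cos b + cos b * sin b = 0 by ring.
rewrite /= a1 a2 a3 a4 b1 b0 cE sE in P1.
rewrite [RHS]surjective_pairing; apply/pair_equal_spec; split.
  rewrite [RHS]P1.
  by apply/rowP => i; rewrite !mxE; elim/ord5P: i; rewrite /=; ring.
have c1 : cos th ^+ 2 = 1 - sin th ^+ 2 by rewrite cos2sin2.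
have c2 : cos ph ^+ 2 = 1 - sin ph ^+ 2 by rewrite cos2sin2.
have c3 : C ^+ 2 = 1 - S ^+ 2 by rewrite -CS; ring.
apply/matrixP => i j; rewrite chart_entries a1 a2 a3 a4 a5 a6 a7 cE sE b1 b0.
rewrite mul0r /wedge_entry !mxE; elim/ord5P: i; elim/ord5P: j; rewrite /=.
all: ring: c1 c2 c3.
Qed.

Lemma bolt_iota c u v b C S t : 0 <= c -> 0 <= v -> nonsing c u v ->
  bolt_param c u v C S t -> bolt c (base u v b) = iota_pt b C S t @` S2.
Proof.
move=> c0 v0 ns P; have [C0 S0 CS tC [rp Sv]] := P; apply/seteqP; split=> p.
  move=> /[dup] /bolt_cross[q0 q1 q2] [fp _].
  have [C' [S' [t' [n [P' Sn ->]]]]] := cross_iota c0 v0 ns fp q0 q1 q2.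
  have [<- <- [->|[Cz ->]]] := bolt_param_uniq c0 v0 ns P' P; first by exists n.
  have [_ _ CS' _ _] := P'.
  (* When C = 0 only the product t n enters, so a change of sign of t is absorbed by the antipodal
     map. *)
  exists (- n); first by move: Sn; rewrite /S2 /= !dot3E !mxE => <-; ring.
  apply: (@Phi_inj b); rewrite !Phi_iota// Cz !mxE; congr emb; ring.
move=> [y Sy <-]; split; first exact: iota_fibre.
exact: iota_chart.
Qed.

End BoltImage.

(** * Collapse *)

Section Collapse.
Context {R : realType}.
Local Notation E := ('rV[R]_5 * 'M[R]_5)%type.
Implicit Types (c u v b C S t : R).

Lemma singular_base c b : singular c (base 0 (2 * c `^ (4^-1)) b).
Proof. by exists b. Qed.

Lemma bolt_SLag c u v b : 0 <= c -> 0 <= v -> ~ singular c (base u v b) ->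
  SLag_in_fibre c u v b (bolt c (base u v b)).
Proof.
move=> c0 v0 nsing; have ns : ~ (u = 0 /\ v = 2 * c `^ (4^-1)).
  by move=> [u0 v1]; apply: nsing; rewrite u0 v1; exact: singular_base.
have [C [S [t P]]] := bolt_param_exists c0 v0 ns; have [C0 S0 CS tC [rp Sv]] := P.
have [k0 i0] := bolt_kap_neq0 CS tC rp Sv S0 ns.
exists (su2 c b (bolt_k1 C S t c) (bolt_k2 C S t c)); split.
- by apply: su2_is_structure => //; exact: bolt_k_neq0.
- exact: natural_su2.
exists (iota_pt b C S t); split; last exact: (iota_SL _ CS).
split; [exact: smooth_iota| | |by rewrite (bolt_iota b c0 v0 ns P)].
- by move=> y y' _ _ /addrI; exact: iota_inj.
- move=> y X _ _; rewrite diff_iota => X0; apply: (@iota_inj _ b C S t) => //.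
  by rewrite X0 -[RHS]addr0 /iota_tan !mxE !scale0r !addr0.
Qed.


Lemma is_derive_affine_at (l a a' : R) : is_derive (l : R^o) (1 : R^o) (fun h : R^o => h * a' + a : R^o) a'.
Proof. by apply: is_derive_eq; rewrite /GRing.scale/=; ring. Qed.

Lemma is_derive_cos_at (l a a' : R) :
  is_derive (l : R^o) (1 : R^o) (fun h : R^o => cos (h * a' + a) : R^o) (- sin (l * a' + a) * a').
Proof.
exact: (@is_derive1_comp R cos (fun h => h * a' + a) l _ _ (is_derive_cos _) (is_derive_affine_at l a a')).
Qed.

Lemma is_derive_sin_at (l a a' : R) :
  is_derive (l : R^o) (1 : R^o) (fun h : R^o => sin (h * a' + a) : R^o) (cos (l * a' + a) * a').
Proof.
exact: (@is_derive1_comp R sin (fun h => h * a' + a) l _ _ (is_derive_sin _) (is_derive_affine_at l a a')).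
Qed.

Lemma is_derive_mx {m n} (M : R^o -> 'M[R]_(m, n)) (D : 'M[R]_(m, n)) l :
  (forall i j, is_derive l (1 : R^o) (fun x => M x i j : R^o) (D i j)) -> is_derive l (1 : R^o) M D.
Proof.
move=> dM; have dm : derivable M l 1 by apply/derivable_mxP => i j; have [] := dM i j.
split=> //; rewrite derive_mx//; apply/matrixP => i j; rewrite mxE.
exact: (@derive_val _ _ _ _ _ _ _ (dM i j)).
Qed.

Definition sph_diff (th ph a d : R) : 'rV[R]_3 :=
  \row_(j < 3) nth 0 [:: - sin th * a; cos th * a * cos ph - sin th * sin ph * d;
                         cos th * a * sin ph + sin th * cos ph * d] j.

Lemma is_derive_sph (th ph a d l : R) :
  is_derive (l : R^o) (1 : R^o) (fun x : R^o => sph (x * a + th) (x * d + ph))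
    (sph_diff (l * a + th) (l * d + ph) a d).
Proof.
have d1 := is_derive_cos_at l th a; have d2 := is_derive_sin_at l th a.
have d3 := is_derive_cos_at l ph d; have d4 := is_derive_sin_at l ph d.
apply: is_derive_mx => i j; rewrite (ord1 i) mxE; under eq_fun do rewrite mxE.
have : j \in [:: 0; 1; 2] by case: j => -[|[|[|]]].
rewrite !inE => /orP[/eqP->|/orP[/eqP->|/eqP->]] //=.
- by apply: is_derive_eq; rewrite /GRing.scale /=; ring.
- by apply: is_derive_eq; rewrite /GRing.scale /=; ring.
Qed.

Lemma sph_S2 (th ph : R) : S2 (sph th ph).
Proof.
rewrite /S2 /= dot3E !mxE /=.
have c1 : cos th ^+ 2 = 1 - sin th ^+ 2 by rewrite cos2sin2.
have c2 : cos ph ^+ 2 = 1 - sin ph ^+ 2 by rewrite cos2sin2.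
ring: c1 c2.
Qed.

Lemma dot_sph_diff (th ph a d : R) : dot (sph th ph) (sph_diff th ph a d) = 0.
Proof.
rewrite dot3E !mxE /=.
have c2 : cos ph ^+ 2 = 1 - sin ph ^+ 2 by rewrite cos2sin2.
ring: c2.
Qed.

Lemma dot_sph_diff2 (th ph a d : R) :
  dot (sph_diff th ph a d) (sph_diff th ph a d) = a ^+ 2 + sin th ^+ 2 * d ^+ 2.
Proof.
rewrite dot3E !mxE /=.
have c1 : cos th ^+ 2 = 1 - sin th ^+ 2 by rewrite cos2sin2.
have c2 : cos ph ^+ 2 = 1 - sin ph ^+ 2 by rewrite cos2sin2.
ring: c1 c2.
Qed.

Lemma is_derive_iota b C S t (n : R^o -> 'rV[R]_3) (l : R^o) n' :
  is_derive l (1 : R^o) n n' -> is_derive l (1 : R^o) (iota_pt b C S t \o n) (iota_tan b C S t n').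
Proof.
move=> [dn dn']; have dn1 : differentiable n l by apply/derivable1_diffP.
have di : differentiable (iota_pt b C S t) (n l).
  exact: (smooth_differentiable (@smooth_iota _ b C S t) I).
have dc := differentiable_comp dn1 di.
split; first exact/derivable1_diffP.
by rewrite deriveE// diff_comp//= diff_iota -dn' deriveE.
Qed.

(* The metric on the bolt is this multiple of the round metric. *)
Definition bolt_factor c t S C : R :=
  (c + t ^+ 2) `^ (- 2^-1) * t ^+ 2 * S ^+ 2 + 2 * (c + t ^+ 2) `^ (2^-1) * C ^+ 2.

(** The path is affine in the polar angles of the sphere. Its squared speed is [bolt_factor] times
    dtheta^2 + sin(theta)^2 dphi^2, which the ranges of the angles bound uniformly. *)
Lemma bolt_path c u v b C S t (K : R) : 0 <= c -> 0 <= v -> ~ (u = 0 /\ v = 2 * c `^ (4^-1)) ->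
  bolt_param c u v C S t -> bolt_factor c t S C * (5 * pi ^+ 2) < K ->
  forall p q, bolt c (base u v b) p -> bolt c (base u v b) q -> exists h : R -> E,
    [/\ h 0 = p, h 1 = q &
        forall l, 0 <= l <= 1 ->
          [/\ bolt c (base u v b) (h l), derivable h l 1 &
              forall e, oframe (h l).1 e -> gBS c e (h l) ('D_1 h l) ('D_1 h l) < K]].
Proof.
move=> c0 v0 ns P GK p q; rewrite (bolt_iota b c0 v0 ns P) => -[y Sy <-] [y' Sy' <-].
have [C0 S0 CS tC [rp Sv]] := P.
have [th [ph [/andP[th0 th1] /andP[ph0 ph1] e0 e1 e2]]] := sphere_polar Sy.
have [th' [ph' [/andP[th0' th1'] /andP[ph0' ph1'] e0' e1' e2']]] := sphere_polar Sy'.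
have yE : y = sph th ph by apply: row3P; rewrite !mxE.
have yE' : y' = sph th' ph' by apply: row3P; rewrite !mxE.
pose n (x : R^o) := sph (x * (th' - th) + th) (x * (ph' - ph) + ph).
exists (iota_pt b C S t \o n); rewrite /= /n !mul0r !add0r !mul1r !subrK -yE -yE'; split=> // l l01.
have dh := is_derive_iota b C S t (is_derive_sph th ph (th' - th) (ph' - ph) l).
have [d1 d2] := dh; split=> //; first by exists (n l) => //; exact: sph_S2.
move=> e fr; rewrite d2 /=.
have ny := sph_S2 (l * (th' - th) + th) (l * (ph' - ph) + ph).
have nd := dot_sph_diff (l * (th' - th) + th) (l * (ph' - ph) + ph) (th' - th) (ph' - ph).
have T := iota_tanN b CS tC rp Sv ny nd.
rewrite (gBS_fibre (iota_fibre b CS tC rp Sv ny) fr T T) iota_metr// -/(bolt_factor c t S C) dot_sph_diff2.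
apply: le_lt_trans GK; apply: ler_wpM2l.
  apply: addr_ge0; (apply: mulr_ge0; last exact: sqr_ge0).
    by apply: mulr_ge0; [exact: powR_ge0|exact: sqr_ge0].
  by apply: mulr_ge0 => //; exact: powR_ge0.
have s1 : sin (l * (th' - th) + th) ^+ 2 <= 1.
  by rewrite -(cos2Dsin2 (l * (th' - th) + th)) lerDr sqr_ge0.
have sqb (x A : R) : - A <= x <= A -> x ^+ 2 <= A ^+ 2.
  move=> /andP[a1 a2]; rewrite -subr_ge0 subr_sqr mulr_ge0//; lra.
have h1 : (th' - th) ^+ 2 <= pi ^+ 2 by apply: sqb; lra.
have h2 : (ph' - ph) ^+ 2 <= (2 * pi) ^+ 2 by apply: sqb; lra.
(* Differences of angles are at most pi for theta and 2 pi for phi, and sin^2 is at most 1. *)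
have -> : 5 * pi ^+ 2 = pi ^+ 2 + 1 * (2 * pi) ^+ 2 :> R by ring.
by apply: lerD => //; apply: ler_pM; rewrite ?sqr_ge0.
Qed.
End Collapse.

(** * Limits at the singular fibres *)

Section Limit.
Context {R : realType}.
Local Notation E := ('rV[R]_5 * 'M[R]_5)%type.
Implicit Types (c u v b C S t : R).

(** Fourth roots and S are eliminated in favour of w = (c + t^2)^(1/2) and q = C^2, so that the
    estimates concern polynomials and w^-1 only. *)
Lemma bolt_param_root c u v C S t : 0 <= v -> bolt_param c u v C S t ->
  exists w, let q := C ^+ 2 in
  [/\ 0 < w, w ^+ 2 = c + t ^+ 2, u ^+ 2 = t ^+ 2 * q,
      w ^+ 2 * (1 - q) ^+ 2 = (v / 2) ^+ 4 &
      0 <= q <= 1 /\ bolt_factor c t S C = w^-1 * t ^+ 2 * (1 - q) + 2 * w * q].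
Proof.
move=> v0 [C0 S0 CS tC [rp /(quartic_eq (ltW rp) S0 v0) e]].
have SE : S ^+ 2 = 1 - C ^+ 2 by rewrite -CS; ring.
have w2 : (c + t ^+ 2) `^ (2^-1) ^+ 2 = c + t ^+ 2.
  by rewrite powR12_sqrt ?(ltW rp)// sqr_sqrtr// ltW.
exists ((c + t ^+ 2) `^ (2^-1)) => /=; rewrite w2 -tC -e -SE; split=> //.
- exact: powR_gt0.
- by rewrite exprMn.
- by rewrite -exprM.
- split; last by rewrite /bolt_factor powRN.
  by rewrite sqr_ge0 -subr_ge0 -SE sqr_ge0.
Qed.

(** Nearness is measured by u^2 + |(v/2)^4 - c|, which for v >= 0 vanishes exactly at the singular
    values and is free of the implicitly given C, S, t. *)
Lemma bolt_estimate c (eps : R) : 0 <= c -> 0 < eps -> exists2 d : R, 0 < d &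
  forall u v C S t, 0 <= v -> bolt_param c u v C S t ->
    u ^+ 2 + `|(v / 2) ^+ 4 - c| < d -> bolt_factor c t S C < eps.
Proof.
move=> c0 e0; have [cz|cn] := eqVneq c 0.
  exists ((eps / 4) ^+ 2) => [|u v C S t v0 /(bolt_param_root v0)]; first by rewrite exprn_gt0// divr_gt0.
  move=> [w [w0 w2 u2 wV [/andP[q0 q1] ->]]].
  have V0 : 0 <= (v / 2) ^+ 4 by rewrite -wV mulr_ge0 ?sqr_ge0.
  rewrite cz subr0 ger0_norm// u2 -wV w2 cz add0r => small.
  have t2 : t ^+ 2 = w ^+ 2 by rewrite w2 cz add0r.
  rewrite t2 expr2 mulKf ?gt_eqF//; rewrite t2 in small.
  move: (C ^+ 2) q0 q1 small => q q0 q1 small {u2 wV w2 t2 V0}.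
  (* Here t^2 = w^2, so the small quantity is w^2 (q + (1 - q)^2), whose second factor is at least
     1/4, and the metric factor is w (1 + q) <= 2 w. *)
  have w4 : w ^+ 2 < (eps / 2) ^+ 2.
    have pq : 0 <= 4 * q ^+ 2 - 6 * q + 3 by nra.
    have := mulr_ge0 (sqr_ge0 w) pq; nra.
  have we : w < eps / 2 by rewrite -(@ltr_pXn2r _ 2)// nnegrE ?divr_ge0// ltW.
  have : w * (1 + q) <= w * 2 by rewrite ler_pM2l//; lra.
  lra.
have cp : 0 < c by rewrite lt_neqAle eq_sym cn.
pose k := Num.sqrt c; have k0 : 0 < k by rewrite sqrtr_gt0.
have k2 : k ^+ 2 = c by rewrite sqr_sqrtr.
(* The two summands come from the bounds of the two terms of the factor by multiples of d1, in
   [first_term] and [second_term]; w >= k = sqrt c keeps w^-1 bounded. *)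
pose M := 2 * (1 + 2 * c) / k + 4 * (c + 1).
have M0 : 0 < M by rewrite addr_gt0 ?divr_gt0 ?mulr_gt0//; lra.
pose d1 := Num.min 2^-1 (eps / (2 * M)).
have d10 : 0 < d1 by rewrite lt_min invr_gt0 divr_gt0 ?mulr_gt0// ltr0n.
have d1h : d1 <= 2^-1 by rewrite ge_min lexx.
have d1M : d1 * M < eps.
  have : d1 <= eps / (2 * M) by rewrite ge_min lexx orbT.
  rewrite -(ler_pM2r M0) (_ : eps / (2 * M) * M = eps / 2); last by field; exact: lt0r_neq0.
  lra.
clearbody d1.
exists (Num.min d1 (c * d1 ^+ 2)) => [|u v C S t v0 /(bolt_param_root v0)].
  by rewrite lt_min d10 mulr_gt0 ?exprn_gt0.
move=> [w [w0 w2 u2 wV [/andP[q0 q1] ->]]]; rewrite lt_min => /andP[].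
move: (C ^+ 2) q0 q1 u2 wV => q q0 q1 u2 wV.
move: ((v / 2) ^+ 4) wV => V wV.
set n := `|V - c| => s1 s2.
have n0 : 0 <= n := normr_ge0 _.
have nV : V - c <= n by exact: ler_norm.
have nV' : c - V <= n by rewrite /n distrC; exact: ler_norm.
have u20 : 0 <= u ^+ 2 by exact: sqr_ge0.
(* The identity [e1] controls q: as 2 - q >= 1, c q^2 is at most u^2 + |V - c|. This explains the
   term c d1^2 in the threshold. *)
have cq : c * q ^+ 2 < c * d1 ^+ 2.
  apply: le_lt_trans s2.
  have e1 : c * q ^+ 2 * (2 - q) = u ^+ 2 * (1 - q) ^+ 2 + q * (c - V) by rewrite -wV u2 w2; ring.
  have b1 : c * q ^+ 2 <= c * q ^+ 2 * (2 - q).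
    by rewrite ler_peMr ?mulr_ge0 ?sqr_ge0//; lra.
  have b2 : u ^+ 2 * (1 - q) ^+ 2 <= u ^+ 2.
    by rewrite ler_piMr// expr_le1//; lra.
  have b3 : q * (c - V) <= n.
    by apply: (@le_trans _ _ (q * n)); [exact: ler_wpM2l|exact: ler_piMl].
  lra.
have qd : q < d1 by move: cq; rewrite ltr_pM2l// ltr_pXn2r// nnegrE// ltW.
have q12 : 2 * q <= 1 by have := lt_le_trans qd d1h; lra.
have tb : t ^+ 2 * (1 - q) ^+ 2 <= n + 2 * c * q.
  have -> : t ^+ 2 * (1 - q) ^+ 2 = (V - c) + c * (2 * q - q ^+ 2) by rewrite -wV w2; ring.
  apply: lerD => //; rewrite -subr_ge0 (_ : _ - _ = c * q ^+ 2); last by ring.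
  by rewrite mulr_ge0 ?sqr_ge0.
have td : t ^+ 2 * (1 - q) <= 2 * (1 + 2 * c) * d1.
  have : t ^+ 2 * (1 - q) <= 2 * (t ^+ 2 * (1 - q) ^+ 2).
    have h : 0 <= (1 - q) * (1 - 2 * q) by rewrite mulr_ge0//; lra.
    have := mulr_ge0 (sqr_ge0 t) h; lra.
  have : c * q <= c * d1 by rewrite ler_pM2l// ltW.
  lra.
have kw : k <= w by rewrite -(@ler_pXn2r _ 2)// ?nnegrE ?(ltW k0) ?(ltW w0)// k2 w2 lerDl sqr_ge0.
have first_term : w^-1 * t ^+ 2 * (1 - q) <= 2 * (1 + 2 * c) * d1 / k.
  rewrite -mulrA mulrC; apply: ler_pM => //.
  - by rewrite mulr_ge0 ?sqr_ge0//; lra.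
  - by rewrite invr_ge0 ltW.
  - by rewrite lef_pV2.
have wb : w <= 2 * (c + 1).
  (* The square is V, within 1 of c; since q <= 1/2, w is at most twice w (1 - q). *)
  have : (w * (1 - q)) ^+ 2 <= c + 1 by rewrite exprMn wV; lra.
  have h1 : 0 <= w * (1 - q) by rewrite mulr_ge0 ?(ltW w0)//; lra.
  have h2 : w <= 2 * (w * (1 - q)).
    by rewrite mulrCA ler_peMr ?(ltW w0)//; lra.
  move: (w * (1 - q)) h1 h2 => z h1 h2 z2.
  have : z <= c + 1 by rewrite leNgt; apply/negP => h; nra.
  lra.
have second_term : 2 * w * q <= 4 * (c + 1) * d1.
  by apply: ler_pM => //; [rewrite mulr_ge0// ltW|lra|exact: ltW].
apply: le_lt_trans (lerD first_term second_term) _.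
by rewrite (_ : _ + _ = d1 * M)// /M; field; exact: lt0r_neq0.
Qed.

Lemma bolt_collapses c (P : R -> R^o * R^o * R^o) : 0 <= c -> path_to_singular c P ->
  collapses c (fun tau => bolt c (P tau)).
Proof.
move=> c0 [contP nsP [b1 P1]] eps e0.
have M0 : 0 < 5 * pi ^+ 2 :> R by rewrite mulr_gt0// exprn_gt0// pi_gt0.
have [|d d0 small] := bolt_estimate c0 (_ : 0 < eps ^+ 2 / (5 * pi ^+ 2)).
  by rewrite divr_gt0// exprn_gt0.
(* The quantity of [bolt_estimate] in Cartesian coordinates of the base, hence continuous also where
   v = 0 and the angle is undefined. *)
pose f (x : R^o * R^o * R^o) : R^o := x.1.1 ^+ 2 + `|((x.1.2 ^+ 2 + x.2 ^+ 2) / 4) ^+ 2 - c|.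
have fbase u v b : f (base u v b) = u ^+ 2 + `|(v / 2) ^+ 4 - c|.
  rewrite /f /base /=; congr (_ + `|_ - _|).
  have cs := cos2Dsin2 b.
  have -> : (v * cos b) ^+ 2 + (v * sin b) ^+ 2 = v ^+ 2 by lincomb (v ^+ 2 * dif cs).
  by field.
have f1 : f (P 1) = 0.
  rewrite P1 fbase expr0n add0r mulrAC divff// mul1r powR4// subrr normr0 //.
have cf : continuous f.
  move=> x; have c1 : y.1.1 @[y --> x] --> x.1.1 by apply: cvg_comp; [exact: cvg_fst|exact: cvg_fst].
  have c2 : y.1.2 @[y --> x] --> x.1.2 by apply: cvg_comp; [exact: cvg_fst|exact: cvg_snd].
  have c3 : y.2 @[y --> x] --> x.2 by exact: cvg_snd.
  have sq (g : R^o * R^o * R^o -> R^o) (l : R^o) : g y @[y --> x] --> l -> g y ^+ 2 @[y --> x] --> l ^+ 2.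
    by move=> gl; apply: cvgM.
  apply: cvgD; first exact: (sq (fun y => y.1.1)).
  apply: cvg_norm; apply: cvgB; last exact: cvg_cst.
  apply: (sq (fun y => (y.1.2 ^+ 2 + y.2 ^+ 2) / 4)); apply: cvgM; last exact: cvg_cst.
  by apply: cvgD; [exact: (sq (fun y => y.1.2))|exact: (sq snd)].
have : \forall tau \near 1^'-, f (P tau) < d /\ 0 <= tau < 1.
  have cP : P tau @[tau --> 1^'-] --> P 1.
    by have [] := (continuous_within_itvP P (@ltr01 R)).1 contP.
  have : f (P tau) @[tau --> 1^'-] --> (0 : R^o) by rewrite -f1; apply: cvg_comp cP _; exact: cf.
  move=> /cvgr_lt /(_ _ d0) fd; near=> tau; split; first by near: tau.
  apply/andP; split; near: tau; [exact: nbhs_left_ge|exact: nbhs_left_lt].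
apply: filterS => tau [fd t01].
(* Polar coordinates and parameters are chosen separately for each tau; the estimate depends only on
   f (P tau). *)
have [v [b [v0 _ e1 e2]]] := plane_polar (P tau).1.2 (P tau).2.
have PE : P tau = base (P tau).1.1 v b.
  by rewrite /base -e1 -e2; case: (P tau) => -[].
have ns : ~ ((P tau).1.1 = 0 /\ v = 2 * c `^ (4^-1)).
  move=> [u0 vE]; apply: (nsP tau t01); exists b.
  by rewrite PE u0 vE.
have [C [S [t Pm]]] := bolt_param_exists c0 v0 ns.
rewrite PE fbase in fd.
have := small _ _ _ _ _ v0 Pm fd; rewrite ltr_pdivlMr// => lt_eps.
by rewrite PE; exact: (bolt_path c0 v0 ns Pm lt_eps).
Unshelve. all: by end_near. Qed.

End Limit.

Theorem proposition5p21 (R : realType) (c : R) (hc : 0 <= c) :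
  (forall u v beta : R, 0 <= v -> ~ singular c (base u v beta) ->
     SLag_in_fibre c u v beta (bolt c (base u v beta))) /\
  (forall P : R -> R^o * R^o * R^o, path_to_singular c P ->
     exists Sigma, vanishing_cycle c P Sigma /\
     forall u v beta : R, 0 <= v -> P 0 = base u v beta ->
       SLag_in_fibre c u v beta Sigma).
Proof.
split=> [u v b v0 ns|P pP]; first exact: bolt_SLag.
exists (bolt c (P 0)); split; first by split=> //; exact: bolt_collapses.
have [_ ns _] := pP; have := ns 0; rewrite lexx ltr01 => /(_ isT) ns0.
by move=> u v b v0 PE; rewrite PE in ns0 *; exact: bolt_SLag.
Qed.
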